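(* Let $E\to M$ be a vector bundle. For every linear generalised complex structure $\mathcal J$ on $E$, with side morphism $j\colon TM\oplus E^*\to TM\oplus E^*$, there is a skew-symmetric $(TM\oplus E^* )$-Dorfman connection $\Delta$ on $E\oplus T^*M$ such that $\mathcal J(\sigma^\Delta(\nu))=\sigma^\Delta(j\nu)$ for all $\nu\in\Gamma(TM\oplus E^* )$.
   Context: Manifolds and vector bundles are smooth and real. For $q_E\colon E\to M$, $TE$ is a vector bundle over $E$ and over $TM$ (projection $Tq_E$), and $T^*E$ is a vector bundle over $E$ and over $E^*$ (projection $\langle r_E(\theta_{e_m}),e'_m\rangle=\theta_{e_m}(\frac{d}{dt}|_{0}(e_m+te'_m))$). So $TE\oplus T^*E$ (sum over $E$) is a double vector bundle with sides $E$, $TM\oplus E^*$ and core $E\oplus T^*M$. Core sections: $(e,\theta)^\uparrow(e'_m)=(\frac{d}{dt}|_{0}(e'_m+te(m)),(T_{e'_m}q_E)^t\theta(m))$. Duality: $\langle(X,\epsilon),(e,\theta)\rangle=\epsilon(e)+\theta(X)$. $TE\oplus T^*E\to E$ is the standard Courant algebroid over $E$ (pairing $\langle(v,\theta),(w,\omega)\rangle=\theta(w)+\omega(v)$, bracket $[\![(X,\theta),(Y,\omega)]\!]=([X,Y],\mathcal L_X\omega-\iota_Yd\theta)$). A generalised complex structure on $E$ is a vector bundle morphism $\mathcal J$ of $TE\oplus T^*E$ over $\mathrm{id}_E$ with $\mathcal J^2=-1$, orthogonal, with $[\![e_1,e_2]\!]-[\![\mathcal Je_1,\mathcal Je_2]\!]+\mathcal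 J([\![\mathcal Je_1,e_2]\!]+[\![e_1,\mathcal Je_2]\!])=0$. It is linear if it is also a vector bundle morphism of $TE\oplus T^*E\to TM\oplus E^*$ over a map $j$ of $TM\oplus E^*$, its side morphism. A Dorfman $TM\oplus E^*$-connection on $E\oplus T^*M$ is an $\mathbb R$-bilinear $\Delta\colon\Gamma(TM\oplus E^* )\times\Gamma(E\oplus T^*M)\to\Gamma(E\oplus T^*M)$ with $\Delta_\nu(f\tau)=f\Delta_\nu\tau+\mathrm{pr}_{TM}(\nu)(f)\tau$, $\Delta_{f\nu}\tau=f\Delta_\nu\tau+\langle\nu,\tau\rangle(0,df)$, $\Delta_\nu(0,df)=(0,d(\mathrm{pr}_{TM}(\nu)(f)))$. Its dual dull bracket $[\![\cdot,\cdot]\!]_\Delta$ on $\Gamma(TM\oplus E^* )$ is defined by $\mathrm{pr}_{TM}(\nu_1)\langle\nu_2,\tau\rangle=\langle[\![\nu_1,\nu_2]\!]_\Delta,\tau\rangle+\langle\nu_2,\Delta_{\nu_1}\tau\rangle$; $\Delta$ is skew-symmetric if $[\![\cdot,\cdot]\!]_\Delta$ is. The horizontal lift $\sigma^\Delta\colon\Gamma(TM\oplus E^* )\to\Gamma_E(TE\oplus T^*E)$ is $\sigma^\Delta(X,\epsilon)(e(m))=(T_me\,X(m),d\ell_\epsilon(e(m)))-(\Delta_{(X,\epsilon)}(e,0))^\uparrow(e(m))$ for $e\in\Gamma(E)$, $\ell_\epsilon\colon E\to\mathbb R$ being the linear function defined by $\epsilon$. *)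

(* Defs.v *)
From mathcomp Require Import all_boot all_order all_algebra.
From mathcomp Require Import all_classical all_reals all_analysis.

Set Implicit Arguments.
Unset Strict Implicit.
Unset Printing Implicit Defensive.

Import Order.TTheory GRing.Theory Num.Theory.
Import numFieldNormedType.Exports.
Local Open Scope classical_set_scope.
Local Open Scope ring_scope.

(** * Smooth maps between normed spaces *)

(* The space V is 'rV_n or R below, so C^k in terms of all iterated directional
   derivatives is the usual notion on an open set U. *)
Fixpoint Ck (R : realType) (V W : normedModType R) (k : nat) (U : set V)
    (f : V -> W) : Prop :=
  (forall x, U x -> {for x, continuous f}) /\
  if k is k'.+1 then
    forall v : V, (forall x, U x -> derivable f x v) /\
      Ck k' U (fun x => 'D_v f x : W)
  else True.

Definition smooth_on (R : realType) (V W : normedModType R) (U : set V)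
    (f : V -> W) : Prop := forall k, Ck k U f.

(** * Manifolds *)

(* A homeomorphism from an open subset of M to an open subset of R^n; the
   values of coord outside dom, and of param outside coord @` dom, are junk. *)
Record chart (R : realType) (n : nat) (M : topologicalType) := Chart {
  dom : set M;
  coord : M -> 'rV[R]_n;
  param : 'rV[R]_n -> M;
  dom_open : open dom;
  img_open : open (coord @` dom);
  coordK : forall p, dom p -> param (coord p) = p;
  coord_continuous : forall p, dom p -> {for p, continuous coord};
  param_continuous :
    forall y, (coord @` dom) y -> {for y, continuous param} }.

Definition compatible (R : realType) (n : nat) (M : topologicalType)
    (c d : chart R n M) : Prop :=
  smooth_on (coord c @` (dom c `&` dom d)) (coord d \o param c) /\
  smooth_on (coord d @` (dom c `&` dom d)) (coord c \o param d).

Record manifold (R : realType) (n : nat) := Manifold {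
  mspace :> topologicalType;
  mfd_hausdorff : hausdorff_space mspace;
  mfd_countable : @second_countable mspace;
  atlas : set (chart R n mspace);
  atlas_cover : forall p : mspace, exists2 c, atlas c & dom c p;
  atlas_compatible : forall c d, atlas c -> atlas d -> compatible c d;
  atlas_maximal :
    forall c, (forall d, atlas d -> compatible c d) -> atlas c }.

Definition smooth_fun (R : realType) (n : nat) (M : manifold R n)
    (f : M -> R) : Prop :=
  forall c, @atlas _ _ M c -> smooth_on (coord c @` dom c) (f \o param c).

Definition smooth_map (R : realType) (m n : nat) (M : manifold R m)
    (N : manifold R n) (F : M -> N) : Prop :=
  continuous F /\
  forall c d, @atlas _ _ M c -> @atlas _ _ N d ->
    smooth_on (coord c @` (dom c `&` F @^-1` dom d))
      (coord d \o F \o param c).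

Definition smooth_curve (R : realType) (n : nat) (M : manifold R n)
    (g : R -> M) : Prop :=
  continuous g /\
  forall c, @atlas _ _ M c -> smooth_on (g @^-1` dom c) (coord c \o g).

(** * Tangent and cotangent vectors *)

(* Tangent vectors at p are derivations of C^oo(M) at p.  They are represented
   by functionals on all of M -> R that vanish on non-smooth functions, and
   cotangent vectors by functionals on tvec M that vanish outside T_pM, so that
   the Leibniz equality of Rocq is equality of (co)tangent vectors and T_pM,
   T_p^*M are linear subspaces of the lmodTypes tvec M, covec M. *)
Definition tvec (R : realType) (n : nat) (M : manifold R n) : Type :=
  (M -> R) -> R.
Definition covec (R : realType) (n : nat) (M : manifold R n) : Type :=
  tvec M -> R.
(* ambient type of the fibres of TM (+) T^*M *)
Definition gvec (R : realType) (n : nat) (M : manifold R n) : Type :=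
  (tvec M * covec M)%type.

Section Tangent.
Context (R : realType) (n : nat) (M : manifold R n).

Definition tangent (p : M) : set (tvec M) := [set v |
  [/\ (forall (a : R) f g, smooth_fun f -> smooth_fun g ->
        v (fun x => a * f x + g x) = a * v f + v g),
      (forall f g, smooth_fun f -> smooth_fun g ->
        v (fun x => f x * g x) = f p * v g + g p * v f) &
      (forall f, ~ smooth_fun f -> v f = 0)]].

Definition cotangent (p : M) : set (covec M) := [set th |
  (forall (a : R) v w, tangent p v -> tangent p w ->
     th (a *: v + w) = a * th v + th w) /\
  (forall v, ~ tangent p v -> th v = 0)].

Definition gtangent (p : M) : set (gvec M) := [set xi |
  tangent p xi.1 /\ cotangent p xi.2].

Definition gpair (xi eta : gvec M) : R := xi.2 eta.1 + eta.2 xi.1.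

Definition velocity (g : R -> M) : tvec M :=
  fun f => if `[< smooth_fun f >] then (f \o g)^`()%classic 0 else 0.

Definition dfun (f : M -> R) (p : M) : covec M :=
  fun v => if `[< tangent p v >] then v f else 0.

Definition vfield (X : M -> tvec M) : Prop :=
  (forall p, tangent p (X p)) /\
  (forall f, smooth_fun f -> smooth_fun (fun p => X p f)).

Definition form1 (om : M -> covec M) : Prop :=
  (forall p, cotangent p (om p)) /\
  (forall X, vfield X -> smooth_fun (fun p => om p (X p))).

Definition gsection (s : M -> gvec M) : Prop :=
  vfield (fun p => (s p).1) /\ form1 (fun p => (s p).2).

Definition lie (X Y : M -> tvec M) : M -> tvec M :=
  fun p f => X p (fun x => Y x f) - Y p (fun x => X x f).

Definition vfield_through (p : M) (v : tvec M) : M -> tvec M :=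
  xget (fun _ : M => (fun _ => 0) : (M -> R) -> R)
    [set Z : M -> (M -> R) -> R | vfield Z /\ Z p = v].

(* The 1-form with om(Z) = A Z for all vector fields Z, for A linear over
   C^oo(M): then A Z p depends only on the value of Z at p. *)
Definition form_of (A : (M -> tvec M) -> M -> R) : M -> covec M :=
  fun p v => if `[< tangent p v >] then A (vfield_through p v) p else 0.

Definition lie_form (X : M -> tvec M) (om : M -> covec M) : M -> covec M :=
  form_of (fun Z p => X p (fun x => om x (Z x)) - om p (lie X Z p)).

(* iota_Y (d th) *)
Definition contract_d (Y : M -> tvec M) (th : M -> covec M) : M -> covec M :=
  form_of (fun Z p => Y p (fun x => th x (Z x)) - Z p (fun x => th x (Y x))
                      - th p (lie Y Z p)).

Definition courant (s1 s2 : M -> gvec M) : M -> gvec M :=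
  let X p := (s1 p).1 in let th p := (s1 p).2 in
  let Y p := (s2 p).1 in let om p := (s2 p).2 in
  fun p => (lie X Y p, lie_form X om p - contract_d Y th p).

(* A bundle endomorphism over the identity is a family of linear maps of the
   fibres that sends smooth sections to smooth sections. *)
Definition gendomorphism (J : M -> gvec M -> gvec M) : Prop :=
  [/\ (forall p xi, gtangent p xi -> gtangent p (J p xi)),
      (forall p (a : R) xi eta, gtangent p xi -> gtangent p eta ->
         J p (a *: xi + eta) = a *: J p xi + J p eta) &
      (forall s, gsection s -> gsection (fun p => J p (s p)))].

Definition gcs (J : M -> gvec M -> gvec M) : Prop :=
  let JS (s : M -> gvec M) := fun p => J p (s p) in
  [/\ gendomorphism J,
      (forall p xi, gtangent p xi -> J p (J p xi) = - xi),
      (forall p xi eta, gtangent p xi -> gtangent p eta ->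
         gpair (J p xi) (J p eta) = gpair xi eta) &
      (forall s1 s2, gsection s1 -> gsection s2 -> forall p,
         courant s1 s2 p - courant (JS s1) (JS s2) p
         + J p (courant (JS s1) s2 p + courant s1 (JS s2) p) = 0)].

End Tangent.

(* the tangent map of F *)
Definition push (R : realType) (m n : nat) (M : manifold R m)
    (N : manifold R n) (F : M -> N) (v : tvec M) : tvec N :=
  fun f => if `[< smooth_fun f >] then v (f \o F) else 0.

(** * Vector bundles *)

(* The manifold tot is the disjoint union of the vector spaces fibre m, and is
   covered by charts of the form (m, x) |-> (coord c m, phi_m x) with phi_m a
   linear isomorphism fibre m -> R^k: these are the local trivialisations over
   chart domains. *)
Record vbundle (R : realType) (n : nat) (M : manifold R n) (k : nat) :=
  VBundle {
    tot :> manifold R (n + k);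
    fibre : M -> lmodType R;
    inc : {m : M & fibre m} -> tot;
    split_tot : tot -> {m : M & fibre m};
    incK : cancel inc split_tot;
    split_totK : cancel split_tot inc;
    vb_trivial : forall m0 : M, exists c d,
      [/\ @atlas _ _ M c, @atlas _ _ tot d, dom c m0,
          dom d = [set p | dom c (tag (split_tot p))] &
          forall m, dom c m ->
            exists phi : {linear fibre m -> 'rV[R]_k}, bijective phi /\
            forall x : fibre m,
              coord d (inc (Tagged fibre x)) = row_mx (coord c m) (phi x)] }.

Section Bundle.
Context (R : realType) (n k : nat) (M : manifold R n) (E : vbundle M k).

Definition qE (p : E) : M := tag (split_tot p).

Definition pt (m : M) (x : fibre E m) : E := inc (Tagged (fibre E) x).

(* ambient types of the fibres of TM (+) E^* and E (+) T^*M over m *)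
Definition sideT (m : M) : Type := (tvec M * (fibre E m -> R))%type.
Definition coreT (m : M) : Type := (fibre E m * covec M)%type.

Definition esection (e : forall m, fibre E m) : Prop :=
  smooth_map (fun m => pt (e m) : E).

Definition side_section (nu : forall m, sideT m) : Prop :=
  [/\ vfield (fun m => (nu m).1),
      (forall m (a : R) x y,
         (nu m).2 (a *: x + y) = a * (nu m).2 x + (nu m).2 y) &
      (forall e, esection e -> smooth_fun (fun m => (nu m).2 (e m)))].

Definition core_section (tau : forall m, coreT m) : Prop :=
  esection (fun m => (tau m).1) /\ form1 (fun m => (tau m).2).

Definition duality (nu : forall m, sideT m) (tau : forall m, coreT m) (m : M) :
    R := (nu m).2 (tau m).1 + (tau m).2 (nu m).1.

(* ell_eps *)
Definition ell (eps : forall m, fibre E m -> R) (p : E) : R :=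
  eps (tag (split_tot p)) (tagged (split_tot p)).

Definition vertical (m : M) (x y : fibre E m) : tvec E :=
  velocity (fun t : R => pt (x + t *: y)).

Definition core_up (m : M) (tau : coreT m) (x : fibre E m) : gvec E :=
  (vertical x tau.1,
   fun v => if `[< tangent (pt x) v >] then tau.2 (push qE v) else 0).

(** ** The double vector bundle TE (+) T^*E *)

(* the projection to TM (+) E^*, restricted to the fibre over x *)
Definition side_proj (m : M) (x : fibre E m) (xi : gvec E) : sideT m :=
  (push qE xi.1, fun y => xi.2 (vertical x y)).

(* u = v + w in TE -> TM: the tangent map of the addition of E (x)_M E, whose
   tangent vectors are the velocities of pairs of curves over one curve in M *)
Definition tsum (m : M) (x y : fibre E m) (v w u : tvec E) : Prop :=
  exists (c : R -> M) (a b : forall t, fibre E (c t)),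
    [/\ smooth_curve (fun t => pt (a t) : E),
        smooth_curve (fun t => pt (b t) : E),
        pt (a 0) = pt x /\ pt (b 0) = pt y &
        [/\ v = velocity (fun t => pt (a t)), w = velocity (fun t => pt (b t))
          & u = velocity (fun t => pt (a t + b t))]].

(* the tangent map of the multiplication by l in E *)
Definition tscale (l : R) (v : tvec E) : tvec E :=
  push (fun p : E => pt (l *: tagged (split_tot p)) : E) v.

(* zeta = xi + eta in TE (+) T^*E -> TM (+) E^*; in T^*E -> E^* the sum of
   th, om is determined by (th + om)(v + w) = th v + om w, with v + w in
   TE -> TM *)
Definition gsum (m : M) (x y : fibre E m) (xi eta zeta : gvec E) : Prop :=
  [/\ side_proj x xi = side_proj y eta,
      tsum x y xi.1 eta.1 zeta.1 &
      forall v w u, tangent (pt x) v -> tangent (pt y) w -> tsum x y v w u ->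
        zeta.2 u = xi.2 v + eta.2 w].

(* zeta = l . xi in TE (+) T^*E -> TM (+) E^*; the value of zeta.2 on vertical
   vectors is redundant unless l = 0 *)
Definition gscale (m : M) (x : fibre E m) (l : R) (xi zeta : gvec E) : Prop :=
  [/\ side_proj (l *: x) zeta = side_proj x xi,
      zeta.1 = tscale l xi.1 &
      forall v, tangent (pt x) v -> zeta.2 (tscale l v) = l * xi.2 v].

(* Since J is over the identity of E, j is automatically over that of M. *)
Definition linear_over (J : E -> gvec E -> gvec E)
    (j : forall m, sideT m -> sideT m) : Prop :=
  [/\ (forall m (x : fibre E m) xi, gtangent (pt x) xi ->
         side_proj x (J (pt x) xi) = j m (side_proj x xi)),
      (forall m (x y : fibre E m) xi eta zeta,
         gtangent (pt x) xi -> gtangent (pt y) eta ->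
         gtangent (pt (x + y)) zeta -> gsum x y xi eta zeta ->
         gsum x y (J (pt x) xi) (J (pt y) eta) (J (pt (x + y)) zeta)) &
      (forall m (x : fibre E m) l xi zeta,
         gtangent (pt x) xi -> gtangent (pt (l *: x)) zeta ->
         gscale x l xi zeta ->
         gscale x l (J (pt x) xi) (J (pt (l *: x)) zeta))].

Definition linear_gcs (J : E -> gvec E -> gvec E)
    (j : forall m, sideT m -> sideT m) : Prop :=
  gcs J /\ linear_over J j.

(** ** Dorfman connections *)

(* Maps of sections are defined on all families; only their values on smooth
   sections matter. *)
Definition connection_type : Type :=
  (forall m, sideT m) -> (forall m, coreT m) -> forall m, coreT m.

Definition core_d (f : M -> R) (m : M) : coreT m := (0, dfun f m).

Definition dorfman_connection (D : connection_type) : Prop :=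
  (forall nu tau, side_section nu -> core_section tau ->
     core_section (D nu tau)) /\
  [/\ (forall (a : R) nu nu' tau,
         side_section nu -> side_section nu' -> core_section tau ->
         forall m, D (fun m => a *: nu m + nu' m) tau m =
                   a *: D nu tau m + D nu' tau m),
      (forall (a : R) nu tau tau',
         side_section nu -> core_section tau -> core_section tau' ->
         forall m, D nu (fun m => a *: tau m + tau' m) m =
                   a *: D nu tau m + D nu tau' m),
      (forall f nu tau,
         smooth_fun f -> side_section nu -> core_section tau ->
         forall m, D nu (fun m => f m *: tau m) m =
                   f m *: D nu tau m + (nu m).1 f *: tau m),
      (forall f nu tau,
         smooth_fun f -> side_section nu -> core_section tau ->
         forall m, D (fun m => f m *: nu m) tau m =
                   f m *: D nu tau m + duality nu tau m *: core_d f m) &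
      (forall f nu, smooth_fun f -> side_section nu ->
         forall m, D nu (core_d f) m = core_d (fun x => (nu x).1 f) m)].

Definition dual_dull_bracket (D : connection_type)
    (br : (forall m, sideT m) -> (forall m, sideT m) -> forall m, sideT m) :
    Prop :=
  forall nu1 nu2, side_section nu1 -> side_section nu2 ->
    side_section (br nu1 nu2) /\
    forall tau, core_section tau -> forall m,
      (nu1 m).1 (duality nu2 tau) =
      duality (br nu1 nu2) tau m + duality nu2 (D nu1 tau) m.

(* The dual dull bracket exists and is unique on smooth sections. *)
Definition skew_symmetric (D : connection_type) : Prop :=
  exists2 br, dual_dull_bracket D br &
    forall nu1 nu2, side_section nu1 -> side_section nu2 ->
      forall m, br nu1 nu2 m = - br nu2 nu1 m.

(* Every point of E is e(m) for some section e, so this determines sg nu for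
   every section nu. *)
Definition horizontal_lift (D : connection_type)
    (sg : (forall m, sideT m) -> E -> gvec E) : Prop :=
  forall nu e, side_section nu -> esection e -> forall m,
    sg nu (pt (e m)) =
    ((push (fun x => pt (e x) : E) (nu m).1,
      dfun (ell (fun x => (nu x).2)) (pt (e m))) : gvec E)
    - core_up (D nu (fun x => (e x, 0)) m) (e m).

End Bundle.

(* Main.v *)
Require Import Defs.
From HB Require Import structures.
From mathcomp Require Import all_boot all_order all_algebra.
From mathcomp Require Import all_classical all_reals all_analysis.
From mathcomp Require Import lra ring.

(* A linear connection nabla on E, built from a locally finite frame, splits
   TE (+) T^*E into lifts sigma nu of side sections and core elements.  In this
   splitting J (sigma nu) = sigma (j nu) + core (Phi nu), where Phi is tensorial,
   linear in the point of E by linearity of J, and skew for the duality pairing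
   by orthogonality.  From J^2 = -1 one gets J (core (Phi nu)) =
   - core (Phi (j nu)) and <nu', Phi (j nu)> = <j nu', Phi nu>, so that
   Phi (j nu) is again skew.  Hence adding 1/2 Phi (j nu) to the standard
   Dorfman connection of nabla keeps it skew-symmetric, while it replaces
   sigma nu by sigma nu - 1/2 core (Phi (j nu)), which J maps to
   sigma (j nu) + 1/2 core (Phi nu), the new lift of j nu. *)

Set Implicit Arguments.
Unset Strict Implicit.
Unset Printing Implicit Defensive.
Import Order.TTheory GRing.Theory Num.Theory.
Import numFieldNormedType.Exports.
Local Open Scope classical_set_scope.
Local Open Scope ring_scope.
Local Notation coord := Defs.coord.

(** * Functions of class C^k *)

(** The constant 1/2 is that of a midpoint. Linear lifts of side sections form an affine space,
    which the affine map taking [sigma] to [nu |-> - J (sigma (j nu))] sends to itself; [J^2 = -1]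
    and [j^2 = -1] make this map an involution, and its fixed points are the lifts with
    [J (sigma nu) = sigma (j nu)]. Since [- J (sigma (j nu)) = sigma nu - core (Phi (j nu))], the
    corrected lift is the midpoint of [sigma] and its image, hence fixed. Skew-symmetry of the dual
    dull bracket means that the lift has isotropic image; core elements being isotropic, this
    condition is affine, and orthogonality of [J] preserves it. The connection is not glued from
    local ones: the frame makes [E] a summand of a trivial bundle with one factor per index, and the
    trivial connection is projected to [E]. Tangent vectors are derivations, whereas sums in
    [TE -> TM] are defined by curves. Linearity of [Phi] therefore needs horizontal lifts as
    velocities of curves in [E]; this is why Hadamard's lemma and curves with prescribed velocity
    are developed. *)

Section DirectionalDerivative.
Context {R : realType}.
Implicit Types V W Z : normedModType R.

Lemma derive_line V W (f : V -> W) x v :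
  'D_v f x = (fun t : R => f (t *: v + x))^`()%classic 0.
Proof.
rewrite /derive1 /derive; set a := (fun h => _); set b := (fun h => _).
suff -> : a = b by [].
by apply/funext => t; rewrite /a /b /= addr0 scale0r add0r.
Qed.

(** [f] is only derivable along [v], so the chain rule is applied to its restriction to a line, a
    map of one real variable, where derivable and differentiable agree. *)
Lemma is_derive_diff_comp V W Z (g : W -> Z) (f : V -> W) x v :
  derivable f x v -> differentiable g (f x) ->
  is_derive x v (g \o f) ('d g (f x) ('D_v f x)).
Proof.
move=> df dg.
set h := (fun t : R => f (t *: v + x)).
have h0 : h 0 = f x by rewrite /h scale0r add0r.
have dh : differentiable h 0 by apply/derivable1_diffP; exact: (derivable1P f x v).1.
have dgh : differentiable (g \o h) 0 by apply: differentiable_comp; rewrite ?h0.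
split; first by apply/derivable1P/derivable1_diffP.
rewrite !derive_line -/h -[(fun t : R => _)]/(g \o h) derive1E' //.
by rewrite diff_comp ?h0 // (derive1E' dh).
Qed.

Lemma is_derive_linear_comp V W Z (l : {linear W -> Z}) (f : V -> W) x v :
  continuous l -> derivable f x v ->
  is_derive x v (fun y => l (f y)) (l ('D_v f x)).
Proof.
move=> cl df; have dl := linear_differentiable (f x) cl.
have := is_derive_diff_comp df dl.
by rewrite diff_lin.
Qed.

(** The line is reparametrised by [t * c], which also covers [c = 0]. *)
Lemma is_derive_scale V W (f : V -> W) x v (c : R) :
  derivable f x v -> is_derive x (c *: v) f (c *: 'D_v f x).
Proof.
move=> df; set h := (fun t : R => f (t *: v + x)).
have dh : derivable h 0 1 by exact: (derivable1P f x v).1.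
set m := (fun t : R => t * c).
have m0 : m 0 = 0 by rewrite /m mul0r.
have hm : is_derive (0 : R) 1 m c.
  apply: is_derive_eq; by rewrite /GRing.scale /= mulr0 add0r mulr1.
have dm : derivable m 0 1 by [].
have dh' : differentiable h (m 0) by rewrite m0; apply/derivable1_diffP.
have [] := is_derive_diff_comp dm dh'; rewrite m0.
have -> : h \o m = (fun t : R => f (t *: (c *: v) + x)).
  by apply/funext => t; rewrite /h/m/= scalerA.
move=> d1 d2; split; first exact/derivable1P.
by rewrite !derive_line -/h derive1E d2 derive_val deriv1E.
Qed.

End DirectionalDerivative.

Section Ck.
Context {R : realType}.
Implicit Types V W Z : normedModType R.

Lemma Ck_sub V W k (U U' : set V) (f : V -> W) :
  U' `<=` U -> Ck k U f -> Ck k U' f.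
Proof.
move=> UU; elim: k f => [|k IH] f [cf df]; split=> //; first by move=> x /UU /cf.
  by move=> x /UU /cf.
by move=> v; have [d1 d2] := df v; split; [move=> x /UU /d1|exact: IH].
Qed.

Lemma Ck_near_eq V W (U : set V) (f g : V -> W) x :
  open U -> (forall x, U x -> f x = g x) -> U x -> \near x, f x = g x.
Proof. by move=> oU fg Ux; apply: (filterS fg); apply: open_nbhs_nbhs. Qed.

Lemma near_eq_derive0 V W (f g : V -> W) x v :
  (\near x, f x = g x) ->
  (derivable f x v -> derivable g x v) /\ 'D_v f x = 'D_v g x.
Proof.
move=> fg; have [->|v0] := eqVneq v 0.
  by split; [move=> _; exact: derivable0|rewrite !derive0].
by split; [exact: near_eq_derivable|exact: near_eq_derive].
Qed.

Lemma Ck_eq V W k (U : set V) (f g : V -> W) :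
  open U -> (forall x, U x -> f x = g x) -> Ck k U f -> Ck k U g.
Proof.
move=> oU; elim: k f g => [|k IH] f g fg [cf df].
  split=> // x Ux; rewrite /prop_for /continuous_at -(fg _ Ux).
  apply: cvg_trans (cf _ Ux); apply: near_eq_cvg.
  exact: (Ck_near_eq oU fg Ux).
split.
  move=> x Ux; rewrite /prop_for /continuous_at -(fg _ Ux).
  apply: cvg_trans (cf _ Ux); apply: near_eq_cvg.
  exact: (Ck_near_eq oU fg Ux).
move=> v; have [d1 d2] := df v.
have fgx x (Ux : U x) := near_eq_derive0 v (Ck_near_eq oU fg Ux).
split; first by move=> x Ux; apply: (fgx x Ux).1; exact: d1.
by apply: IH d2 => x Ux; apply: (fgx x Ux).2.
Qed.

Lemma Ck_pred V W k (U : set V) (f : V -> W) : Ck k.+1 U f -> Ck k U f.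
Proof.
elim: k f => [|k IH] f [cf df]; split=> // v.
by have [d1 d2] := df v; split=> //; exact: IH.
Qed.

Lemma Ck_local V W k (U : set V) (f : V -> W) :
  (forall x, U x -> exists2 U', U' x & Ck k U' f) -> Ck k U f.
Proof.
elim: k f => [|k IH] f H.
  by split=> // x /H[U' U'x [c _]]; exact: c.
split; first by move=> x /H[U' U'x [c _]]; exact: c.
move=> v; split; first by move=> x /H[U' U'x [_ /(_ v)[d _]]]; exact: d.
by apply: IH => x /H[U' U'x [_ /(_ v)[_ d]]]; exists U'.
Qed.

Lemma Ck_cst V W k (U : set V) (c : W) : Ck k U (fun=> c).
Proof.
elim: k c => [|k IH] c; split=> //; try by move=> x _; exact: cvg_cst.
move=> v; split; first by move=> x _; exact: derivable_cst.
rewrite (_ : 'D_v (fun=> c) = fun=> 0); first exact: IH.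
by apply/funext => x; exact: derive_cst.
Qed.

Lemma Ck_linear V W k (U : set V) (l : {linear V -> W}) :
  continuous l -> Ck k U l.
Proof.
move=> cl; case: k => [|k]; split=> //; try by move=> x _; exact: cl.
move=> v; have dl x := linear_differentiable x cl.
split; first by move=> x _; exact: diff_derivable.
rewrite (_ : 'D_v l = fun=> l v); first exact: Ck_cst.
by apply/funext => x; rewrite deriveE // diff_lin.
Qed.

Lemma Ck_comp_linear V W Z k (U : set V) (l : {linear W -> Z}) (f : V -> W) :
  open U -> continuous l -> Ck k U f -> Ck k U (fun x => l (f x)).
Proof.
move=> oU cl; elim: k f => [|k IH] f [cf df].
  split=> // x Ux; apply: continuous_comp; [exact: cf|exact: cl].
split.
  move=> x Ux; apply: continuous_comp; [exact: cf|exact: cl].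
move=> v; have [d1 d2] := df v; split.
  by move=> x /d1 d; have [] := is_derive_linear_comp cl d.
apply: Ck_eq (IH _ d2) => // x /d1 d.
by have [_ ->] := is_derive_linear_comp cl d.
Qed.

Lemma CkD V W k (U : set V) (f g : V -> W) : open U ->
  Ck k U f -> Ck k U g -> Ck k U (fun x => f x + g x).
Proof.
move=> oU; elim: k f g => [|k IH] f g [cf df] [cg dg].
  by split=> // x Ux; apply: continuousD; [exact: cf|exact: cg].
split; first by move=> x Ux; apply: continuousD; [exact: cf|exact: cg].
move=> v; have [d1 d2] := df v; have [e1 e2] := dg v; split.
  by move=> x Ux; apply: derivableD; [exact: d1|exact: e1].
apply: Ck_eq (IH _ _ d2 e2) => // x Ux.
by rewrite -(deriveD (d1 _ Ux) (e1 _ Ux)).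
Qed.

Lemma CkM V k (U : set V) (f g : V -> R) : open U ->
  Ck k U f -> Ck k U g -> Ck k U (fun x => f x * g x).
Proof.
move=> oU; elim: k f g => [|k IH] f g cdf cdg.
  have [cf df] := cdf; have [cg dg] := cdg.
  by split=> // x Ux; apply: continuousM; [exact: cf|exact: cg].
have cf' := Ck_pred cdf; have cg' := Ck_pred cdg.
case: cdf => cf df; case: cdg => cg dg.
split; first by move=> x Ux; apply: continuousM; [exact: cf|exact: cg].
move=> v; have [d1 d2] := df v; have [e1 e2] := dg v; split.
  by move=> x Ux; apply: derivableM; [exact: d1|exact: e1].
apply: Ck_eq (CkD oU (IH _ _ cf' e2) (IH _ _ cg' d2)) => // x Ux.
by rewrite -[(fun x => f x * g x)]/(f * g) (deriveM (d1 _ Ux) (e1 _ Ux)).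
Qed.

Lemma Ck_sum V W k (U : set V) I (r : seq I) (P : pred I) (F : I -> V -> W) :
  open U -> (forall i, P i -> Ck k U (F i)) ->
  Ck k U (fun x => \sum_(i <- r | P i) F i x).
Proof.
move=> oU cF; elim: r => [|i r IH].
  by apply: Ck_eq (Ck_cst _ _ 0) => // x _; rewrite big_nil.
case: (boolP (P i)) => Pi.
  by apply: Ck_eq (CkD oU (cF i Pi) IH) => // x _; rewrite big_cons Pi.
by apply: Ck_eq IH => // x _; rewrite big_cons (negPf Pi).
Qed.

Lemma Ck_scalel V W k (U : set V) (f : V -> R) (w : W) : open U ->
  Ck k U f -> Ck k U (fun x => f x *: w).
Proof.
move=> oU cf.
have sx_lin : linear (fun a : R => a *: w).
  by move=> u y z; rewrite scalerDl scalerA.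
pose sxlM := GRing.isLinear.Build _ _ _ _ _ sx_lin.
pose sxL : {linear R -> W} := HB.pack (fun a : R => a *: w) sxlM.
by apply: (@Ck_comp_linear _ R W _ _ sxL) => //; exact: scalel_continuous.
Qed.

Lemma Ck_rowP V n k (U : set V) (F : V -> 'rV[R]_n) : open U ->
  Ck k U F <-> (forall a, Ck k U (fun x => F x 0 a)).
Proof.
move=> oU; split=> [cF a|cF].
  have @f : {linear 'rV[R]_n -> R}.
    by exists (fun N : 'rV[R]_n => N 0 a); do 2![eexists]; do ?[constructor];
     rewrite ?mxE// => ? *; rewrite ?mxE//; move=> ?; rewrite !mxE.
  apply: (@Ck_comp_linear _ _ _ _ _ f) => //; exact: coord_continuous.
have := Ck_sum (k := k) (index_enum _) oU
  (fun (a : 'I_n) (_ : xpredT a) => Ck_scalel (delta_mx 0 a) oU (cF a)).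
move=> /(_ 0%N); apply: Ck_eq => // x _; rewrite [RHS]matrix_sum_delta big_ord1 //.
Qed.
End Ck.

(** * Differentiability of C^1 functions and the chain rule for C^k functions *)

Section C1.
Context {R : realType}.
Implicit Types V W Z : normedModType R.

Lemma is_derive_line V W (f : V -> W) x w (t : R) :
  derivable f (t *: w + x) w ->
  is_derive t 1 (fun s : R => f (s *: w + x)) ('D_w f (t *: w + x)).
Proof.
rewrite /derivable => df.
have e : (fun h : R => h^-1 *: ((f \o shift (t *: w + x)) (h *: w)
    - f (t *: w + x))) =
  (fun h : R => h^-1 *: (((fun s : R => f (s *: w + x)) \o shift t) (h *: 1)
    - f (t *: w + x))).
  by apply/funext => h /=; rewrite [_%:A]mulr1 scalerDl addrA.
by rewrite e in df; split; rewrite /derivable // /derive e.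
Qed.

Lemma MVT01 (h dh : R -> R) :
  (forall t : R, t \in `[0, 1] -> is_derive t 1 h (dh t)) ->
  exists2 t : R, t \in `[0, 1] & h 1 - h 0 = dh t.
Proof.
move=> H.
have d (t : R) : t \in `]0, 1[ -> is_derive t 1 h (dh t).
  by move=> /subset_itv_oo_cc/H.
have c : {within `[0, 1], continuous h}.
  by apply: derivable_within_continuous => t /H[].
have [t t01 E] := @MVT_segment R h dh 0 1 ler01 d c.
by exists t => //; rewrite E subr0 mulr1.
Qed.

Lemma MVT_line V (f : V -> R) x w :
  (forall t : R, t \in `[0, 1] -> derivable f (t *: w + x) w) ->
  exists2 t : R, t \in `[0, 1] & f (w + x) - f x = 'D_w f (t *: w + x).
Proof.
move=> df; set h := (fun s : R => f (s *: w + x)).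
have dh (t : R) : t \in `[0, 1] -> is_derive t 1 h ('D_w f (t *: w + x)).
  by move=> /df /is_derive_line.
have [c c01] := MVT01 dh.
by rewrite /h scale1r scale0r add0r; exists c.
Qed.

Lemma rV_norm_lt n (x : 'rV[R]_n) e : 0 < e -> (forall i, `|x 0 i| < e) -> `|x| < e.
Proof.
move=> e0 xe; rewrite /Num.norm /= mx_normrE; apply/bigmax_ltP; split=> // i _.
by rewrite (ord1 i.1).
Qed.

Lemma rV_coord_le n (x : 'rV[R]_n) i : `|x 0 i| <= `|x|.
Proof.
rewrite [leRHS]/Num.norm /= mx_normrE.
exact: (le_bigmax _ (fun i : 'I_1 * 'I_n => `|x i.1 i.2|) (0, i)).
Qed.

Lemma differentiable_approx V W (f : V -> W) (df : {linear V -> W}) x :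
  continuous df ->
  (forall e : R, 0 < e -> \forall h \near (0 : V),
     `|f (h + x) - (f x + df h)| <= e * `|h|) ->
  differentiable f x.
Proof.
move=> cdf H; have o : f \o shift x = cst (f x) + df +o_ 0 id.
  by apply/eqaddoP => e e0; apply: filterS (H e e0) => h.
by apply/diff_locallyP; rewrite (diff_unique cdf o).
Qed.

(** The increment is telescoped along a path of edges parallel to the axes; the mean value theorem
    on each edge and continuity of the partial derivatives bound the error. *)
Lemma C1_differentiable n (U : set 'rV[R]_n) (f : 'rV[R]_n -> R) x :
  open U -> Ck 1 U f -> U x -> differentiable f x.
Proof.
move=> oU [cf df] Ux.
pose d i := 'e_i : 'rV[R]_n.
pose D i := 'D_(d i) f.
have dl : linear (fun h : 'rV[R]_n => \sum_i h 0 i * D i x).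
  move=> a u v; rewrite scaler_sumr -big_split; apply: eq_bigr => i _ /=.
  by rewrite !mxE mulrDl [in RHS]/GRing.scale /= mulrA.
pose dM := GRing.isLinear.Build _ _ _ _ _ dl.
pose df0 : {linear 'rV[R]_n -> R} :=
  HB.pack (fun h : 'rV[R]_n => \sum_i h 0 i * D i x) dM.
have cdf0 : continuous df0.
  have H : continuous (fun h : 'rV[R]_n => \sum_i h 0 i * D i x).
    apply: (@continuous_big R _ +%R 0 xpredT (@add_continuous R)) => i _ h.
    apply: (@continuous_comp _ _ _ (fun k : 'rV[R]_n => k 0 i) ( *%R^~ (D i x))).
      exact: coord_continuous.
    exact: mulrr_continuous.
  exact: H.
apply: (differentiable_approx (df := df0)) => // e e0.
(* Each of the [n] edges gets the same share of the error; dividing by [n.+1] also serves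
   [n = 0]. *)
have e1 : 0 < e / n.+1%:R by rewrite divr_gt0.
have [r /= r0 rU] : exists2 r : R, 0 < r & forall y, `|y - x| < r ->
    U y /\ forall i, `|D i y - D i x| <= e / n.+1%:R.
  have nU : \forall y \near x, U y by exact: open_nbhs_nbhs.
  have nD : \forall y \near x, forall i, `|D i y - D i x| <= e / n.+1%:R.
    apply: (@filter_forall _ _ (fun i y => `|D i y - D i x| <= e / n.+1%:R) (nbhs x) _) => i.
    have [_ [cD _]] := df (d i).
    have /cvgrPdist_le /(_ _ e1) := cD x Ux.
    by apply: filterS => y; rewrite distrC.
  have /nbhs_normP[r r0 rU] : \forall y \near x, U y /\ forall i, `|D i y - D i x| <= e / n.+1%:R.
    by apply: filterS2 nU nD.
  by exists r => // y yx; apply: rU; rewrite /ball_ /= distrC.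
apply/nbhs_normP; exists r => // h; rewrite /ball_ /= sub0r normrN => hr.
(* [tr j] keeps the first [j] coordinates of [h], so the points [tr j + x] lead from [x] to [h + x],
   changing one coordinate at a time. *)
pose tr (j : nat) := \row_(i < n) (if (i < j)%N then h 0 i else 0).
have trn : tr n = h by apply/rowP => i; rewrite mxE ltn_ord.
have tr0 : tr 0%N = 0 by apply/rowP => i; rewrite !mxE.
have hi i : `|h 0 i| < r by apply: le_lt_trans hr; exact: rV_coord_le.
pose u j := f (tr j + x).
have -> : f (h + x) - (f x + df0 h)
    = \sum_(i < n) (u i.+1 - u i - h 0 i * D i x).
  rewrite opprD addrA.
  rewrite [RHS]sumrB; congr (_ - _).
  by rewrite -(big_mkord xpredT (fun i => u i.+1 - u i)) telescope_sumr // /u trn tr0 add0r.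
apply: le_trans (ler_norm_sum _ _ _) _.
have key (i : 'I_n) : `|u i.+1 - u i - h 0 i * D i x| <= e / n.+1%:R * `|h|.
  have trS : tr i.+1 = h 0 i *: d i + tr i.
    apply/rowP => j; rewrite !mxE eqxx /= ltnS.
    have [->|ji] := eqVneq j i; first by rewrite ltnn leqnn mulr1 addr0.
    by rewrite mulr0 add0r ltn_neqAle -val_eqE in ji * ; rewrite ji.
  have near_seg (t : R) : t \in `[0, 1] ->
      `|t *: (h 0 i *: d i) + (tr i + x) - x| < r.
    rewrite in_itv /= => /andP[t0 t1].
    rewrite addrA addrK; apply: rV_norm_lt => // j; rewrite !mxE eqxx /=.
    have [->|ji] := eqVneq j i.
      rewrite ltnn addr0 mulr1 normrM ger0_norm //.
      by apply: le_lt_trans (hi i); rewrite ler_piMl.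
    by rewrite !mulr0 add0r; case: ifP => // _; rewrite normr0.
  have dfs (t : R) : t \in `[0, 1] ->
      is_derive (t *: (h 0 i *: d i) + (tr i + x)) (h 0 i *: d i) f
       (h 0 i * D i (t *: (h 0 i *: d i) + (tr i + x))).
    move=> /near_seg/rU[Ut _]; apply: is_derive_scale.
    by have [d1 _] := df (d i); exact: d1.
  rewrite /u trS -(addrA (h 0 i *: d i)).
  have [|t t01 ->] := MVT_line (f := f) (x := tr i + x) (w := h 0 i *: d i).
    by move=> t /dfs[].
  have [_ ->] := dfs t t01.
  rewrite -mulrBr normrM mulrC; apply: ler_pM => //.
    by have [_] := rU _ (near_seg t t01); apply.
  exact: rV_coord_le.
apply: le_trans (ler_sum _ (fun i _ => key i)) _.
have -> : \sum_(i < n) e / n.+1%:R * `|h| = n%:R / n.+1%:R * (e * `|h|).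
  by rewrite sumr_const card_ord -[LHS]mulr_natl; ring.
rewrite ler_piMl //; first by rewrite mulr_ge0 // ltW.
by rewrite ler_pdivrMr // mul1r ler_nat.
Qed.

Lemma derive_rV n (g : 'rV[R]_n -> R) y w : differentiable g y ->
  'D_w g y = \sum_i w 0 i * 'D_('e_i) g y.
Proof.
move=> dg; rewrite deriveE // [in LHS](row_sum_delta w) linear_sum.
by apply: eq_bigr => i _; rewrite linearZ -deriveE.
Qed.

(** Induction on the order: the derivative of the composite is a sum of products of components of
    ['D_v f] with partial derivatives of [g] at [f x], all of one order less. *)
Lemma Ck_comp_rV V n k (U : set V) (U' : set 'rV[R]_n) (g : 'rV[R]_n -> R)
    (f : V -> 'rV[R]_n) : open U -> open U' -> (forall x, U x -> U' (f x)) ->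
  Ck k U' g -> Ck k U f -> Ck k U (fun x => g (f x)).
Proof.
move=> oU oU' UU'; elim: k g f UU' => [|k IH] g f UU' cg cf.
  case: cg => cg _; case: cf => cf _.
  by split=> // x Ux; apply: continuous_comp; [exact: cf|apply: cg; exact: UU'].
have cf' := Ck_pred cf.
have dg x : U x -> differentiable g (f x).
  move=> Ux; apply: (C1_differentiable oU') (UU' _ Ux).
  (* Truncates [Ck k.+1] to [Ck 1]. *)
  by case: cg => ? h; split=> // v; have [h1 h2] := h v; split=> //;
    case: k h2 {IH cf cf' h} => [|k] [].
case: cg => cg dg1; case: cf => cf df.
split; first by move=> x Ux; apply: continuous_comp; [exact: cf|apply: cg; exact: UU'].
move=> v; have [d1 d2] := df v.
have ch x (Ux : U x) := is_derive_diff_comp (d1 x Ux) (dg x Ux).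
split; first by move=> x /ch[].
have cs : Ck k U (fun x => \sum_i 'D_v f x 0 i * 'D_('e_i) g (f x)).
  apply: Ck_sum => // i _; apply: CkM => //.
    exact: ((Ck_rowP _ _ oU).1 d2).
  by apply: (IH ('D_('e_i) g) f) => //; have [_] := dg1 ('e_i).
apply: Ck_eq cs => // x Ux.
have [_ ->] := ch x Ux.
by rewrite -deriveE ?derive_rV //; exact: dg.
Qed.

Lemma Ck_comp_R V k (U : set V) (U' : set R) (g : R -> R)
    (f : V -> R) : open U -> (forall x, U x -> U' (f x)) ->
  Ck k U' g -> Ck k U f -> Ck k U (fun x => g (f x)).
Proof.
move=> oU UU'; elim: k g f UU' => [|k IH] g f UU' cg cf.
  case: cg => cg _; case: cf => cf _.
  by split=> // x Ux; apply: continuous_comp; [exact: cf|apply: cg; exact: UU'].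
have cf' := Ck_pred cf.
case: cg => cg dg1; case: cf => cf df.
have [dg1a dg1b] := dg1 1.
have dg x : U x -> differentiable g (f x).
  by move=> Ux; apply/derivable1_diffP; apply: dg1a; exact: UU'.
split; first by move=> x Ux; apply: continuous_comp; [exact: cf|apply: cg; exact: UU'].
move=> v; have [d1 d2] := df v.
have ch x (Ux : U x) := is_derive_diff_comp (d1 x Ux) (dg x Ux).
split; first by move=> x /ch[].
have cs : Ck k U (fun x => 'D_v f x * 'D_1 g (f x)).
  by apply: CkM => //; apply: (IH ('D_1 g) f).
apply: Ck_eq cs => // x Ux.
have [_ ->] := ch x Ux.
by rewrite diff1E; [rewrite derive1E|exact: dg].
Qed.
End C1.

Lemma near_open (T : topologicalType) (P : set T) x :
  (\forall y \near x, P y) -> exists2 U, open_nbhs x U & U `<=` P.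
Proof.
move=> H; have : nbhs x P by exact: H.
by rewrite nbhsE.
Qed.

(** * Smoothness at a point *)

Section SmoothAt.
Context {R : realType}.
Implicit Types V W Z : normedModType R.

(** The pointwise form lets composites in charts be treated up to equality near a point, without
    tracking the open sets on which they make sense. *)
Definition smooth_at V W (f : V -> W) (x : V) : Prop :=
  exists2 U, open_nbhs x U & smooth_on U f.

Lemma smooth_on_at V W (U : set V) (f : V -> W) x :
  open U -> smooth_on U f -> U x -> smooth_at f x.
Proof. by move=> oU sf Ux; exists U. Qed.

Lemma smooth_atP V W (U : set V) (f : V -> W) :
  (forall x, U x -> smooth_at f x) -> smooth_on U f.
Proof. by move=> H k; apply: Ck_local => x /H[U' [_ U'x] sf]; exists U'. Qed.

Lemma smooth_at_continuous V W (f : V -> W) x :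
  smooth_at f x -> {for x, continuous f}.
Proof. by case=> U [oU Ux] /(_ 0%N)[+ _]; exact. Qed.

Lemma smooth_at_eq V W (f g : V -> W) x :
  (\forall y \near x, f y = g y) -> smooth_at f x -> smooth_at g x.
Proof.
move=> /near_open[U' [oU' U'x] fg] [U [oU Ux] sf].
exists (U `&` U'); first by split=> //; exact: openI.
move=> k; apply: (Ck_eq (f := f)); first exact: openI.
  by move=> y [_ /fg].
by apply: Ck_sub (sf k); exact: subIsetl.
Qed.

Lemma smooth_at2 V W W' Z (F : V -> Z) (f : V -> W) (g : V -> W') x :
  (forall k U, open U -> Ck k U f -> Ck k U g -> Ck k U F) ->
  smooth_at f x -> smooth_at g x -> smooth_at F x.
Proof.
move=> H [U [oU Ux] sf] [U' [oU' U'x] sg].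
exists (U `&` U'); first by split=> //; exact: openI.
move=> k; apply: H; first exact: openI.
  by apply: Ck_sub (sf k); exact: subIsetl.
by apply: Ck_sub (sg k); exact: subIsetr.
Qed.

Lemma smooth_at_cst V W (c : W) (x : V) : smooth_at (fun=> c) x.
Proof.
by exists setT => [|k]; [split=> //; exact: openT|exact: Ck_cst].
Qed.

Lemma smooth_at_linear V W (l : {linear V -> W}) x :
  continuous l -> smooth_at l x.
Proof.
by move=> cl; exists setT => [|k]; [split=> //; exact: openT|exact: Ck_linear].
Qed.

Lemma smooth_at_id V (x : V) : smooth_at id x.
Proof. by apply: (@smooth_at_linear V V idfun) => y; exact: cvg_id. Qed.

Lemma smooth_atD V W (f g : V -> W) x :
  smooth_at f x -> smooth_at g x -> smooth_at (fun y => f y + g y) x.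
Proof. by apply: smooth_at2 => k U; exact: CkD. Qed.

Lemma smooth_atM V (f g : V -> R) x :
  smooth_at f x -> smooth_at g x -> smooth_at (fun y => f y * g y) x.
Proof. by apply: smooth_at2 => k U; exact: CkM. Qed.

Lemma smooth_atZ V W (f : V -> R) (w : W) x :
  smooth_at f x -> smooth_at (fun y => f y *: w) x.
Proof.
move=> sf; apply: (smooth_at2 _ sf sf) => k U oU cf _; exact: Ck_scalel.
Qed.

Lemma smooth_atB V (f g : V -> R) x :
  smooth_at f x -> smooth_at g x -> smooth_at (fun y => f y - g y) x.
Proof.
move=> sf sg; have := smooth_atD sf (smooth_atM (smooth_at_cst (-1 : R) x) sg).
by apply: smooth_at_eq; near=> y; rewrite mulN1r.
Unshelve. all: by end_near. Qed.

Lemma smooth_at_sum V W I (r : seq I) (P : pred I) (F : I -> V -> W) x :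
  (forall i, P i -> smooth_at (F i) x) ->
  smooth_at (fun y => \sum_(i <- r | P i) F i y) x.
Proof.
move=> sF; elim: r => [|i r IH].
  by apply: smooth_at_eq (smooth_at_cst 0 x); near=> y; rewrite big_nil.
case: (boolP (P i)) => Pi.
  by apply: smooth_at_eq (smooth_atD (sF i Pi) IH); near=> y; rewrite big_cons Pi.
by apply: smooth_at_eq IH; near=> y; rewrite big_cons (negPf Pi).
Unshelve. all: by end_near. Qed.

Lemma smooth_at_rowP V n (F : V -> 'rV[R]_n) x :
  smooth_at F x <-> forall a, smooth_at (fun y => F y 0 a) x.
Proof.
split=> [sF a|sF].
  by apply: (smooth_at2 _ sF sF) => k U oU /(Ck_rowP _ _ oU).
have := smooth_at_sum (index_enum _) (fun (a : 'I_n) (_ : xpredT a) =>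
  smooth_atZ ('e_a : 'rV[R]_n) (sF a)).
by apply: smooth_at_eq; near=> y; rewrite [RHS]row_sum_delta.
Unshelve. all: by end_near. Qed.

Lemma smooth_at_comp_rV V n (g : 'rV[R]_n -> R) (f : V -> 'rV[R]_n) x :
  smooth_at f x -> smooth_at g (f x) -> smooth_at (fun y => g (f y)) x.
Proof.
move=> sf [U' [oU' U'x] sg].
have nU' : \forall y \near x, U' (f y).
  by apply: (smooth_at_continuous sf); exact: open_nbhs_nbhs.
have [U'' [oU'' U''x] UU'] := near_open nU'.
case: sf => U [oU Ux] sf.
exists (U `&` U''); first by split=> //; exact: openI.
move=> k; apply: (Ck_comp_rV (U' := U')) => //; first exact: openI.
  by move=> y [_ /UU'].
by apply: Ck_sub (sf k); exact: subIsetl.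
Qed.

Lemma smooth_at_comp n m V (g : 'rV[R]_n -> 'rV[R]_m) (f : V -> 'rV[R]_n) x :
  smooth_at f x -> smooth_at g (f x) -> smooth_at (fun y => g (f y)) x.
Proof.
move=> sf /smooth_at_rowP sg; apply/smooth_at_rowP => a.
exact: (smooth_at_comp_rV sf (sg a)).
Qed.

Lemma smooth_at_comp_R V (g : R -> R) (f : V -> R) x :
  smooth_at f x -> smooth_at g (f x) -> smooth_at (fun y => g (f y)) x.
Proof.
move=> sf [U' [oU' U'x] sg].
have nU' : \forall y \near x, U' (f y).
  by apply: (smooth_at_continuous sf); exact: open_nbhs_nbhs.
have [U'' [oU'' U''x] UU'] := near_open nU'.
case: sf => U [oU Ux] sf.
exists (U `&` U''); first by split=> //; exact: openI.
move=> k; apply: (Ck_comp_R (U' := U')) => //; first exact: openI.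
  by move=> y [_ /UU'].
by apply: Ck_sub (sf k); exact: subIsetl.
Qed.

Lemma smooth_at_derive V W (f : V -> W) v x :
  smooth_at f x -> smooth_at ('D_v f) x.
Proof.
case=> U oUx sf; exists U => // k.
by have [_ /(_ v)[]] := sf k.+1.
Qed.

Lemma smooth_at_derivable V W (f : V -> W) v x :
  smooth_at f x -> derivable f x v.
Proof. by case=> U [oU Ux] /(_ 1%N)[_ /(_ v)[+ _]]; exact. Qed.

Lemma smooth_at_differentiable n (f : 'rV[R]_n -> R) x :
  smooth_at f x -> differentiable f x.
Proof. by case=> U [oU Ux] /(_ 1%N) /C1_differentiable; exact. Qed.

Lemma smooth_at_coord n (a : 'I_n) (x : 'rV[R]_n) :
  smooth_at (fun y : 'rV[R]_n => y 0 a) x.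
Proof. by have /smooth_at_rowP := smooth_at_id x. Qed.

Lemma smooth_atX V (f : V -> R) m x :
  smooth_at f x -> smooth_at (fun y => f y ^+ m) x.
Proof.
move=> sf; elim: m => [|m IH]; first exact: smooth_at_cst.
by apply: smooth_at_eq (smooth_atM sf IH); near=> y; rewrite exprS.
Unshelve. all: by end_near. Qed.

End SmoothAt.

(** * Hadamard's lemma *)

Section UnitIntegral.
Context {R : realType}.

Definition cont01 (h : R -> R) : Prop :=
  forall t : R, t \in `[0, 1] -> {for t, continuous h}.

Definition int01 (h : R -> R) : R :=
  \int[@lebesgue_measure R]_(t in `[0, 1]) h t.

Lemma cont01_within h : cont01 h -> {within `[0, 1], continuous h}.
Proof. by move=> ch; apply: continuous_in_subspaceT => t; rewrite inE; exact: ch. Qed.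

Lemma cont01_integrable h : cont01 h ->
  (@lebesgue_measure R).-integrable `[0, 1] (EFin \o h).
Proof.
move=> ch; apply: continuous_compact_integrable; first exact: segment_compact.
exact: cont01_within.
Qed.

Lemma int01_ext h g : (forall t : R, t \in `[0, 1] -> h t = g t) -> int01 h = int01 g.
Proof. by move=> hg; apply: eq_Rintegral => t; rewrite inE; exact: hg. Qed.

Lemma int01_cst (c : R) : int01 (fun=> c) = c.
Proof.
transitivity (c * fine ((@lebesgue_measure R) `[0, 1]%classic)).
  by apply: Rintegral_cst; exact: measurable_itv.
by rewrite lebesgue_measure_itv /= lte_fin ltr01 oppr0 adde0 /= mulr1.
Qed.

Lemma int01_scale (c : R) h : cont01 h -> int01 (fun t => c * h t) = c * int01 h.
Proof. by move=> /cont01_integrable ch; rewrite /int01 RintegralZl. Qed.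

Lemma int01_add h g : cont01 h -> cont01 g ->
  int01 (fun t => h t + g t) = int01 h + int01 g.
Proof. by move=> /cont01_integrable ch /cont01_integrable cg; rewrite /int01 RintegralD. Qed.

Lemma cont01_cst (c : R) : cont01 (fun=> c).
Proof. by move=> t _; exact: cvg_cst. Qed.

Lemma cont01_sum I (r : seq I) (h : I -> R -> R) :
  (forall i, cont01 (h i)) -> cont01 (fun t => \sum_(i <- r) h i t).
Proof.
move=> ch t t01; apply: cvg_big => [|i _]; first exact: add_continuous.
exact: ch.
Qed.

Lemma int01_sum I (r : seq I) (c : I -> R) (h : I -> R -> R) :
  (forall i, cont01 (h i)) ->
  int01 (fun t => \sum_(i <- r) c i * h i t) = \sum_(i <- r) c i * int01 (h i).
Proof.
move=> ch; have cs (s : seq I) : cont01 (fun t => \sum_(i <- s) c i * h i t).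
  by apply: cont01_sum => i t t01; apply: cvgMr; exact: ch.
elim: r => [|i r IH].
  rewrite big_nil -[RHS](int01_cst 0); apply: int01_ext => t _; exact: big_nil.
rewrite big_cons -int01_scale // -IH -int01_add //.
  by apply: int01_ext => t _; rewrite big_cons.
by move=> t t01; apply: cvgMr; exact: ch.
Qed.

Lemma int01_le h (C : R) : cont01 h ->
  (forall t : R, t \in `[0, 1] -> `|h t| <= C) -> `|int01 h| <= C.
Proof.
move=> ch hC; have ih := cont01_integrable ch.
apply: le_trans (le_normr_Rintegral _ ih) _ => //.
rewrite -[leRHS]int01_cst; apply: le_Rintegral => //.
- apply: cont01_integrable => t t01.
  by apply: (@continuous_comp _ _ _ h Num.norm); [exact: ch|exact: norm_continuous].
- by apply: cont01_integrable; exact: cont01_cst.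
Qed.

Lemma int01_FTC (h dh : R -> R) : cont01 dh ->
  (forall t : R, t \in `[0, 1] -> is_derive t 1 h (dh t)) ->
  int01 dh = h 1 - h 0.
Proof.
move=> cdh H.
have ch (t : R) : t \in `[0, 1] -> {for t, continuous h}.
  by move=> /H[d _]; apply: differentiable_continuous; apply/derivable1_diffP.
rewrite /int01 /Rintegral (continuous_FTC2 (F := h)) //.
- exact: cont01_within.
- split.
  + by move=> t /subset_itv_oo_cc/H[].
  + by apply: cvg_at_right_filter; apply: ch; rewrite in_itv /= lexx ler01.
  + by apply: cvg_at_left_filter; apply: ch; rewrite in_itv /= lexx ler01.
- by move=> t /subset_itv_oo_cc/H[_ e]; rewrite derive1E.
Qed.

(** Differentiation under the integral sign, with the constant [C] as dominating function. *)
Lemma is_derive_int01 (f df : R -> R -> R) (d C : R) : 0 < d ->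
  (forall s, `|s| < d -> cont01 (f s)) ->
  (forall s t : R, `|s| < d -> t \in `[0, 1] ->
     is_derive s 1 (f ^~ t) (df s t)) ->
  (forall s t : R, `|s| < d -> t \in `[0, 1] -> `|df s t| <= C) ->
  is_derive (0 : R) 1 (fun s => int01 (f s)) (int01 (df 0)).
Proof.
move=> d0 cf H HC.
have I0 : [set` `]- d, d[] (0 : R) by rewrite /= in_itv /= oppr_lt0 d0.
have IE (s : R) : [set` `]- d, d[] s -> `|s| < d.
  by rewrite /= in_itv /= ltr_norml.
have C0 : 0 <= C.
  apply: le_trans (HC 0 0 _ _) => //; first by rewrite normr0.
  by rewrite in_itv /= lexx ler01.
have h1 (s : R) : [set` `]- d, d[] s ->
   (@lebesgue_measure R).-integrable `[0, 1] (EFin \o f s).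
  by move=> /IE/cf/cont01_integrable.
have h2 (s t : R) : [set` `]- d, d[] s -> t \in `[0, 1] -> derivable (f ^~ t) s 1.
  by move=> /IE sd t01; have [] := H s t sd t01.
have h3 := cont01_integrable (@cont01_cst C).
have h4 (s t : R) : [set` `]- d, d[] s -> t \in `[0, 1] ->
    `|partial1of2 f s t| <= C.
  move=> /IE sd t01; rewrite partial1of2E; have [_ ->] := H s t sd t01.
  exact: HC.
have h5 := @derivable_under_integral R _ _ (@lebesgue_measure R) f _
  (measurable_itv `[0, 1]) 0 (- d) d I0 h1 h2 (fun=> C) (fun=> C0) h3 h4.
have h6 := @differentiation_under_integral R _ _ (@lebesgue_measure R) f _
  (measurable_itv `[0, 1]) 0 (- d) d I0 h1 h2 (fun=> C) (fun=> C0) h3 h4.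
split; first exact: h5.
rewrite -derive1E [LHS]h6; apply: eq_Rintegral => t; rewrite inE => t01.
rewrite -/(partial1of2 f 0 t) partial1of2E.
by have [_ ->] := H 0 t (IE _ I0) t01.
Qed.

End UnitIntegral.

(** * Continuity from norm estimates *)

Section NormedContinuity.
Context {R : realType}.
Implicit Types V W : normedModType R.

Lemma dist_continuous V (x0 : V) : continuous (fun y => `|y - x0|).
Proof. by move=> y; apply: cvg_norm; apply: cvgB; [exact: cvg_id|exact: cvg_cst]. Qed.

Lemma lipschitz_continuous V W (f : V -> W) x (K : R) : 0 <= K ->
  (\forall y \near x, `|f y - f x| <= K * `|y - x|) -> {for x, continuous f}.
Proof.
move=> K0 lip; apply/cvgrPdist_lt => e e0.
have nb2 : \forall y \near x, `|y - x| < e / (K + 1).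
  apply/nbhs_normP; exists (e / (K + 1)); first by rewrite /= divr_gt0 // ltr_wpDl.
  by move=> y; rewrite /ball_ /= distrC.
near=> y; rewrite distrC; apply: (@le_lt_trans _ _ (K * `|y - x|)).
  by near: y.
have y1 : `|y - x| < e / (K + 1) by near: y.
have K1 : 0 < K + 1 by rewrite ltr_wpDl.
move: y1; rewrite ltr_pdivlMr // => y1.
by apply: le_lt_trans y1; rewrite mulrC ler_wpM2l // lerDl.
Unshelve. all: by end_near. Qed.

Lemma near_dist V (x0 x : V) (rho : R) : `|x - x0| < rho ->
  \forall y \near x, `|y - x0| <= rho.
Proof.
move=> rho_x; apply/nbhs_normP; exists (rho - `|x - x0|); first by rewrite /= subr_gt0.
move=> y; rewrite /ball_ /= distrC => yx.
rewrite -(subrK x y) -addrA; apply: le_trans (ler_normD _ _) _.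
by rewrite -lerBrDr ltW.
Qed.

End NormedContinuity.

(** * Integrals along segments from a centre *)

Section Hadamard.
Context {R : realType} {n : nat}.
Implicit Types g : 'rV[R]_n -> R.

Lemma cball_compact (x0 : 'rV[R]_n) (rho : R) :
  compact [set y : 'rV[R]_n | `|y - x0| <= rho].
Proof.
apply: bounded_closed_compact.
  exists (rho + `|x0|); split; first exact: num_real.
  move=> M rM y /= yA; apply: ltW; apply: le_lt_trans rM.
  by rewrite -[y](subrK x0); apply: le_trans (ler_normD _ _) _; rewrite lerD2r.
have c : continuous (fun y : 'rV[R]_n => `|y - x0|) by exact: dist_continuous.
by have := preimage_closed (fun y _ => c y) (@closed_le R rho).
Qed.

Lemma cball_bound g (x0 : 'rV[R]_n) (rho : R) :
  (forall y, `|y - x0| <= rho -> {for y, continuous g}) -> 0 <= rho ->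
  exists C, forall y, `|y - x0| <= rho -> `|g y| <= C.
Proof.
move=> cg rho0; pose A := [set y : 'rV[R]_n | `|y - x0| <= rho].
have cA : compact A by exact: cball_compact.
have [] := @EVT_max_rV R n (fun y => `|g y|) A.
- by exists x0; rewrite /A /= subrr normr0.
- exact: cA.
- apply: continuous_in_subspaceT => y; rewrite inE => /cg c.
  by apply: (@continuous_comp _ _ _ g Num.norm) => //; exact: norm_continuous.
move=> c _ H; exists `|g c| => y yA; apply: H; by rewrite inE.
Qed.

Context (x0 : 'rV[R]_n) (r : R).
Let U : set 'rV[R]_n := [set y | `|y - x0| < r].

Let seg (x : 'rV[R]_n) (t : R) := t *: (x - x0) + x0.

Lemma open_nball : open U.
Proof.
have -> : U = ball x0 r.
  by rewrite -ball_normE; apply/seteqP; split => y /=; rewrite distrC.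
exact: ball_open.
Qed.

(* The weights [t ^+ k] arise on differentiating under the integral sign. *)
Definition had k g (x : 'rV[R]_n) : R := int01 (fun t => t ^+ k * g (seg x t)).

Lemma seg_le x t (rho : R) : `|x - x0| <= rho -> t \in `[(0 : R), 1] -> `|seg x t - x0| <= rho.
Proof.
move=> xr; rewrite in_itv /= => /andP[t0 t1].
rewrite /seg addrK normrZ ger0_norm //; apply: le_trans xr.
by rewrite ler_piMl.
Qed.

Lemma segU x t : U x -> t \in `[(0 : R), 1] -> U (seg x t).
Proof.
move=> xU t01; rewrite /U /=; apply: le_lt_trans xU.
exact: seg_le.
Qed.

Lemma seg_cont x : continuous (seg x).
Proof.
by move=> t; apply: cvgD; [exact: scalel_continuous|exact: cvg_cst].
Qed.

Lemma had_cont k g x : (forall y, U y -> {for y, continuous g}) -> U x ->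
  cont01 (fun t => t ^+ k * g (seg x t)).
Proof.
move=> cg Ux t t01; apply: continuousM; first exact: exprn_continuous.
apply: (@continuous_comp _ _ _ (seg x) g); first exact: seg_cont.
by apply: cg; exact: segU.
Qed.

(** Moving the endpoint [x] by [s *: v] moves the point at time [t] by [s *: (t *: v)]; the chain
    rule then yields the extra factor [t]. The derivative is dominated by a bound of ['D_v g] on a
    compact ball. *)
Lemma had_derive k g x v : Ck 1 U g -> U x ->
  is_derive x v (had k g) (had k.+1 ('D_v g) x).
Proof.
move=> [cg dg] Ux; have [dgv [cdg _]] := dg v.
(* A radius strictly between the distance of [x] from the centre and [r]: the closed ball lies in
   [U] and contains a neighbourhood of [x]. *)
pose rho := (r + `|x - x0|) / 2.
have xr : `|x - x0| < r by [].
have rho_r : rho < r by rewrite /rho; lra.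
have rho_x : `|x - x0| < rho by rewrite /rho; lra.
have rho0 : 0 <= rho by rewrite /rho; have := normr_ge0 (x - x0); lra.
have [C HC] := @cball_bound ('D_v g) x0 rho (fun y yr => cdg y (le_lt_trans yr rho_r)) rho0.
(* Moving [x] along [v] by a parameter below [d] stays in the closed ball of radius [rho]; the [1 +]
   covers [v = 0]. *)
pose d := (rho - `|x - x0|) / (1 + `|v|).
have v1 : 0 < 1 + `|v| by rewrite ltr_pwDl.
have d0 : 0 < d by rewrite divr_gt0 // subr_gt0.
have inr s : `|s| < d -> `|(s *: v + x) - x0| <= rho.
  move=> sd; rewrite -addrA; apply: le_trans (ler_normD _ _) _.
  rewrite normrZ -lerBrDr; apply: le_trans (_ : d * (1 + `|v|) <= _); last first.
    by rewrite /d divfK // gt_eqF.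
  apply: ler_pM => //; first exact: ltW.
  by rewrite lerDr.
have inU s : `|s| < d -> U (s *: v + x).
  by move=> /inr sr; apply: le_lt_trans rho_r.
pose f (s t : R) := t ^+ k * g (seg (s *: v + x) t).
pose df (s t : R) := t ^+ k.+1 * 'D_v g (seg (s *: v + x) t).
have e (s t : R) : seg (s *: v + x) t = s *: (t *: v) + seg x t.
  by apply/rowP => i; rewrite !mxE; ring.
have H1 (s t : R) : `|s| < d -> t \in `[(0:R), 1] -> is_derive s 1 (f ^~ t) (df s t).
  move=> sd t01.
  have Us : U (s *: (t *: v) + seg x t) by rewrite -e; apply: segU => //; exact: inU.
  have h1 : is_derive (s *: (t *: v) + seg x t) (t *: v) g (t *: 'D_v g (s *: (t *: v) + seg x t)).
    by apply: is_derive_scale; exact: dgv.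
  have [h1a h1b] := h1.
  have h2 := is_derive_line h1a; rewrite h1b in h2.
  have -> : f^~ t = (fun s => t ^+ k * g (s *: (t *: v) + seg x t)).
    by apply/funext => s'; rewrite /f e.
  rewrite /df e exprS; apply: is_derive_eq.
  by rewrite /GRing.scale /=; ring.
have H2 (s t : R) : `|s| < d -> t \in `[(0:R), 1] -> `|df s t| <= C.
  move=> sd t01; rewrite /df normrM.
  apply: le_trans (HC _ (seg_le (inr _ sd) t01)).
  rewrite ler_piMl //; move: t01; rewrite in_itv /= => /andP[t0 t1].
  by rewrite normrX ger0_norm // exprn_ile1.
have H3 s : `|s| < d -> cont01 (f s) by move=> /inU Us; exact: had_cont.
have [q1 q2] := is_derive_int01 d0 H3 H1 H2.
split; first by apply/derivable1P.
rewrite derive_line derive1E q2; apply: int01_ext => t _.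
by rewrite /df scale0r add0r.
Qed.

(** Directional derivatives alone do not give continuity. A bound of the partial derivatives that is
    uniform on a closed ball gives, by the mean value theorem, a Lipschitz estimate at [x]. *)
Lemma had_continuous k g x : Ck 1 U g -> U x -> {for x, continuous (had k g)}.
Proof.
move=> sg Ux; have [cg dg] := sg.
pose rho := (r + `|x - x0|) / 2.
have xr : `|x - x0| < r by [].
have rho_r : rho < r by rewrite /rho; lra.
have rho_x : `|x - x0| < rho by rewrite /rho; lra.
have rho0 : 0 <= rho by rewrite /rho; have := normr_ge0 (x - x0); lra.
have /choice[C HC] : forall i : 'I_n, exists C, forall y, `|y - x0| <= rho -> `|'D_('e_i) g y| <= C.
  move=> i; apply: cball_bound => // y yr; have [_ [cd _]] := dg ('e_i).
  by apply: cd; exact: le_lt_trans rho_r.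
pose K := \sum_i C i.
have C0 i : 0 <= C i by apply: le_trans (HC i x (ltW rho_x)).
have K0 : 0 <= K by apply: sumr_ge0.
have bnd w y : `|y - x0| <= rho -> `|'D_w g y| <= K * `|w|.
  move=> yr; have Uy : U y by exact: le_lt_trans rho_r.
  have dgy := C1_differentiable open_nball sg Uy.
  rewrite derive_rV // mulr_suml.
  apply: le_trans (ler_norm_sum _ _ _) _; apply: ler_sum => i _.
  rewrite normrM mulrC; apply: ler_pM => //; first exact: HC.
  exact: rV_coord_le.
have lip y : `|y - x0| <= rho -> `|had k g y - had k g x| <= K * `|y - x|.
  move=> yr.
  have ball_seg (t : R) : t \in `[0, 1] -> `|t *: (y - x) + x - x0| <= rho.
    rewrite in_itv /= => /andP[t0 t1].
    have -> : t *: (y - x) + x - x0 = t *: (y - x0) + (1 - t) *: (x - x0).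
      by apply/rowP => i; rewrite !mxE; ring.
    apply: le_trans (ler_normD _ _) _; rewrite !normrZ !ger0_norm ?subr_ge0 //.
    have : t * `|y - x0| <= t * rho by rewrite ler_wpM2l.
    have : (1 - t) * `|x - x0| <= (1 - t) * rho by rewrite ler_wpM2l ?subr_ge0 // ltW.
    lra.
  have dh (t : R) : t \in `[0, 1] -> is_derive (t *: (y - x) + x) (y - x) (had k g)
      (had k.+1 ('D_(y - x) g) (t *: (y - x) + x)).
    by move=> /ball_seg tr; apply: had_derive => //; exact: le_lt_trans rho_r.
  have [t /dh[]//|t t01] := MVT_line (f := had k g) (x := x) (w := y - x).
  rewrite subrK => ->; have [_ ->] := dh t t01.
  have [_ [cd _]] := dg (y - x).
  apply: int01_le.
    by apply: (@had_cont k.+1 ('D_(y - x) g)) => //; apply: le_lt_trans rho_r; exact: ball_seg.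
  move=> s s01; rewrite normrM.
  apply: le_trans (bnd (y - x) _ (seg_le (ball_seg _ t01) s01)).
  rewrite ler_piMl //; move: s01; rewrite in_itv /= => /andP[s0 s1].
  by rewrite normrX ger0_norm // exprn_ile1.
apply: (lipschitz_continuous K0); apply: filterS (near_dist rho_x) => y.
exact: lip.
Qed.

Lemma had_Ck m k g : smooth_on U g -> Ck m U (had k g).
Proof.
elim: m k g => [|m IH] k g sg.
  by split=> // x Ux; exact: had_continuous.
split; first by move=> x Ux; exact: had_continuous.
move=> v; split; first by move=> x Ux; have [] := had_derive k v (sg 1%N) Ux.
have H : Ck m U (had k.+1 ('D_v g)).
  by apply: IH => j; have [_ /(_ v)[]] := sg j.+1.
apply: (Ck_eq open_nball _ H) => x Ux.
by have [_ ->] := had_derive k v (sg 1%N) Ux.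
Qed.

(** The fundamental theorem of calculus for [g] along the segment from [x0] to [x]; the coefficients
    are the averages of the partial derivatives over that segment. *)
Lemma hadamard g : smooth_on U g ->
  exists G : 'I_n -> 'rV[R]_n -> R,
    [/\ forall i, smooth_on U (G i),
        forall i, G i x0 = 'D_('e_i) g x0 &
        forall x, U x -> g x = g x0 + \sum_i (x - x0) 0 i * G i x].
Proof.
move=> sg; exists (fun i => had 0 ('D_('e_i) g)).
have sd i : smooth_on U ('D_('e_i) g).
  by move=> j; have [_ /(_ ('e_i))[]] := sg j.+1.
split=> [i k|i|x Ux]; first exact: had_Ck.
  rewrite -[RHS]int01_cst; apply: int01_ext => t _.
  by rewrite expr0 mul1r /seg subrr scaler0 add0r.
have cc i : cont01 (fun t => t ^+ 0 * 'D_('e_i) g (seg x t)).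
  by apply: (@had_cont 0 ('D_('e_i) g)) => //; have [] := sd i 0%N.
have := @int01_FTC R (fun t => g (seg x t))
    (fun t => \sum_i (x - x0) 0 i * (t ^+ 0 * 'D_('e_i) g (seg x t))).
have -> : seg x 1 = x by rewrite /seg scale1r subrK.
have -> : seg x 0 = x0 by rewrite /seg scale0r add0r.
rewrite int01_sum // => H.
have -> : \sum_i (x - x0) 0 i * had 0 ('D_('e_i) g) x = g x - g x0; last first.
  by rewrite addrC subrK.
apply: H.
- by apply: cont01_sum => i t t01; apply: cvgMr; exact: cc.
- move=> t t01; have Us := segU Ux t01.
  have dgx := C1_differentiable open_nball (sg 1%N) Us.
  have dgx' : derivable g (seg x t) (x - x0) by exact: diff_derivable.
  have := is_derive_line dgx'; rewrite derive_rV //.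
  by under [in X in _ -> X]eq_bigr do rewrite expr0 mul1r.
Qed.

End Hadamard.

(** * Bump functions *)

Section Bump.
Context {R : realType}.

Lemma Ck_antiderivative k (f g : R -> R) :
  (forall t : R, is_derive t 1 f (g t)) -> Ck k setT g -> Ck k.+1 setT f.
Proof.
move=> df cg; split.
  move=> t _; apply: differentiable_continuous; apply/derivable1_diffP.
  by case: (df t).
move=> v; have dfv (t : R) : is_derive t v f (v * g t).
  have [d <-] := df t; have := is_derive_scale v d.
  by rewrite /GRing.scale /= mulr1.
split; first by move=> t _; case: (dfv t).
have H : Ck k setT (fun t => v * g t).
  by apply: CkM => //; [exact: openT|exact: Ck_cst].
by apply: Ck_eq H => [|t _]; [exact: openT|case: (dfv t)].
Qed.

(** The powers of [t^-1] make the family closed, up to linear combinations, under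
    differentiation. *)
Definition flat (m : nat) (t : R) : R :=
  if 0 < t then t^-1 ^+ m * expR (- t^-1) else 0.

(** One term of the exponential series, of degree [m.+2] in [t^-1], beats the power [t^-1 ^+ m] with
    a factor [t ^+ 2] to spare. *)
Lemma flat_bound m t : `|flat m t| <= (m.+2)`!%:R * t ^+ 2.
Proof.
rewrite /flat; case: ifP => [t0|_]; last by rewrite normr0 mulr_ge0 // sqr_ge0.
have u0 : 0 < t^-1 by rewrite invr_gt0.
rewrite ger0_norm; last by rewrite mulr_ge0 ?expR_ge0 // exprn_ge0 // ltW.
have := @expR_ge1Dxn R t^-1 m.+1 (ltW u0).
set u := t^-1 in u0 *; set F := (_`!%:R) => H.
have F0 : 0 < F by rewrite ltr0n fact_gt0.
have H1 : u ^+ m.+2 <= F * expR u.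
  rewrite -ler_pdivrMl // mulrC; apply: le_trans H; by rewrite lerDr.
have -> : t = u^-1 by rewrite invrK.
rewrite expRN -(ler_pM2r (expR_gt0 u)) mulfVK ?gt_eqF ?expR_gt0 //.
rewrite -(ler_pM2r (exprn_gt0 2 u0)) -exprD addn2; apply: le_trans H1 _.
by rewrite le_eqVlt; apply/orP; left; apply/eqP; field; rewrite gt_eqF.
Qed.

(** For [t] nonzero this is a computation on one side of the origin; at [0] the quadratic bound
    makes the difference quotient tend to [0]. *)
Lemma is_derive_flat m (t : R) :
  is_derive t 1 (flat m) (- m%:R * flat m.+1 t + flat m.+2 t).
Proof.
have [t0|t0|<-] := ltgtP 0 t.
- have e : \near t, t^-1 ^+ m * expR (- t^-1) = flat m t.
    near=> s; rewrite /flat ifT //; near: s; exact: lt_nbhsr.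
  apply: near_eq_is_derive e _.
  have tn0 : t != 0 by rewrite gt_eqF.
  have dV : is_derive t 1 (fun s : R => s^-1) (- t ^- 2).
    split; first exact: derivableV.
    by rewrite deriveV // derive_id /GRing.scale /= mulr1.
  have dE : is_derive t 1 (fun s : R => expR (- s^-1)) (t ^- 2 * expR (- t^-1)).
    apply: is_derive_eq.
    by rewrite opprK mulrC.
  have dX : is_derive t 1 (fun s : R => s^-1 ^+ m) (- m%:R * t^-1 ^+ m.+1).
    case: m => [|m].
      by rewrite oppr0 mul0r; exact: is_derive_cst.
    have -> : (fun s : R => s^-1 ^+ m.+1) = (fun s : R => s^-1) ^+ m.+1.
      by apply/funext => s; rewrite exprfctE.
    apply: is_derive_eq; rewrite /GRing.scale /= !exprS exprVn.
    by rewrite expr0; field; rewrite tn0 expf_neq0.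
  have dF := is_deriveM dX dE; apply: (is_derive_eq dF).
  rewrite /flat t0 /GRing.scale /= !exprS exprVn; field.
  by rewrite tn0 expf_neq0.
- have e : \near t, (0 : R) = flat m t.
    near=> s; rewrite /flat ifF //; apply/negbTE; rewrite -leNgt ltW //; near: s.
    exact: lt_nbhsl.
  apply: near_eq_is_derive e _.
  by rewrite /flat !ltNge (ltW t0) /= mulr0 addr0; exact: is_derive_cst.
- have d0 : (fun h : R => h^-1 *: ((flat m \o shift 0) (h *: 1) - flat m 0)) @ 0^' --> (0 : R).
    apply/cvgrPdist_le => e e0.
    have F0 : 0 < ((m.+2)`!%:R : R) by rewrite ltr0n fact_gt0.
    near=> h.
    have h0 : h != 0 by near: h; exact: nbhs_dnbhs_neq.
    have hs : `|h| <= e / (m.+2)`!%:R.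
      near: h; apply: nbhs_dnbhs; apply/nbhs_normP; exists (e / (m.+2)`!%:R).
        by rewrite /= divr_gt0.
      by move=> h; rewrite /ball_ /= sub0r normrN => /ltW.
    rewrite sub0r normrN /= addr0 [_%:A]mulr1 {2}/flat ltxx subr0.
    rewrite normrM normfV ler_pdivrMl ?normr_gt0 //.
    apply: le_trans (flat_bound m h) _; rewrite -real_normK ?num_real //.
    rewrite expr2 mulrA mulrC ler_wpM2l //.
    by move: hs; rewrite ler_pdivlMr // mulrC.
  split; first by apply/cvg_ex; exists 0.
  rewrite /derive (cvg_lim _ d0) //.
  by rewrite /flat ltxx mulr0 addr0.
Unshelve. all: by end_near. Qed.

Lemma flat_Ck k m : Ck k setT (flat m).
Proof.
elim: k m => [|k IH] m.
  split=> // t _; apply: differentiable_continuous; apply/derivable1_diffP.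
  by case: (is_derive_flat m t).
apply: (Ck_antiderivative (is_derive_flat m)).
apply: CkD => //; first exact: openT.
by apply: CkM => //; [exact: openT|exact: Ck_cst].
Qed.

Lemma flat_smooth m t : smooth_at (flat m) t.
Proof. by exists setT => [|k]; [split=> //; exact: openT|exact: flat_Ck]. Qed.

(* The inner [expR 1 * flat 0 (1 - s)] is at least 1 for [s <= 0] and vanishes
   for [1 <= s], so no quotient is needed. *)
Definition step (s : R) : R :=
  expR 1 * flat 0 (1 - expR 1 * flat 0 (1 - s)).

Lemma step_ge1 s : 1 <= s -> step s = 1.
Proof.
move=> s1; rewrite /step {2}/flat subr_gt0 ltNge s1 /= mulr0 subr0.
by rewrite /flat ltr01 expr0 mul1r invr1 expRxMexpNx_1.
Qed.

Lemma step_le0 s : s <= 0 -> step s = 0.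
Proof.
move=> s0; have s1 : 0 < 1 - s by rewrite subr_gt0 (le_lt_trans s0).
rewrite /step {2}/flat s1 expr0 mul1r -expRD {1}/flat ltNge subr_le0.
rewrite -[leLHS]expR0 ler_expR subr_ge0 invf_le1 //.
by rewrite lerDl oppr_ge0 s0 /= mulr0.
Qed.

Lemma step_smooth s : smooth_at step s.
Proof.
apply: smooth_atM; first exact: smooth_at_cst.
apply: smooth_at_comp_R; last exact: flat_smooth.
apply: smooth_atB; first exact: smooth_at_cst.
apply: smooth_atM; first exact: smooth_at_cst.
apply: smooth_at_comp_R; last exact: flat_smooth.
by apply: smooth_atB; [exact: smooth_at_cst|exact: smooth_at_id].
Qed.

Lemma bump_exists n (p : 'rV[R]_n) (r : R) : 0 < r ->
  exists f : 'rV[R]_n -> R, [/\ forall x, smooth_at f x,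
    \forall x \near p, f x = 1 & forall x, f x != 0 -> `|x - p| <= r].
Proof.
move=> r0.
(* A sum of squares, since the maximum norm is not smooth. With the factor [2 / r], [q x < 2] puts
   every coordinate of [x - p] below [r], and [q x < 1] near [p] makes the step equal to 1. *)
pose q (x : 'rV[R]_n) := \sum_a (2 / r * (x 0 a - p 0 a)) ^+ 2.
have sq x : smooth_at q x.
  apply: smooth_at_sum => a _; apply: smooth_atX; apply: smooth_atM.
    exact: smooth_at_cst.
  by apply: smooth_atB; [exact: smooth_at_coord|exact: smooth_at_cst].
exists (fun x => step (2 - q x)); split.
- move=> x; apply: smooth_at_comp_R; last exact: step_smooth.
  by apply: smooth_atB; [exact: smooth_at_cst|exact: sq].
- have qp : q p = 0.
    by rewrite /q big1 // => a _; rewrite subrr mulr0 expr0n.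
  have : \forall x \near p, `|q p - q x| < 1.
    by have /cvgrPdist_lt/(_ 1 ltr01) := smooth_at_continuous (sq p).
  apply: filterS => x; rewrite qp sub0r normrN ltr_norml => /andP[_ q1].
  by apply: step_ge1; lra.
- move=> x; apply: contra_neqT; rewrite -ltNge => xr.
  apply: step_le0; rewrite subr_le0 leNgt; apply/negP => q2.
  move: xr; rewrite ltNge => /negP; apply; apply: ltW.
  apply: rV_norm_lt => // a; rewrite !mxE.
  have ha : (2 / r * (x 0 a - p 0 a)) ^+ 2 < 2 ^+ 2.
    apply: (@le_lt_trans _ _ (q x)); last by lra.
    by rewrite /q (bigD1 a) //= lerDl sumr_ge0 // => b _; exact: sqr_ge0.
  move: ha; rewrite -real_normK ?num_real // ltr_pXn2r ?nnegrE //.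
  rewrite normrM gtr0_norm ?divr_gt0 // mulrAC ltr_pdivrMr //.
  by rewrite ltr_pM2l.
Qed.

(** Sine and cosine share one induction, each being the derivative of the other up to sign. *)
Lemma sin_smooth (t : R) : smooth_at (@sin R) t.
Proof.
exists setT => [|k]; first by split=> //; exact: openT.
suff : Ck k setT (@sin R) /\ Ck k setT (@cos R) by case.
elim: k => [|k [IHs IHc]].
  by split; split=> // s _; [exact: continuous_sin|exact: continuous_cos].
split; first exact: (Ck_antiderivative (@is_derive_sin R)).
apply: (Ck_antiderivative (@is_derive_cos R)).
have H : Ck k setT (fun s => -1 * @sin R s).
  by apply: CkM => //; [exact: openT|exact: Ck_cst].
by apply: Ck_eq H => [|s _]; [exact: openT|rewrite mulN1r].
Qed.

End Bump.

(** * Smooth maps of manifolds *)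

Section Charts.
Context {R : realType} {n : nat} {M : manifold R n}.
Implicit Types (c d : chart R n M) (p q : M) (V : normedModType R).

Lemma smooth_on_near V W (A : set V) (f : V -> W : normedModType R) x :
  (\forall y \near x, A y) -> smooth_on A f -> smooth_at f x.
Proof.
by move=> /near_open[U oU UA] sf; exists U => // k; apply: Ck_sub (sf k).
Qed.

Lemma near_dom c p : dom c p -> \forall q \near p, dom c q.
Proof. by move=> cp; apply: open_nbhs_nbhs; split=> //; exact: dom_open. Qed.

Lemma near_img c p : dom c p ->
  \forall y \near coord c p, dom c (param c y) /\ coord c (param c y) = y.
Proof.
move=> cp; have : \forall y \near coord c p, (coord c @` dom c) y.
  by apply: open_nbhs_nbhs; split; [exact: img_open|exists p].
by apply: filterS => y [q cq <-]; rewrite coordK.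
Qed.

Lemma param_cvg c p : dom c p -> {for coord c p, continuous (param c)}.
Proof. by move=> cp; apply: param_continuous; exists p. Qed.

Lemma near_param c p (P : set M) : dom c p -> (\forall q \near p, P q) ->
  \forall y \near coord c p, P (param c y).
Proof.
move=> cp nP; have := param_cvg cp; rewrite /prop_for /continuous_at coordK //.
exact.
Qed.

Lemma near_coord c p (P : set 'rV[R]_n) : dom c p ->
  (\forall y \near coord c p, P y) -> \forall q \near p, P (coord c q).
Proof. by move=> cp nP; apply: (Defs.coord_continuous cp). Qed.

Lemma smooth_at_transition c d p : @atlas _ _ M c -> @atlas _ _ M d ->
  dom c p -> dom d p -> smooth_at (coord d \o param c) (coord c p).
Proof.
move=> ac ad cp dp; have [s _] := atlas_compatible ac ad.
apply: smooth_on_near s; near=> y.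
have [cy ey] : dom c (param c y) /\ coord c (param c y) = y.
  by near: y; exact: near_img.
exists (param c y) => //; split=> //; near: y.
by apply: near_param => //; exact: near_dom.
Unshelve. all: by end_near. Qed.

(** One chart about [p] is enough to establish it; [sfun_at_chart] then gives it in every chart. *)
Definition sfun_at (f : M -> R) p : Prop :=
  exists c, [/\ @atlas _ _ M c, dom c p & smooth_at (f \o param c) (coord c p)].

Lemma sfun_at_chart f p c : sfun_at f p -> @atlas _ _ M c -> dom c p ->
  smooth_at (f \o param c) (coord c p).
Proof.
move=> [d [ad dp sf]] ac cp.
have st := smooth_at_transition ac ad cp dp.
have sf' : smooth_at (f \o param d) ((coord d \o param c) (coord c p)).
  by rewrite /= coordK.
apply: smooth_at_eq (smooth_at_comp_rV st sf'); near=> y => /=.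
rewrite coordK //; near: y; apply: near_param => //; exact: near_dom.
Unshelve. all: by end_near. Qed.

Lemma smooth_funP f : smooth_fun f <-> forall p, sfun_at f p.
Proof.
split=> [sf p|sf c ac].
  have [c ac cp] := atlas_cover p; exists c; split=> //.
  by apply: smooth_on_at (sf c ac) _; [exact: img_open|exists p].
apply: smooth_atP => _ [p cp <-]; exact: sfun_at_chart.
Qed.

Lemma sfun_at_eq (f g : M -> R) p :
  (\forall q \near p, f q = g q) -> sfun_at f p -> sfun_at g p.
Proof.
move=> fg [c [ac cp sf]]; exists c; split=> //.
by apply: smooth_at_eq sf; exact: (near_param cp fg).
Qed.

Lemma sfun_at2 (f g F : M -> R) p :
  (forall c, smooth_at (f \o param c) (coord c p) ->
     smooth_at (g \o param c) (coord c p) ->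
     smooth_at (F \o param c) (coord c p)) ->
  sfun_at f p -> sfun_at g p -> sfun_at F p.
Proof.
move=> H [c [ac cp sf]] sg; exists c; split=> //; apply: H => //.
exact: sfun_at_chart.
Qed.

Lemma sfun_at_cst (a : R) p : sfun_at (fun=> a) p.
Proof.
by have [c ac cp] := atlas_cover p; exists c; split=> //; exact: smooth_at_cst.
Qed.

Lemma sfun_atD (f g : M -> R) p :
  sfun_at f p -> sfun_at g p -> sfun_at (fun q => f q + g q) p.
Proof. by apply: sfun_at2 => c; exact: smooth_atD. Qed.

Lemma sfun_atM (f g : M -> R) p :
  sfun_at f p -> sfun_at g p -> sfun_at (fun q => f q * g q) p.
Proof. by apply: sfun_at2 => c; exact: smooth_atM. Qed.

Lemma sfun_atB (f g : M -> R) p :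
  sfun_at f p -> sfun_at g p -> sfun_at (fun q => f q - g q) p.
Proof. by apply: sfun_at2 => c; exact: smooth_atB. Qed.

Lemma sfun_at_sum I (r : seq I) (F : I -> M -> R) p :
  (forall i, sfun_at (F i) p) -> sfun_at (fun q => \sum_(i <- r) F i q) p.
Proof.
move=> sF; elim: r => [|i r IH].
  by apply: sfun_at_eq (sfun_at_cst 0 p); near=> y; rewrite big_nil.
by apply: sfun_at_eq (sfun_atD (sF i) IH); near=> y; rewrite big_cons.
Unshelve. all: by end_near. Qed.

Lemma sfun_at_prod I (r : seq I) (F : I -> M -> R) p :
  (forall i, sfun_at (F i) p) -> sfun_at (fun q => \prod_(i <- r) F i q) p.
Proof.
move=> sF; elim: r => [|i r IH].
  by apply: sfun_at_eq (sfun_at_cst 1 p); near=> y; rewrite big_nil.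
by apply: sfun_at_eq (sfun_atM (sF i) IH); near=> y; rewrite big_cons.
Unshelve. all: by end_near. Qed.

Lemma smooth_fun_cst (a : R) : smooth_fun (fun _ : M => a).
Proof. by apply/smooth_funP => p; exact: sfun_at_cst. Qed.

Lemma smooth_funD (f g : M -> R) :
  smooth_fun f -> smooth_fun g -> smooth_fun (fun q => f q + g q).
Proof.
by move=> /smooth_funP sf /smooth_funP sg; apply/smooth_funP => p; exact: sfun_atD.
Qed.

Lemma smooth_funM (f g : M -> R) :
  smooth_fun f -> smooth_fun g -> smooth_fun (fun q => f q * g q).
Proof.
by move=> /smooth_funP sf /smooth_funP sg; apply/smooth_funP => p; exact: sfun_atM.
Qed.

Lemma smooth_funB (f g : M -> R) :
  smooth_fun f -> smooth_fun g -> smooth_fun (fun q => f q - g q).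
Proof.
by move=> /smooth_funP sf /smooth_funP sg; apply/smooth_funP => p; exact: sfun_atB.
Qed.

Lemma smooth_funZ (a : R) (f : M -> R) :
  smooth_fun f -> smooth_fun (fun q => a * f q).
Proof. by apply: smooth_funM; exact: smooth_fun_cst. Qed.

Lemma smooth_fun_sum I (r : seq I) (F : I -> M -> R) :
  (forall i, smooth_fun (F i)) -> smooth_fun (fun q => \sum_(i <- r) F i q).
Proof.
move=> sF; apply/smooth_funP => p; apply: sfun_at_sum => i.
by move: p; apply/smooth_funP.
Qed.

Lemma smooth_fun_prod I (r : seq I) (F : I -> M -> R) :
  (forall i, smooth_fun (F i)) -> smooth_fun (fun q => \prod_(i <- r) F i q).
Proof.
move=> sF; apply/smooth_funP => p; apply: sfun_at_prod => i.
by move: p; apply/smooth_funP.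
Qed.

Lemma sfun_at_coord c p a : @atlas _ _ M c -> dom c p ->
  sfun_at (fun q => coord c q 0 a) p.
Proof.
move=> ac cp; exists c; split=> //.
apply: smooth_at_eq (smooth_at_coord a (coord c p)); near=> y => /=.
have [_ -> //] : dom c (param c y) /\ coord c (param c y) = y.
by near: y; exact: near_img.
Unshelve. all: by end_near. Qed.

(** The function is zero outside the image of a compact coordinate ball. As [M] is Hausdorff, this
    image is closed in [M] and not only in the chart domain, so the extension by zero is smooth. *)
Lemma bump_manifold p (W : set M) : (\forall q \near p, W q) ->
  exists f C, [/\ smooth_fun f, closed C, C `<=` W, \forall q \near p, f q = 1 &
    forall q, ~ C q -> f q = 0].
Proof.
move=> pW; have [c ac cp] := atlas_cover p.
have : \forall y \near coord c p,
    [/\ dom c (param c y), coord c (param c y) = y & W (param c y)].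
  near=> y; have [h1 h2] : dom c (param c y) /\ coord c (param c y) = y.
    by near: y; exact: near_img.
  by split=> //; near: y; exact: near_param.
move=> /nbhs_normP[e /= e0 H].
have e2 : 0 < e / 2 by rewrite divr_gt0.
have [b [sb b1 bs]] := bump_exists (coord c p) e2.
pose B := [set y : 'rV[R]_n | `|y - coord c p| <= e / 2].
have BE y : B y -> [/\ dom c (param c y), coord c (param c y) = y & W (param c y)].
  move=> yB; apply: H; rewrite /ball_ /= distrC; apply: le_lt_trans yB _.
  by rewrite ltr_pdivrMr // ltr_pMr // ltr1n.
pose f q := if `[< dom c q >] then b (coord c q) else 0.
exists f, (param c @` B).
have cC : closed (param c @` B).
  apply: compact_closed; first exact: mfd_hausdorff.
  apply: continuous_compact; last exact: cball_compact.
  apply: continuous_in_subspaceT => y; rewrite inE => /BE[h1 h2 _].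
  by rewrite -h2; exact: param_cvg.
have f0 q : ~ (param c @` B) q -> f q = 0.
  move=> nq; rewrite /f; case: asboolP => // cq.
  apply: contra_notP nq => /eqP/bs qB.
  by exists (coord c q) => //; rewrite coordK.
split=> //.
- apply/smooth_funP => q; have [cq|ncq] := pselect (dom c q).
    exists c; split=> //; apply: smooth_at_eq (sb (coord c q)); near=> y.
    have [h1 h2] : dom c (param c y) /\ coord c (param c y) = y.
      by near: y; exact: near_img.
    by rewrite /f /=; case: asboolP => // _; rewrite h2.
  apply: sfun_at_eq (sfun_at_cst 0 q).
  have : \forall q' \near q, ~ (param c @` B) q'.
    apply: open_nbhs_nbhs; split; first exact: closed_openC.
    by move=> [y /BE[h1 _ _] yq]; apply: ncq; rewrite -yq.
  by apply: filterS => q' /f0.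
- by move=> _ [y /BE[_ _ Wy] <-].
- near=> q; rewrite /f; case: asboolP => [_|[]].
    by near: q; exact: (near_coord cp b1).
  by near: q; exact: near_dom.
Unshelve. all: by end_near. Qed.

(** Turns functions that make sense only in a chart, such as coordinates and partial derivatives,
    into smooth functions on all of [M]. *)
Lemma smooth_fun_cutoff (f g : M -> R) (C : set M) : smooth_fun f -> closed C ->
  (forall q, ~ C q -> f q = 0) -> (forall q, C q -> sfun_at g q) ->
  smooth_fun (fun q => f q * g q).
Proof.
move=> /smooth_funP sf cC f0 sg; apply/smooth_funP => q.
have [Cq|nCq] := pselect (C q); first by apply: sfun_atM => //; exact: sg.
apply: sfun_at_eq (sfun_at_cst 0 q).
have : \forall q' \near q, ~ C q'.
  by apply: open_nbhs_nbhs; split=> //; exact: closed_openC.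
by apply: filterS => q' /f0 ->; rewrite mul0r.
Qed.

Definition msmooth_at V (g : V -> M) (x : V) : Prop :=
  exists d, [/\ @atlas _ _ M d, \forall y \near x, dom d (g y) &
    smooth_at (coord d \o g) x].

Lemma msmooth_continuous V (g : V -> M) x :
  msmooth_at g x -> {for x, continuous g}.
Proof.
move=> [d [ad dg /smooth_at_continuous sg]].
have dgx : dom d (g x) by exact: nbhs_singleton dg.
have H : (param d \o (coord d \o g)) y @[y --> x] --> g x.
  rewrite -[in X in _ --> X](coordK dgx).
  by apply: (continuous_comp (f := coord d \o g)) => //; exact: param_cvg.
apply: cvg_trans H; apply: near_eq_cvg; apply: filterS dg => y dy /=.
by rewrite coordK.
Qed.

Lemma msmooth_at_chart V (g : V -> M) x d : msmooth_at g x ->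
  @atlas _ _ M d -> dom d (g x) ->
  (\forall y \near x, dom d (g y)) /\ smooth_at (coord d \o g) x.
Proof.
move=> sg; have cg := msmooth_continuous sg.
move: sg => [c [ac cgx sg]] ad dgx; split.
  by apply: cg; exact: near_dom.
have cx : dom c (g x) by exact: nbhs_singleton cgx.
have st := smooth_at_transition ac ad cx dgx.
apply: smooth_at_eq (smooth_at_comp sg st).
by apply: filterS cgx => y cy /=; rewrite coordK.
Qed.

Lemma msmooth_at_eq V (g h : V -> M) x :
  (\forall y \near x, g y = h y) -> msmooth_at g x -> msmooth_at h x.
Proof.
move=> gh [d [ad dg sg]]; exists d; split=> //.
  by apply: filterS2 gh dg => y ->.
by apply: smooth_at_eq sg; apply: filterS gh => y /= ->.
Qed.

Lemma msmooth_at_comp V m (g : 'rV[R]_m -> M) (h : V -> 'rV[R]_m) x :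
  smooth_at h x -> msmooth_at g (h x) -> msmooth_at (fun y => g (h y)) x.
Proof.
move=> sh [d [ad dg sg]]; exists d; split=> //.
  exact: (smooth_at_continuous sh dg).
exact: (smooth_at_comp sh sg).
Qed.

Lemma msmooth_param c p : @atlas _ _ M c -> dom c p ->
  msmooth_at (param c) (coord c p).
Proof.
move=> ac cp; exists c; split=> //.
  by apply: near_param => //; exact: near_dom.
apply: smooth_at_eq (smooth_at_id _).
by apply: filterS (near_img cp) => y [_ /= ->].
Qed.

Lemma sfun_at_msmooth V (f : M -> R) (g : V -> M) x :
  msmooth_at g x -> sfun_at f (g x) -> smooth_at (fun y => f (g y)) x.
Proof.
move=> [c [ac cg sg]] sf; have cx : dom c (g x) by exact: nbhs_singleton cg.
have sf' := sfun_at_chart sf ac cx.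
apply: smooth_at_eq (smooth_at_comp_rV sg sf').
by apply: filterS cg => y cy /=; rewrite coordK.
Qed.

Lemma smooth_curveP (g : R -> M) : smooth_curve g <-> forall t, msmooth_at g t.
Proof.
split=> [[cg sg] t|sg].
  have [c ac ct] := atlas_cover (g t); exists c; split=> //.
    by apply: cg; exact: near_dom.
  by apply: smooth_on_near (sg c ac); apply: cg; exact: near_dom.
split=> [t|c ac]; first exact: msmooth_continuous.
by apply: smooth_atP => t ct; have [] := msmooth_at_chart (sg t) ac ct.
Qed.

End Charts.

(** * Smooth maps between manifolds *)

Section Maps.
Context {R : realType} {m n : nat} {M : manifold R m} {N : manifold R n}.
Implicit Types (F : M -> N).

Definition msmap_at F (p : M) : Prop :=
  exists c, [/\ @atlas _ _ M c, dom c p & msmooth_at (F \o param c) (coord c p)].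

Lemma msmap_at_chart F p c : msmap_at F p -> @atlas _ _ M c -> dom c p ->
  msmooth_at (F \o param c) (coord c p).
Proof.
move=> [d [ad dp sF]] ac cp.
have st := smooth_at_transition ac ad cp dp.
have sF' : msmooth_at (F \o param d) ((coord d \o param c) (coord c p)).
  by rewrite /= coordK.
apply: msmooth_at_eq (msmooth_at_comp st sF'); near=> y => /=.
rewrite coordK //; near: y; apply: near_param => //; exact: near_dom.
Unshelve. all: by end_near. Qed.

Lemma msmap_continuous F p : msmap_at F p -> {for p, continuous F}.
Proof.
move=> [c [ac cp /msmooth_continuous sF]].
have H : ((F \o param c) \o coord c) q @[q --> p] --> F p.
  rewrite -[in X in _ --> F X](coordK cp).
  by apply: (continuous_comp (f := coord c)) => //; exact: Defs.coord_continuous.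
apply: cvg_trans H; apply: near_eq_cvg; apply: filterS (near_dom cp) => q cq /=.
by rewrite coordK.
Qed.

Lemma smooth_mapP F : smooth_map F <-> forall p, msmap_at F p.
Proof.
split=> [[cF sF] p|sF].
  have [c ac cp] := atlas_cover p; exists c; split=> //.
  have [d ad dp] := atlas_cover (F p).
  have nd : \forall q \near p, dom d (F q) by apply: cF; exact: near_dom.
  exists d; split=> //; first exact: (near_param cp nd).
  apply: smooth_on_near (sF c d ac ad); near=> y.
  have [cy ey] : dom c (param c y) /\ coord c (param c y) = y.
    by near: y; exact: near_img.
  exists (param c y) => //; split=> //; near: y.
  exact: (near_param cp nd).
split=> [p|c d ac ad]; first exact: msmap_continuous.
apply: smooth_atP => _ [p [cp dp] <-].
have sp := msmap_at_chart (sF p) ac cp.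
have [|_] := msmooth_at_chart sp ad; last by [].
by rewrite /= coordK.
Unshelve. all: by end_near. Qed.

Lemma msmooth_at_map (V : normedModType R) F (g : V -> M) x :
  msmooth_at g x -> msmap_at F (g x) -> msmooth_at (fun y => F (g y)) x.
Proof.
move=> [c [ac cg sg]] sF; have cx : dom c (g x) by exact: nbhs_singleton cg.
have sF' := msmap_at_chart sF ac cx.
apply: msmooth_at_eq (msmooth_at_comp sg sF').
by apply: filterS cg => y cy /=; rewrite coordK.
Qed.

Lemma sfun_at_map F (f : N -> R) p :
  msmap_at F p -> sfun_at f (F p) -> sfun_at (fun q => f (F q)) p.
Proof.
move=> [c [ac cp sF]] sf; exists c; split=> //.
apply: (sfun_at_msmooth (f := f) sF).
by rewrite /= coordK.
Qed.

Lemma smooth_fun_map F (f : N -> R) :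
  smooth_map F -> smooth_fun f -> smooth_fun (fun q => f (F q)).
Proof.
move=> /smooth_mapP sF /smooth_funP sf; apply/smooth_funP => p.
exact: sfun_at_map.
Qed.

Lemma smooth_curve_map F (g : R -> M) :
  smooth_map F -> smooth_curve g -> smooth_curve (fun t => F (g t)).
Proof.
move=> /smooth_mapP sF /smooth_curveP sg; apply/smooth_curveP => t.
exact: msmooth_at_map.
Qed.

End Maps.

(** * Tangent vectors *)

Section TangentVectors.
Context {R : realType} {n : nat} {M : manifold R n}.
Implicit Types (p q : M) (v w : tvec M) (f g : M -> R).

Lemma tangent_lin p v (a : R) f g : tangent p v -> smooth_fun f -> smooth_fun g ->
  v (fun x => a * f x + g x) = a * v f + v g.
Proof. by case=> h _ _; exact: h. Qed.

Lemma tangent_prod p v f g : tangent p v -> smooth_fun f -> smooth_fun g ->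
  v (fun x => f x * g x) = f p * v g + g p * v f.
Proof. by case=> _ h _; exact: h. Qed.

Lemma tangent_nonsmooth p v f : tangent p v -> ~ smooth_fun f -> v f = 0.
Proof. by case=> _ _; exact. Qed.

Lemma tangent_cst p v (a : R) : tangent p v -> v (fun=> a) = 0.
Proof.
move=> tv; have s1 (b : R) := @smooth_fun_cst R n M b.
have v1 : v (fun=> 1) = 0.
  have := tangent_prod tv (s1 1) (s1 1); rewrite mulr1 mul1r => h.
  by apply: (addrI (v (fun=> 1))); rewrite addr0 -h.
have v0 : v (fun=> 0) = 0.
  have := tangent_lin 1 tv (s1 0) (s1 0); rewrite mulr0 addr0 mul1r => h.
  by apply: (addrI (v (fun=> 0))); rewrite addr0 -h.
have := tangent_lin a tv (s1 1) (s1 0).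
by rewrite mulr1 addr0 v1 v0 mulr0 addr0.
Qed.

Lemma tangentD p v f g : tangent p v -> smooth_fun f -> smooth_fun g ->
  v (fun x => f x + g x) = v f + v g.
Proof.
move=> tv sf sg; have := tangent_lin 1 tv sf sg; rewrite mul1r => <-.
by congr v; apply/funext => x; rewrite mul1r.
Qed.

Lemma tangentZ p v (a : R) f : tangent p v -> smooth_fun f ->
  v (fun x => a * f x) = a * v f.
Proof.
move=> tv sf; have := tangent_lin a tv sf (@smooth_fun_cst R n M 0).
rewrite (tangent_cst 0 tv) addr0 => <-.
by congr v; apply/funext => x; rewrite addr0.
Qed.

Lemma tangentB p v f g : tangent p v -> smooth_fun f -> smooth_fun g ->
  v (fun x => f x - g x) = v f - v g.
Proof.
move=> tv sf sg; have := tangent_lin (-1) tv sg sf; rewrite mulN1r addrC => <-.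
by congr v; apply/funext => x; rewrite mulN1r addrC.
Qed.

Lemma tangent_sum p v I (r : seq I) (F : I -> M -> R) :
  tangent p v -> (forall i, smooth_fun (F i)) ->
  v (fun x => \sum_(i <- r) F i x) = \sum_(i <- r) v (F i).
Proof.
move=> tv sF; elim: r => [|i r IH].
  rewrite big_nil -[RHS](tangent_cst 0 tv); congr v.
  by apply/funext => x; rewrite big_nil.
rewrite big_cons -IH -(tangentD tv) //; last exact: smooth_fun_sum.
by congr v; apply/funext => x; rewrite big_cons.
Qed.

(** Derivations are local: a bump function supported where [f = g] annihilates [f - g], and the
    Leibniz rule is applied to this zero product. *)
Lemma tangent_germ p v f g : tangent p v -> smooth_fun f -> smooth_fun g ->
  (\forall q \near p, f q = g q) -> v f = v g.
Proof.
move=> tv sf sg fg; have [h [C [sh _ CW h1 h0]]] := bump_manifold fg.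
apply/eqP; rewrite -subr_eq0 -(tangentB tv sf sg); apply/eqP.
have E : (fun x => h x * (f x - g x)) = (fun=> 0).
  apply/funext => x; have [Cx|/h0->] := pselect (C x); last by rewrite mul0r.
  by rewrite (CW _ Cx) subrr mulr0.
have := tangent_prod tv sh (smooth_funB sf sg).
rewrite E (tangent_cst 0 tv) (nbhs_singleton h1) mul1r.
by rewrite (nbhs_singleton fg) subrr mul0r addr0.
Qed.

Lemma tangent0 p : tangent p 0.
Proof.
split=> // [a f g _ _|f g _ _]; first by rewrite mulr0 addr0.
by rewrite !mulr0 addr0.
Qed.

Lemma tangent_lincomb p (a : R) v w :
  tangent p v -> tangent p w -> tangent p (a *: v + w).
Proof.
have E : (a *: v + w) =1 (fun f => a * v f + w f) by [].
move=> tv tw; split=> [b f g sf sg|f g sf sg|f nf]; rewrite !E.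
- by rewrite !(tangent_lin b tv, tangent_lin b tw) //; ring.
- by rewrite (tangent_prod tv) // (tangent_prod tw) //; ring.
- by rewrite (tangent_nonsmooth tv nf) (tangent_nonsmooth tw nf) mulr0 addr0.
Qed.

Lemma tangent_scale p (a : R) v : tangent p v -> tangent p (a *: v).
Proof. by move=> tv; have := tangent_lincomb a tv (tangent0 p); rewrite addr0. Qed.

Lemma tangent_add p v w : tangent p v -> tangent p w -> tangent p (v + w).
Proof. by move=> tv tw; have := tangent_lincomb 1 tv tw; rewrite scale1r. Qed.

Lemma tangent_sub p v w : tangent p v -> tangent p w -> tangent p (v - w).
Proof.
by move=> tv tw; have := tangent_lincomb (-1) tw tv; rewrite scaleN1r addrC.
Qed.

Lemma tangent_sumv p I (r : seq I) (F : I -> tvec M) :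
  (forall i, tangent p (F i)) -> tangent p (\sum_(i <- r) F i).
Proof.
move=> tF; elim: r => [|i r IH]; first by rewrite big_nil; exact: tangent0.
by rewrite big_cons; exact: tangent_add.
Qed.

Lemma tvec_sumE I (r : seq I) (F : I -> tvec M) f :
  (\sum_(i <- r) F i) f = \sum_(i <- r) F i f.
Proof. by elim: r => [|i r IH]; rewrite ?big_nil // !big_cons -IH. Qed.

Lemma tangent_ext p v w : tangent p v -> tangent p w ->
  (forall f, smooth_fun f -> v f = w f) -> v = w.
Proof.
move=> tv tw vw; apply/funext => f; have [/vw//|nf] := pselect (smooth_fun f).
by rewrite (tangent_nonsmooth tv nf) (tangent_nonsmooth tw nf).
Qed.

(* By Hadamard's lemma [f] is, near [p], its value at [p] plus a combination of
   the centred coordinates with smooth coefficients. *)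
Lemma tangent_chart c p v (h : 'I_n -> M -> R) :
  @atlas _ _ M c -> dom c p -> tangent p v ->
  (forall a, smooth_fun (h a)) ->
  (forall a, \forall q \near p, h a q = coord c q 0 a) ->
  forall f, smooth_fun f ->
  v f = \sum_a v (h a) * 'D_('e_a) (f \o param c) (coord c p).
Proof.
move=> ac cp tv sh hc f sf.
have [r0 r0_gt0 Hr] : exists2 r : R, 0 < r & forall y, `|y - coord c p| < r ->
    dom c (param c y) /\ coord c (param c y) = y.
  have /nbhs_normP[r r0 Hr] := near_img cp.
  by exists r => // y yr; apply: Hr; rewrite /ball_ /= distrC.
have sfc : smooth_on [set y | `|y - coord c p| < r0] (f \o param c).
  apply: smooth_atP => y /Hr[cy ey]; rewrite -ey; apply: sfun_at_chart => //.
  by move: (param c y); apply/smooth_funP.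
have [G [sG Gp HG]] := hadamard sfc.
have nW : \forall q \near p, dom c q /\ `|coord c q - coord c p| < r0.
  near=> q; split; first by near: q; exact: near_dom.
  near: q; apply: (near_coord cp (P := fun y => `|y - coord c p| < r0)).
  apply/nbhs_normP; exists r0 => // y; by rewrite /ball_ /= distrC.
have [b [C [sb cC CW b1 b0]]] := bump_manifold nW.
(* Derivations act on functions on all of [M], so the Hadamard coefficients are cut off. *)
pose g a q := b q * G a (coord c q).
have sg a : smooth_fun (g a).
  apply: (smooth_fun_cutoff sb cC b0) => q /CW[cq qr]; exists c; split=> //.
  have oU := @open_nball _ _ (coord c p) r0.
  apply: smooth_at_eq (smooth_on_at oU (sG a) qr).
  by apply: filterS (near_img cq) => y [_ /= ->].
have E : \forall q \near p, f q = f p + \sum_a (h a q - h a p) * g a q.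
  have hc' : \forall q \near p, forall a, h a q = coord c q 0 a by exact: filter_forall.
  have hcp := nbhs_singleton hc'.
  near=> q; have cq : dom c q by near: q; exact: near_dom.
  have qr : `|coord c q - coord c p| < r0.
    by near: q; apply: filterS nW => q [].
  have hq : forall a, h a q = coord c q 0 a by near: q.
  have bq : b q = 1 by near: q.
  have := HG _ qr; rewrite /= !coordK // => ->; congr (_ + _).
  by apply: eq_bigr => a _; rewrite hcp hq !mxE /g bq mul1r.
have s1 a : smooth_fun (fun q => h a q - h a p).
  by apply: smooth_funB => //; exact: smooth_fun_cst.
have s2 : smooth_fun (fun q => \sum_a (h a q - h a p) * g a q).
  by apply: smooth_fun_sum => a; exact: smooth_funM.
have s3 : smooth_fun (fun q => f p + \sum_a (h a q - h a p) * g a q).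
  by apply: smooth_funD => //; exact: smooth_fun_cst.
rewrite (tangent_germ tv sf s3 E) (tangentD tv) //; last exact: smooth_fun_cst.
rewrite (tangent_cst _ tv) add0r (tangent_sum _ tv); last first.
  by move=> a; exact: smooth_funM.
apply: eq_bigr => a _; rewrite (tangent_prod tv) // subrr mul0r add0r.
rewrite (tangentB tv) //; last exact: smooth_fun_cst.
rewrite (tangent_cst _ tv) subr0 mulrC; congr (_ * _).
by rewrite /g (nbhs_singleton b1) mul1r Gp.
Unshelve. all: by end_near. Qed.

(** The coordinate vector, set to zero on non-smooth functions as [tangent] demands. *)
Definition pderiv (c : chart R n M) (a : 'I_n) (q : M) : tvec M := fun f =>
  if `[< smooth_fun f >] then 'D_('e_a) (f \o param c) (coord c q) else 0.

Lemma pderivE c a q f : smooth_fun f ->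
  pderiv c a q f = 'D_('e_a) (f \o param c) (coord c q).
Proof. by move=> sf; rewrite /pderiv; case: asboolP. Qed.

Lemma tangent_pderiv c a q : @atlas _ _ M c -> dom c q ->
  tangent q (pderiv c a q).
Proof.
move=> ac cq.
have d f : smooth_fun f -> derivable (f \o param c) (coord c q) ('e_a : 'rV[R]_n).
  by move=> /smooth_funP sf; apply: smooth_at_derivable; exact: sfun_at_chart.
split=> [b f g sf sg|f g sf sg|f nf].
- rewrite !pderivE //; last by apply: smooth_funD => //; exact: smooth_funZ.
  have -> : (fun x => b * f x + g x) \o param c
     = b *: (f \o param c) + (g \o param c) by [].
  rewrite deriveD; [|by apply: derivableZ; exact: d|exact: d].
  by rewrite deriveZ //; exact: d.
- rewrite !pderivE //; last exact: smooth_funM.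
  have -> : (fun x => f x * g x) \o param c = (f \o param c) * (g \o param c) by [].
  by rewrite deriveM /= ?coordK //; exact: d.
- by rewrite /pderiv; case: asboolP.
Qed.

Lemma sfun_at_pderiv c a q f : @atlas _ _ M c -> dom c q -> smooth_fun f ->
  sfun_at (fun p => pderiv c a p f) q.
Proof.
move=> ac cq sf; exists c; split=> //.
have sfc : smooth_at (f \o param c) (coord c q).
  by apply: sfun_at_chart => //; exact: ((smooth_funP f).1 sf).
apply: smooth_at_eq (smooth_at_derive ('e_a : 'rV[R]_n) sfc).
by apply: filterS (near_img cq) => y [_ ey] /=; rewrite pderivE // ey.
Qed.

(** The cut-off is 1 around every [q] close to [p], so cut-off coordinates have the germs of the
    coordinates at all these [q] and not only at [p]. *)
Lemma cutoff_near_one c p : @atlas _ _ M c -> dom c p ->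
  exists (f : M -> R) C, [/\ smooth_fun f, closed C, C `<=` dom c,
    forall q, ~ C q -> f q = 0 & \forall q \near p, \forall q' \near q, f q' = 1].
Proof.
move=> ac cp; have [f [C [sf cC CW f1 f0]]] := bump_manifold (near_dom cp).
by exists f, C; split=> //; apply: near_join.
Qed.

(** The functions and fields are global, while the expansion holds at every point near [p]. Vector
    fields can thus be expanded near [p] with coefficients that are smooth on all of [M]. *)
Lemma local_frame p : exists (h : 'I_n -> M -> R) (X : 'I_n -> M -> tvec M),
  [/\ forall a, smooth_fun (h a), forall a, vfield (X a) &
    \forall q \near p, forall v, tangent q v -> v = \sum_a v (h a) *: X a q].
Proof.
have [c ac cp] := atlas_cover p.
have [f [C [sf cC CW f0 f1]]] := cutoff_near_one ac cp.
exists (fun a q => f q * coord c q 0 a), (fun a q => f q *: pderiv c a q).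
have sh a : smooth_fun (fun q => f q * coord c q 0 a).
  by apply: (smooth_fun_cutoff sf cC f0) => q /CW cq; exact: sfun_at_coord.
split=> // [a|].
- split=> [q|g sg].
    have [Cq|/f0->] := pselect (C q); last by rewrite scale0r; exact: tangent0.
    by apply: tangent_scale; apply: tangent_pderiv => //; exact: CW.
  by apply: (smooth_fun_cutoff sf cC f0) => q /CW cq; exact: sfun_at_pderiv.
- near=> q => v tv.
  have cq : dom c q by near: q; exact: near_dom.
  have fq : \forall q' \near q, f q' = 1 by near: q.
  rewrite (nbhs_singleton fq).
  have tw : tangent q (\sum_a v (fun q => f q * coord c q 0 a) *: (1 *: pderiv c a q)).
    apply: tangent_sumv => a; apply: tangent_scale; rewrite scale1r.
    exact: tangent_pderiv.
  apply: (tangent_ext tv tw) => g sg.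
  rewrite tvec_sumE (tangent_chart ac cq tv sh _ sg).
    by apply: eq_bigr => a _; rewrite scale1r -pderivE.
  by move=> a; apply: filterS fq => q' ->; rewrite mul1r.
Unshelve. all: by end_near. Qed.

Lemma velocityE (g : R -> M) f : smooth_fun f ->
  velocity g f = (f \o g)^`()%classic 0.
Proof. by move=> sf; rewrite /velocity; case: asboolP. Qed.

Lemma tangent_velocity (g : R -> M) : smooth_curve g -> tangent (g 0) (velocity g).
Proof.
move=> /smooth_curveP sg.
have d f : smooth_fun f -> derivable (f \o g) 0 1.
  move=> /smooth_funP sf; apply: smooth_at_derivable.
  exact: (sfun_at_msmooth (sg 0)).
split=> [b f h sf sh|f h sf sh|f nf].
- rewrite !velocityE ?derive1E //; last by apply: smooth_funD => //; exact: smooth_funZ.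
  have -> : (fun x => b * f x + h x) \o g = b *: (f \o g) + (h \o g) by [].
  rewrite deriveD; [|by apply: derivableZ; exact: d|exact: d].
  by rewrite deriveZ //; exact: d.
- rewrite !velocityE ?derive1E //; last exact: smooth_funM.
  have -> : (fun x => f x * h x) \o g = (f \o g) * (h \o g) by [].
  by rewrite deriveM //; exact: d.
- by rewrite /velocity; case: asboolP.
Qed.

Lemma velocity_at p (g : R -> M) : smooth_curve g -> g 0 = p ->
  tangent p (velocity g).
Proof. by move=> /tangent_velocity + <-. Qed.

(** Links the two descriptions of tangent vectors: [tsum] speaks of velocities, everything else of
    derivations. *)
Lemma curve_exists p v : tangent p v ->
  exists g : R -> M, [/\ smooth_curve g, g 0 = p & velocity g = v].
Proof.
move=> tv; have [c ac cp] := atlas_cover p.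
have [f [C [sf cC CW f0 f1]]] := cutoff_near_one ac cp.
pose h a q := f q * coord c q 0 a.
have sh a : smooth_fun (h a).
  by apply: (smooth_fun_cutoff sf cC f0) => q /CW cq; exact: sfun_at_coord.
pose u : 'rV[R]_n := \row_a v (h a).
have /nbhs_normP[r /= r0 Hr] := near_img cp.
(* The amplitude [e] satisfies [e * |u| < r], and dividing the time by [e] restores the velocity [u]
   at time [0]. *)
pose e := r / (1 + `|u|).
have u1 : 0 < 1 + `|u| by rewrite ltr_pwDl.
have e0 : 0 < e by rewrite divr_gt0.
(* [sin] keeps the curve inside the chart for all times. *)
pose l (t : R) := (e * sin (t / e)) *: u + coord c p.
have l0 : l 0 = coord c p by rewrite /l mul0r sin0 mulr0 scale0r add0r.
have sl t : smooth_at l t.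
  apply: smooth_atD; last exact: smooth_at_cst.
  apply: smooth_atZ; apply: smooth_atM; first exact: smooth_at_cst.
  apply: smooth_at_comp_R; last exact: sin_smooth.
  by apply: smooth_atM; [exact: smooth_at_id|exact: smooth_at_cst].
have lr t : dom c (param c (l t)) /\ coord c (param c (l t)) = l t.
  apply: Hr; rewrite /ball_ /= distrC /l addrK normrZ normrM (gtr0_norm e0).
  apply: (@le_lt_trans _ _ (e * `|u|)).
    rewrite ler_wpM2r // ler_piMr //; first exact: ltW.
    by rewrite ler_norml sin_geN1 sin_le1.
  rewrite /e mulrAC ltr_pdivrMr // ltr_pM2l // ltrDr //.
have sg : smooth_curve (fun t => param c (l t)).
  apply/smooth_curveP => t; apply: msmooth_at_comp => //.
  by have [ct <-] := lr t; exact: msmooth_param.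
have g0 : param c (l 0) = p by rewrite l0 coordK.
exists (fun t => param c (l t)); split=> //.
apply: (tangent_ext (velocity_at sg g0) tv) => F sF.
have hc a : \forall q \near p, h a q = coord c q 0 a.
  by apply: filterS (nbhs_singleton f1) => q fq; rewrite /h fq mul1r.
rewrite velocityE // derive1E (tangent_chart ac cp tv sh hc sF).
have sFc : smooth_at (F \o param c) (coord c p).
  by apply: sfun_at_chart => //; exact: ((smooth_funP F).1 sF).
have dF := smooth_at_differentiable sFc.
have dl : is_derive (0 : R) 1 l u.
  have ds : is_derive (0 : R) 1 (fun t : R => e * sin (t / e)) 1.
    apply: is_derive_eq; rewrite /GRing.scale /= mul0r cos0.
    by field; rewrite gt_eqF.
  have [d1 e1] := ds.
  have l_lin : linear (fun a : R => a *: u).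
    by move=> x y z; rewrite scalerDl scalerA.
  pose lM := GRing.isLinear.Build _ _ _ _ _ l_lin.
  pose L : {linear R -> 'rV[R]_n} := HB.pack (fun a : R => a *: u) lM.
  have d2 := @is_derive_linear_comp R R R _ L _ 0 1 (@scalel_continuous _ _ u) d1.
  rewrite e1 /= scale1r in d2.
  have := is_deriveD d2 (is_derive_cst (coord c p) (0 : R) 1).
  by rewrite addr0.
have [dl1 dl2] := dl.
have dF' : differentiable (F \o param c) (l 0) by rewrite l0.
have [_] := is_derive_diff_comp dl1 dF'.
rewrite dl2 -deriveE // derive_rV // l0 => ->.
by apply: eq_bigr => a _; rewrite mxE.
Qed.

End TangentVectors.

(** * Tangent maps *)

Section Push.
Context {R : realType} {m n : nat} {M : manifold R m} {N : manifold R n}.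
Implicit Types (F : M -> N).

Lemma pushE F v f : smooth_fun f -> push F v f = v (f \o F).
Proof. by move=> sf; rewrite /push; case: asboolP. Qed.

Lemma tangent_push F p v : smooth_map F -> tangent p v ->
  tangent (F p) (push F v).
Proof.
move=> sF tv; have sc f := smooth_fun_map sF (f := f).
split=> [a f g sf sg|f g sf sg|f nf].
- rewrite !pushE // -?(tangent_lin _ tv) //; try exact: sc.
  by apply: smooth_funD => //; exact: smooth_funZ.
- rewrite !pushE // -?(tangent_prod tv) //; try exact: sc.
  exact: smooth_funM.
- by rewrite /push; case: asboolP.
Qed.

Lemma push_velocity F (g : R -> M) : smooth_map F ->
  push F (velocity g) = velocity (fun t => F (g t)).
Proof.
move=> sF; apply/funext => f; have [sf|nf] := pselect (smooth_fun f).
  by rewrite pushE // !velocityE //; exact: smooth_fun_map.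
by rewrite /push /velocity; case: asboolP.
Qed.

Lemma push_lincomb F (a : R) v w : push F (a *: v + w) = a *: push F v + push F w.
Proof.
apply/funext => f; have [sf|nf] := pselect (smooth_fun f).
  by rewrite -[RHS]/(a * push F v f + push F w f) !pushE.
rewrite -[RHS]/(a * push F v f + push F w f) /push; case: asboolP => // _.
by rewrite mulr0 addr0.
Qed.

Lemma push_sub F v w : push F (v - w) = push F v - push F w.
Proof. by rewrite addrC -scaleN1r push_lincomb scaleN1r addrC. Qed.

Lemma push0 F : push F 0 = 0.
Proof. by apply/funext => f; rewrite /push; case: asboolP. Qed.

End Push.

(** * Vector bundles *)

Section Trivialisation.
Context {R : realType} {n k : nat} {M : manifold R n} {E : vbundle M k}.
Implicit Types (m : M) (p : E) (c : chart R n M) (d : chart R (n + k) E)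
  (e : forall m, fibre E m) (lam : forall m, fibre E m -> R).

Lemma qE_pt m (x : fibre E m) : qE (pt x) = m.
Proof. by rewrite /qE /pt incK. Qed.

Lemma pt_tagged p : pt (tagged (split_tot p)) = p.
Proof. by rewrite /pt -[RHS]split_totK; case: (split_tot p). Qed.

Lemma ell_pt lam m (x : fibre E m) : ell lam (pt x) = lam m x.
Proof. by rewrite /ell /pt incK. Qed.

(** Smooth sections of [E^*], encoded as in [side_section]. They provide the test functions
    [ell lam] on [E]. *)
Definition dual_section lam : Prop :=
  (forall m (a : R) x y, lam m (a *: x + y) = a * lam m x + lam m y) /\
  (forall e, esection e -> smooth_fun (fun m => lam m (e m))).

Lemma dual0 lam m : dual_section lam -> lam m 0 = 0.
Proof.
case=> h _; have := h m 1 0 0; rewrite scaler0 addr0 mul1r => H.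
by apply: (addrI (lam m 0)); rewrite addr0 -H.
Qed.

Lemma dualD lam m x y : dual_section lam -> lam m (x + y) = lam m x + lam m y.
Proof. by case=> h _; have := h m 1 x y; rewrite scale1r mul1r. Qed.

Lemma dualZ lam m (a : R) x : dual_section lam -> lam m (a *: x) = a * lam m x.
Proof. by move=> dl; have := dl.1 m a x 0; rewrite (dual0 m dl) !addr0. Qed.

Lemma dual_sum lam m I (r : seq I) (x : I -> fibre E m) : dual_section lam ->
  lam m (\sum_(i <- r) x i) = \sum_(i <- r) lam m (x i).
Proof.
move=> dl; elim: r => [|i r IH]; first by rewrite !big_nil (dual0 m dl).
by rewrite !big_cons (dualD _ _ dl) IH.
Qed.

Definition vtriv c d : Prop :=
  [/\ @atlas _ _ M c, @atlas _ _ E d, dom d = [set p | dom c (qE p)] &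
    forall m, dom c m -> exists phi : {linear fibre E m -> 'rV[R]_k},
      bijective phi /\
      forall x : fibre E m, coord d (pt x) = row_mx (coord c m) (phi x)].

Lemma vtriv_exists m : exists c d, vtriv c d /\ dom c m.
Proof.
by have [c [d [ac ad cm dd H]]] := vb_trivial E m; exists c, d; split.
Qed.

Section LocalTrivialisation.
Context c d (cd : vtriv c d).

Let ac : @atlas _ _ M c. Proof. by case: cd. Qed.
Let ad : @atlas _ _ E d. Proof. by case: cd. Qed.

Lemma vtriv_dom p : dom d p <-> dom c (qE p).
Proof. by case: cd => _ _ -> _. Qed.

Lemma vtriv_dom_pt m (x : fibre E m) : dom d (pt x) <-> dom c m.
Proof. by rewrite vtriv_dom qE_pt. Qed.

Definition vcoord m (x : fibre E m) : 'rV[R]_k := rsubmx (coord d (pt x)).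

Lemma vcoord_coord m (x : fibre E m) : dom c m ->
  coord d (pt x) = row_mx (coord c m) (vcoord x).
Proof.
case: cd => _ _ _ H /H [phi [_ h]]; by rewrite /vcoord h row_mxKr.
Qed.

Lemma coord_vtriv p : dom c (qE p) ->
  coord d p = row_mx (coord c (qE p)) (rsubmx (coord d p)).
Proof.
move=> cp; rewrite -[p in LHS]pt_tagged vcoord_coord //.
by rewrite /vcoord pt_tagged.
Qed.

Lemma vcoord_phi m : dom c m -> exists phi : {linear fibre E m -> 'rV[R]_k},
  bijective phi /\ forall x : fibre E m, vcoord x = phi x.
Proof.
case: cd => _ _ _ H /H [phi [bphi h]]; exists phi; split=> // x.
by rewrite /vcoord h row_mxKr.
Qed.

Lemma qE_msmap_at p : dom c (qE p) -> msmap_at (@qE _ _ _ M E) p.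
Proof.
move=> cp; have dp : dom d p by apply/vtriv_dom.
exists d; split=> //; exists c; split=> //.
  by apply: filterS (near_img dp) => y [/vtriv_dom].
have sl : smooth_at (lsubmx : 'rV[R]_(n + k) -> 'rV[R]_n) (coord d p).
  apply/smooth_at_rowP => a; apply: smooth_at_eq (smooth_at_coord (lshift k a) _).
  by near=> y; rewrite mxE.
apply: smooth_at_eq sl; apply: filterS (near_img dp) => y [dy ey] /=.
rewrite -[y in LHS]ey coord_vtriv; last exact/vtriv_dom.
by rewrite row_mxKl.
Unshelve. all: by end_near. Qed.

(** The inverse of the trivialisation, obtained by choice because [vtriv] only asserts that the
    isomorphisms exist. *)
Definition vframe (u : 'rV[R]_k) m : fibre E m :=
  xget 0 [set x : fibre E m | vcoord x = u].

Lemma vframeK u m : dom c m -> vcoord (vframe u m) = u.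
Proof.
move=> cm; have [phi [[psi psiK phiK] h]] := vcoord_phi cm.
apply: (@xgetPex _ 0 [set x : fibre E m | vcoord x = u]).
by exists (psi u); rewrite /= h phiK.
Qed.

Lemma vframe_sum m (x : fibre E m) : dom c m ->
  x = \sum_a vcoord x 0 a *: vframe 'e_a m.
Proof.
move=> cm; have [phi [bphi h]] := vcoord_phi cm.
apply: (bij_inj bphi); rewrite linear_sum -h [LHS]row_sum_delta.
by apply: eq_bigr => a _; rewrite linearZ /= -h vframeK.
Qed.

Lemma vcoordZ m (a : R) (x : fibre E m) : dom c m -> vcoord (a *: x) = a *: vcoord x.
Proof. by move=> /vcoord_phi[phi [_ h]]; rewrite !h linearZ. Qed.

Lemma vcoord_lin m (a : R) (x y : fibre E m) : dom c m ->
  vcoord (a *: x + y) = a *: vcoord x + vcoord y.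
Proof. by move=> /vcoord_phi[phi [_ h]]; rewrite !h linearP. Qed.

Lemma section_msmap_at e m (u : M -> 'rV[R]_k) : dom c m ->
  (forall a, sfun_at (fun m => u m 0 a) m) ->
  (\forall m' \near m, vcoord (e m') = u m') ->
  msmap_at (fun m => pt (e m) : E) m.
Proof.
move=> cm su eu; exists c; split=> //; exists d; split=> //.
  by apply: filterS (near_img cm) => y [cy _]; apply/vtriv_dom_pt.
have ncm : \forall y \near coord c m, coord d (pt (e (param c y))) =
    row_mx y (u (param c y)).
  near=> y; have [cy ey] : dom c (param c y) /\ coord c (param c y) = y.
    by near: y; exact: near_img.
  rewrite vcoord_coord // ey; congr row_mx.
  by near: y; exact: (near_param cm eu).
apply: (@smooth_at_eq _ _ _ (fun y => row_mx y (u (param c y)))).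
  by apply: filterS ncm => y /= ->.
apply/smooth_at_rowP => b; have [i ->|a ->] := split_ordP b.
  apply: smooth_at_eq (smooth_at_coord i (coord c m)).
  by near=> y; rewrite row_mxEl.
apply: smooth_at_eq (sfun_at_chart (su a) ac cm).
by near=> y; rewrite row_mxEr.
Unshelve. all: by end_near. Qed.

Lemma sfun_at_vcoord e m a : dom c m -> esection e ->
  sfun_at (fun m => vcoord (e m) 0 a) m.
Proof.
move=> cm /smooth_mapP/(_ m) se; have dm : dom d (pt (e m)) by apply/vtriv_dom_pt.
have H := sfun_at_map se (sfun_at_coord (rshift n a) ad dm).
by apply: sfun_at_eq H; near=> q; rewrite /vcoord mxE.
Unshelve. all: by end_near. Qed.

End LocalTrivialisation.

Lemma qE_smooth : smooth_map (@qE _ _ _ M E).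
Proof.
apply/smooth_mapP => p; have [c [d [cd cp]]] := vtriv_exists (qE p).
exact: qE_msmap_at cd p cp.
Qed.

Lemma esection0 : esection (fun m => 0 : fibre E m).
Proof.
apply/smooth_mapP => m; have [c [d [cd cm]]] := vtriv_exists m.
apply: (section_msmap_at cd (u := fun=> 0) cm).
  by move=> a; apply: sfun_at_eq (sfun_at_cst 0 m); near=> q; rewrite mxE.
near=> q; have cq : dom c q by near: q; exact: near_dom.
by have [phi [_ ->]] := vcoord_phi cd cq; rewrite linear0.
Unshelve. all: by end_near. Qed.

(* The last component of the frame data is the common cut-off: with [f = 1]
   the [s a] are a frame and the [l a] the dual one. *)
Definition frame_data : Type :=
  ('I_k -> forall m, fibre E m -> R) * ('I_k -> forall m, fibre E m) * (M -> R).

(** The square of the cut-off arises because both the coordinate forms and the frame sections are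
    multiplied by it to become global. *)
Definition is_frame (D : frame_data) : Prop :=
  let: (l, s, f) := D in
  [/\ forall a, dual_section (l a), forall a, esection (s a), smooth_fun f &
      forall m (x : fibre E m), \sum_a l a m x *: s a m = f m ^+ 2 *: x].

(** The filler for those indices of the sequence below that carry no local frame. *)
Lemma frame0 : is_frame (fun _ _ _ => 0, fun _ _ => 0, fun=> 0).
Proof.
split=> [a|a||m x]; last by rewrite big1 ?expr0n ?scale0r // => a _; rewrite scale0r.
- split=> [m b x y|e _]; first by rewrite mulr0 addr0.
  exact: smooth_fun_cst.
- exact: esection0.
- exact: smooth_fun_cst.
Qed.

(** By the last clause the fibre coordinates are, where the cut-off is 1, values of global sections
    of [E^*]. Statements in coordinates can thus be traded for statements about dual sections. *)
Lemma vtriv_frame c d m0 : vtriv c d -> dom c m0 -> exists l s f,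
  [/\ is_frame (l, s, f), \forall m \near m0, f m = 1 &
    forall m, f m = 1 -> dom c m /\ forall a (x : fibre E m),
      l a m x = vcoord d x 0 a].
Proof.
move=> cd cm0; have [ac ad _ _] := cd.
have [f [C [sf cC CW f1 f0]]] := bump_manifold (near_dom cm0).
exists (fun a m x => f m * vcoord d x 0 a), (fun a m => f m *: vframe d 'e_a m), f.
have fC m : f m != 0 -> dom c m.
  by move=> fm; apply: CW; apply: contrapT => /f0/eqP; exact/negP.
split=> //; last first.
  move=> m fm; split=> [|a x]; last by rewrite fm mul1r.
  by apply: fC; rewrite fm oner_neq0.
split=> // [a|a|m x].
- split=> [m b x y|e se].
    have [->|/fC cm] := eqVneq (f m) 0; first by rewrite !mul0r mulr0 addr0.
    by rewrite (vcoord_lin cd) // !mxE; ring.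
  apply: (smooth_fun_cutoff sf cC f0) => q /CW cq.
  exact: (sfun_at_vcoord cd).
- apply/smooth_mapP => m; have [Cm|nCm] := pselect (C m).
    apply: (section_msmap_at cd (u := fun m => f m *: 'e_a)); first exact: CW.
      move=> b; have H := sfun_atM ((smooth_funP f).1 sf m) (sfun_at_cst (('e_a : 'rV[R]_k) 0 b) m).
      by apply: sfun_at_eq H; near=> q; rewrite [in RHS]mxE.
    near=> q; have cq : dom c q by near: q; apply: near_dom; exact: CW.
    by rewrite (vcoordZ cd) // (vframeK cd).
  have [c' [d' [cd' cm']]] := vtriv_exists m.
  apply: (section_msmap_at cd' (u := fun=> 0) cm').
    by move=> b; apply: sfun_at_eq (sfun_at_cst 0 m); near=> q; rewrite mxE.
  near=> q; have cq : dom c' q by near: q; exact: near_dom.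
  have nCq : ~ C q.
    near: q; apply: open_nbhs_nbhs; split=> //; exact: closed_openC.
  by rewrite f0 // scale0r; have [phi [_ ->]] := vcoord_phi cd' cq; rewrite linear0.
- have [->|/fC cm] := eqVneq (f m) 0.
    by rewrite expr0n scale0r big1 // => a _; rewrite mul0r scale0r.
  rewrite [in RHS](vframe_sum cd x cm) scaler_sumr; apply: eq_bigr => a _.
  by rewrite !scalerA; congr (_ *: _); ring.
Unshelve. all: by end_near. Qed.

(** Near a point, [ell lam] is the sum of the fibre coordinates times the functions [lam (s a)]
    pulled back from the base. *)
Lemma ell_smooth lam : dual_section lam -> smooth_fun (ell lam : E -> R).
Proof.
move=> dl; apply/smooth_funP => p.
have [c [d [cd cp]]] := vtriv_exists (qE p).
have [ac ad _ _] := cd.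
have [l [s [f [fr f1 lf]]]] := vtriv_frame cd cp; have [_ ss _ ls] := fr.
have H : sfun_at (fun p' : E => \sum_a coord d p' 0 (rshift n a) * lam (qE p') (s a (qE p'))) p.
  apply: sfun_at_sum => a; apply: sfun_atM.
    by apply: sfun_at_coord => //; apply/(vtriv_dom cd).
  move: p {cp f1}; apply/smooth_funP.
  by apply: (smooth_fun_map (f := fun m => lam m (s a m)) qE_smooth); exact: dl.2.
apply: sfun_at_eq H.
have : \forall p' \near p, f (qE p') = 1.
  exact: (msmap_continuous ((smooth_mapP _).1 qE_smooth p) f1).
apply: filterS => p' fp.
have [cp' lE] := lf _ fp.
rewrite -[p' in RHS]pt_tagged ell_pt.
rewrite -[tagged (split_tot p')]scale1r.
have := ls _ (tagged (split_tot p')); rewrite -/(qE p') fp expr1n => <-.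
rewrite (dual_sum _ _ dl); apply: eq_bigr => a _.
by rewrite (dualZ _ _ dl) lE /vcoord pt_tagged mxE.
Qed.

(** The coordinates of [E] over a trivialising chart are base coordinates and, locally, functions
    [ell lam], so testing against both suffices. Later smoothness proofs into [E] avoid
    trivialisations in this way. *)
Lemma msmooth_tot (V : normedModType R) (g : V -> E) x :
  msmooth_at (fun y => qE (g y)) x ->
  (forall lam, dual_section lam -> smooth_at (fun y => ell lam (g y)) x) ->
  msmooth_at g x.
Proof.
move=> sq sl; have [c [d [cd cx]]] := vtriv_exists (qE (g x)).
have [ac ad _ _] := cd.
have [l [s [f [fr f1 lf]]]] := vtriv_frame cd cx; have [dl _ _ _] := fr.
have [nc sc] := msmooth_at_chart sq ac cx.
exists d; split=> //; first by apply: filterS nc => y /(vtriv_dom cd).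
apply/smooth_at_rowP => b; have [i ->|a ->] := split_ordP b.
  have sci := (smooth_at_rowP _ _).1 sc i.
  apply: smooth_at_eq sci; apply: filterS nc => y cy /=.
  by rewrite (coord_vtriv cd cy) row_mxEl.
apply: smooth_at_eq (sl _ (dl a)).
have : \forall y \near x, f (qE (g y)) = 1.
  exact: (msmooth_continuous sq f1).
apply: filterS => y fy; have [cy lE] := lf _ fy.
by rewrite -[g y in LHS]pt_tagged ell_pt lE /vcoord pt_tagged mxE.
Qed.

Lemma esectionP e :
  esection e <-> forall lam, dual_section lam -> smooth_fun (fun m => lam m (e m)).
Proof.
split=> [se lam [_]|H]; first exact.
apply/smooth_mapP => m; have [c ac cm] := atlas_cover m.
exists c; split=> //; apply: msmooth_tot.
  apply: msmooth_at_eq (msmooth_param ac cm).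
  by near=> y; rewrite /= qE_pt.
move=> lam dl; have H' := sfun_at_chart ((smooth_funP _).1 (H _ dl) m) ac cm.
by apply: smooth_at_eq H'; near=> y; rewrite /= ell_pt.
Unshelve. all: by end_near. Qed.

Lemma smooth_curve_tot (g : R -> E) : smooth_curve (fun t => qE (g t)) ->
  (forall lam, dual_section lam -> forall t, smooth_at (fun y => ell lam (g y)) t) ->
  smooth_curve g.
Proof.
move=> /smooth_curveP sq sl; apply/smooth_curveP => t.
by apply: msmooth_tot => // lam dl; exact: sl.
Qed.

Lemma smooth_map_tot N (X : manifold R N) (g : X -> E) :
  smooth_map (fun t => qE (g t)) ->
  (forall lam, dual_section lam -> smooth_fun (fun y => ell lam (g y))) ->
  smooth_map g.
Proof.
move=> /smooth_mapP sq sl; apply/smooth_mapP => p.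
have [c ac cp] := atlas_cover p; exists c; split=> //.
apply: msmooth_tot; first exact: (msmap_at_chart (sq p) ac cp).
move=> lam dl.
exact: (sfun_at_chart ((smooth_funP _).1 (sl _ dl) p) ac cp).
Qed.

Lemma esectionD e e' : esection e -> esection e' -> esection (fun m => e m + e' m).
Proof.
move=> se se'; apply/esectionP => lam dl.
have H := smooth_funD (dl.2 _ se) (dl.2 _ se').
by rewrite (_ : (fun m => _) = fun m => lam m (e m) + lam m (e' m)) //;
  apply/funext => m; rewrite (dualD _ _ dl).
Qed.

Lemma esectionM (f : M -> R) e : smooth_fun f -> esection e ->
  esection (fun m => f m *: e m).
Proof.
move=> sf se; apply/esectionP => lam dl.
have H := smooth_funM sf (dl.2 _ se).
by rewrite (_ : (fun m => _) = fun m => f m * lam m (e m)) //;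
  apply/funext => m; rewrite (dualZ _ _ dl).
Qed.

Lemma esection_sum I (r : seq I) (e : I -> forall m, fibre E m) :
  (forall i, esection (e i)) -> esection (fun m => \sum_(i <- r) e i m).
Proof.
move=> se; apply/esectionP => lam dl.
have H := smooth_fun_sum r (fun i => dl.2 _ (se i)).
by rewrite (_ : (fun m => _) = fun m => \sum_(i <- r) lam m (e i m)) //;
  apply/funext => m; rewrite (dual_sum _ _ dl).
Qed.

Lemma dual_sectionM (f : M -> R) lam : smooth_fun f -> dual_section lam ->
  dual_section (fun m x => f m * lam m x).
Proof.
move=> sf dl; split=> [m a x y|e se]; first by rewrite dl.1; ring.
by apply: smooth_funM => //; exact: dl.2.
Qed.

Lemma frame_near m0 : exists D : frame_data,
  is_frame D /\ \forall m \near m0, D.2 m = 1.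
Proof.
have [c [d [cd cp]]] := vtriv_exists m0.
by have [l [s [f [fr f1 lf]]]] := vtriv_frame cd cp; exists (l, s, f).
Qed.

(** Second countability enters here: the basic open sets are numbered, and each one on which some
    frame has cut-off 1 contributes such a frame at its number. *)
Lemma frame_sequence : exists D : nat -> frame_data,
  (forall i, is_frame (D i)) /\
  forall m0, exists i, \forall m \near m0, (D i).2 m = 1.
Proof.
have [B /countable_injP[code codeI] [oB BP]] := @mfd_countable _ _ M.
have /choice[D HD] : forall i : nat, exists D : frame_data, is_frame D /\
    forall U, B U -> code U = i ->
      (exists D', is_frame D' /\ U `<=` [set m | D'.2 m = 1]) ->
      U `<=` [set m | D.2 m = 1].
  move=> i; have [[U [BU [Ui [D' [fD' UD']]]]]|H] := pselect (exists U, B U /\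
      code U = i /\ exists D', is_frame D' /\ U `<=` [set m | D'.2 m = 1]).
    exists D'; split=> // U' BU' U'i _.
    by rewrite (_ : U' = U) //; apply: codeI; rewrite ?inE // U'i.
  exists (fun _ _ _ => 0, fun _ _ => 0, fun=> 0); split; first exact: frame0.
  by move=> U BU Ui D'; exfalso; apply: H; exists U.
exists D; split=> [i|m0]; first by have [] := HD i.
have [D' [fD' nD']] := frame_near m0.
have [U [BU Um] UD'] := BP m0 _ nD'.
exists (code U); have [_ H] := HD (code U).
apply: (filterS (P := U)).
  by apply: H => //; exists D'.
by apply: open_nbhs_nbhs; split=> //; exact: oB.
Qed.

(** The total weight of the partition below; it is 1 as soon as one of the [g j] is 1. *)
Lemma prod_telescope (g : nat -> R) N :
  \sum_(0 <= i < N) (\prod_(0 <= j < i) (1 - g j)) * g i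
  = 1 - \prod_(0 <= j < N) (1 - g j).
Proof.
elim: N => [|N IH]; first by rewrite !big_geq // subrr.
by rewrite big_nat_recr //= IH big_nat_recr //=; ring.
Qed.

(* [r m] lists the indices that may contribute near [m]; the [s i] span but need
   not be linearly independent. *)
Definition locally_finite_frame (I : eqType) (l : I -> forall m, fibre E m -> R)
    (s : I -> forall m, fibre E m) (r : M -> seq I) : Prop :=
  [/\ forall i, dual_section (l i), forall i, esection (s i),
      forall m, uniq (r m),
      forall m0, \forall m \near m0, forall i, i \notin r m0 ->
        forall x : fibre E m, l i m x = 0 &
      forall m (x : fibre E m), \sum_(i <- r m) l i m x *: s i m = x].

(* Replacing [f_i ^ 2] by [f_i ^ 2 * \prod_(j < i) (1 - f_j ^ 2)] gives a
   partition of unity that is locally finite because each point has a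
   neighbourhood on which some [f_i] is 1. *)
Lemma global_frame : exists (I : eqType) (l : I -> forall m, fibre E m -> R)
    (s : I -> forall m, fibre E m) (r : M -> seq I), locally_finite_frame l s r.
Proof.
have [D [fD /choice[N ND]]] := frame_sequence.
pose f i := (D i).2; pose l i := (D i).1.1; pose s i := (D i).1.2.
have HD i : [/\ forall a, dual_section (l i a), forall a, esection (s i a),
    smooth_fun (f i) &
    forall m (x : fibre E m), \sum_a l i a m x *: s i a m = f i m ^+ 2 *: x].
  by rewrite /l /s /f; have := fD i; case: (D i) => [[? ?] ?].
pose P i m := \prod_(0 <= j < i) (1 - f j m ^+ 2).
have sP i : smooth_fun (P i).
  apply: smooth_fun_prod => j; apply: smooth_funB; first exact: smooth_fun_cst.
  by have [_ _ sf _] := HD j; exact: smooth_funM.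
have P0 i j m : f j m = 1 -> (j < i)%N -> P i m = 0.
  move=> fj ji; rewrite /P (big_cat_nat (n := j)) //=; last exact: ltnW.
  by rewrite (big_ltn ji) /= fj expr1n subrr mul0r mulr0.
exists (nat * 'I_k)%type, (fun ia m x => P ia.1 m * l ia.1 ia.2 m x),
  (fun ia => s ia.1 ia.2), (fun m => [seq (i, a) | i <- iota 0 (N m).+1, a <- enum 'I_k]).
split.
- by move=> [i a] /=; apply: dual_sectionM => //; have [] := HD i.
- by move=> [i a] /=; have [] := HD i.
- move=> m; apply: allpairs_uniq; [exact: iota_uniq|exact: enum_uniq|].
  by move=> [? ?] [? ?] _ _ [-> ->].
- move=> m0; apply: filterS (ND m0) => m fm [i a] ni x.
  rewrite /= (P0 _ (N m0)) ?mul0r // ltnNge; apply: contra ni => iN.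
  by apply: allpairs_f; rewrite ?mem_iota ?mem_enum.
- move=> m x; rewrite big_allpairs_dep /=.
  transitivity (\sum_(i <- iota 0 (N m).+1) (P i m * f i m ^+ 2) *: x).
    apply: eq_bigr => i _; rewrite big_enum /=.
    have [_ _ _ H] := HD i; rewrite -scalerA -H scaler_sumr.
    by apply: eq_bigr => a _; rewrite scalerA.
  rewrite -scaler_suml -[iota _ _]/(index_iota 0 (N m).+1).
  rewrite (prod_telescope (fun i => f i m ^+ 2)) -/(P _ m).
  by rewrite (P0 _ (N m)) ?subr0 ?scale1r //; exact: nbhs_singleton (ND m).
Qed.

End Trivialisation.

(** * Tangent vectors of the total space *)

Section TotalSpace.
Context {R : realType} {n k : nat} {M : manifold R n} {E : vbundle M k}.

Lemma pt_ind (P : E -> Prop) : (forall m (x : fibre E m), P (pt x)) -> forall p, P p.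
Proof. by move=> H p; rewrite -[p]pt_tagged; exact: H. Qed.

(** The coordinates are replaced by functions on all of [E], either pulled back from [M] or linear
    on fibres. Hence these two kinds determine tangent vectors of [E] and detect smoothness of
    vector fields. *)
Lemma tot_frame (p0 : E) : exists (d : chart R (n + k) E) (h : 'I_(n + k) -> E -> R),
  [/\ @atlas _ _ E d,
      forall b, (exists2 f : M -> R, smooth_fun f & h b = fun p => f (qE p)) \/
        (exists2 lam : forall m, fibre E m -> R, dual_section lam & h b = ell lam) &
      \forall p \near p0, dom d p /\ forall v f, tangent p v -> smooth_fun f ->
        v f = \sum_b v (h b) * pderiv d b p f].
Proof.
have [c [d [cd cp]]] := @vtriv_exists _ _ _ _ E (qE p0); have [ac ad _ _] := cd.
have [l [s [f [fr f1 lf]]]] := vtriv_frame cd cp; have [dl _ _ _] := fr.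
have [g [C [sg cC CW g0 g1]]] := cutoff_near_one ac cp.
pose h b : E -> R := match fintype.split b with
  | inl i => fun p => g (qE p) * coord c (qE p) 0 i | inr a => ell (l a) end.
have sgc i : smooth_fun (fun q => g q * coord c q 0 i).
  by apply: (smooth_fun_cutoff sg cC g0) => q /CW cq; exact: sfun_at_coord.
have hE b : (exists2 f : M -> R, smooth_fun f & h b = fun p => f (qE p)) \/
    (exists2 lam : forall m, fibre E m -> R, dual_section lam & h b = ell lam).
  rewrite /h; case: (fintype.split b) => [i|a]; last by right; exists (l a).
  by left; exists (fun q => g q * coord c q 0 i).
have sh b : smooth_fun (h b).
  have [[f' sf ->]|[lam dlam ->]] := hE b; last exact: ell_smooth.
  exact: (smooth_fun_map qE_smooth sf).
exists d, h; split=> //.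
have cq p : {for p, continuous (@qE _ _ _ M E)}.
  exact: (msmap_continuous ((smooth_mapP _).1 qE_smooth p)).
have nf : \forall p \near p0, \forall p' \near p, f (qE p') = 1 /\ g (qE p') = 1.
  apply: near_join; near=> p; split; near: p; first exact: (cq p0 _ f1).
  exact: (cq p0 _ (nbhs_singleton g1)).
near=> p.
have nfp : \forall p' \near p, f (qE p') = 1 /\ g (qE p') = 1 by near: p.
have dp : dom d p by apply/(vtriv_dom cd); have [/lf[]] := nbhs_singleton nfp.
split=> // v F tv sF; rewrite (tangent_chart ad dp tv sh _ sF).
  by apply: eq_bigr => b _; rewrite pderivE.
move=> b; apply: filterS nfp => p' [fp gp]; have [cp' lE] := lf _ fp.
rewrite (coord_vtriv cd cp') /h.
have [i ->|a ->] := split_ordP b.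
  by rewrite gp mul1r row_mxEl.
by rewrite row_mxEr -[p' in LHS]pt_tagged ell_pt lE /vcoord pt_tagged.
Unshelve. all: by end_near. Qed.

Lemma tangent_tot_ext (p : E) v w : tangent p v -> tangent p w ->
  (forall f : M -> R, smooth_fun f -> v (fun p => f (qE p)) = w (fun p => f (qE p))) ->
  (forall lam, dual_section lam -> v (ell lam : E -> R) = w (ell lam)) -> v = w.
Proof.
move=> tv tw hf hl; apply: (tangent_ext tv tw) => F sF.
have [d [h [ad hE /nbhs_singleton[dp H]]]] := tot_frame p.
rewrite (H _ _ tv sF) (H _ _ tw sF); apply: eq_bigr => b _; congr (_ * _).
by have [[f sf ->]|[lam dl ->]] := hE b; [exact: hf|exact: hl].
Qed.

Lemma vfield_tot (V : E -> tvec E) : (forall p, tangent p (V p)) ->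
  (forall f : M -> R, smooth_fun f -> smooth_fun (fun p => V p (fun p => f (qE p)))) ->
  (forall lam, dual_section lam -> smooth_fun (fun p => V p (ell lam))) ->
  vfield V.
Proof.
move=> tV hf hl; split=> // F sF; apply/smooth_funP => p0.
have [d [h [ad hE H]]] := tot_frame p0.
have S : sfun_at (fun p => \sum_b V p (h b) * pderiv d b p F) p0.
  apply: sfun_at_sum => b; apply: sfun_atM; last first.
    by apply: sfun_at_pderiv => //; have [] := nbhs_singleton H.
  by have [[f sf ->]|[lam dl ->]] := hE b; move: p0 {H}; apply/smooth_funP; [exact: hf|exact: hl].
by apply: sfun_at_eq S; apply: filterS H => p [_ H]; rewrite -H.
Qed.

Lemma smooth_curve_cst N (X : manifold R N) (p : X) : smooth_curve (fun=> p).
Proof.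
apply/smooth_curveP => t; have [c ac cp] := atlas_cover p.
exists c; split=> //; first by near=> y.
exact: (@smooth_at_cst R R _ (coord c p) t).
Unshelve. all: by end_near. Qed.

Lemma smooth_curve_vertical m (x y : fibre E m) :
  smooth_curve (fun t : R => pt (x + t *: y)).
Proof.
apply: smooth_curve_tot => [|lam dl t].
  rewrite (_ : (fun t => _) = fun=> m); first exact: smooth_curve_cst.
  by apply/funext => t; rewrite qE_pt.
apply: (@smooth_at_eq _ _ _ (fun t : R => lam m x + t * lam m y)).
  by near=> u; rewrite ell_pt (dualD _ _ dl) (dualZ _ _ dl).
apply: smooth_atD; first exact: smooth_at_cst.
by apply: smooth_atM; [exact: smooth_at_id|exact: smooth_at_cst].
Unshelve. all: by end_near. Qed.

Lemma tangent_vertical m (x y : fibre E m) : tangent (pt x) (vertical x y).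
Proof.
apply: velocity_at; first exact: smooth_curve_vertical.
by rewrite scale0r addr0.
Qed.

Lemma vertical_base m (x y : fibre E m) (f : M -> R) : smooth_fun f ->
  vertical x y (fun p => f (qE p)) = 0.
Proof.
move=> sf; rewrite /vertical velocityE; last exact: (smooth_fun_map qE_smooth sf).
rewrite (_ : _ \o _ = cst (f m)) ?derive1_cst //.
by apply/funext => t; rewrite /= qE_pt.
Qed.

Lemma vertical_ell m (x y : fibre E m) lam : dual_section lam ->
  vertical x y (ell lam) = lam m y.
Proof.
move=> dl; rewrite /vertical velocityE; last exact: ell_smooth.
have -> : ell lam \o (fun t : R => pt (x + t *: y)) = (fun t : R => lam m x + t * lam m y).
  by apply/funext => t /=; rewrite ell_pt (dualD _ _ dl) (dualZ _ _ dl).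
rewrite derive1E.
have H : is_derive (0 : R) 1 (fun t : R => lam m x + t * lam m y) (lam m y).
  by apply: is_derive_eq; rewrite /GRing.scale /=; ring.
by case: H.
Qed.

Lemma push_qE (v : tvec E) (f : M -> R) : smooth_fun f ->
  push (@qE _ _ _ M E) v f = v (fun p => f (qE p)).
Proof. by move=> sf; rewrite pushE. Qed.

Lemma push_qE_vertical m (x y : fibre E m) : push (@qE _ _ _ M E) (vertical x y) = 0.
Proof.
apply/funext => f; rewrite -[RHS]/(0 : R).
have [sf|nf] := pselect (smooth_fun f); first by rewrite push_qE // vertical_base.
by rewrite /push; case: asboolP.
Qed.

Lemma tangent_qE (p : E) m v : qE p = m -> tangent p v ->
  tangent m (push (@qE _ _ _ M E) v).
Proof. by move=> <-; exact: (tangent_push qE_smooth). Qed.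

Lemma tangent_section e m v : esection e -> tangent m v ->
  tangent (pt (e m)) (push (fun m => pt (e m) : E) v).
Proof. exact: (@tangent_push _ _ _ M E (fun m => pt (e m))). Qed.

Lemma push_section_base e m v : esection e -> tangent m v ->
  push (@qE _ _ _ M E) (push (fun m => pt (e m) : E) v) = v.
Proof.
move=> se tv; apply: (@tangent_ext _ _ M m).
- by apply: (tangent_qE (p := pt (e m))); [rewrite qE_pt|exact: tangent_section].
- exact: tv.
move=> f sf; rewrite push_qE // pushE; last exact: (smooth_fun_map qE_smooth sf).
by congr v; apply/funext => q /=; rewrite qE_pt.
Qed.

Lemma push_section_ell e v lam : dual_section lam ->
  push (fun m => pt (e m) : E) v (ell lam) = v (fun m => lam m (e m)).
Proof.
move=> dl; rewrite pushE; last exact: ell_smooth.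
by congr v; apply/funext => q /=; rewrite ell_pt.
Qed.

End TotalSpace.

(** * Generalised tangent vectors *)

Section GeneralisedVectors.
Context {R : realType} {n : nat} {M : manifold R n}.
Implicit Types (p : M) (xi eta : gvec M) (v w : tvec M).

Lemma covec_lincombE (a : R) (th om : covec M) v :
  (a *: th + om) v = a * th v + om v.
Proof. by []. Qed.

Lemma cotangent0 p : cotangent p 0.
Proof.
by split=> [a v w _ _|v _] //; rewrite -[LHS]/(0 : R) -[RHS]/(a * 0 + 0) mulr0 addr0.
Qed.

Lemma cotangent_lincomb p (a : R) (th om : covec M) :
  cotangent p th -> cotangent p om -> cotangent p (a *: th + om).
Proof.
move=> [lt nt] [lo no]; split=> [b v w tv tw|v nv]; rewrite !covec_lincombE.
  by rewrite lt // lo //; ring.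
by rewrite nt // no // mulr0 addr0.
Qed.

Lemma cotangent_lin p th (a : R) v w : cotangent p th -> tangent p v ->
  tangent p w -> th (a *: v + w) = a * th v + th w.
Proof. by case=> h _; exact: h. Qed.

Lemma cotangent_at0 p th : cotangent p th -> th 0 = 0.
Proof.
move=> ct; have := cotangent_lin 1 ct (tangent0 p) (tangent0 p).
rewrite scaler0 addr0 mul1r => H.
by apply: (addrI (th 0)); rewrite addr0 -H.
Qed.

Lemma cotangentD_at p th v w : cotangent p th -> tangent p v -> tangent p w ->
  th (v + w) = th v + th w.
Proof.
by move=> ct tv tw; have := cotangent_lin 1 ct tv tw; rewrite scale1r mul1r.
Qed.

Lemma cotangentZ_at p th (a : R) v : cotangent p th -> tangent p v ->
  th (a *: v) = a * th v.
Proof.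
move=> ct tv; have := cotangent_lin a ct tv (tangent0 p).
by rewrite (cotangent_at0 ct) !addr0.
Qed.

Lemma cotangent_ext p (th om : covec M) : cotangent p th -> cotangent p om ->
  (forall v, tangent p v -> th v = om v) -> th = om.
Proof.
move=> [_ nt] [_ no] H; apply/funext => v.
by have [/H//|nv] := pselect (tangent p v); rewrite nt // no.
Qed.

Lemma gpairC xi eta : gpair xi eta = gpair eta xi.
Proof. by rewrite /gpair addrC. Qed.

Lemma gpair_lin p (a : R) xi eta zeta : gtangent p xi -> gtangent p eta ->
  gtangent p zeta -> gpair (a *: xi + eta) zeta = a * gpair xi zeta + gpair eta zeta.
Proof.
move=> [t1 c1] [t2 c2] [t3 c3]; rewrite /gpair.
rewrite -[(a *: xi + eta).2 _]/(a * xi.2 zeta.1 + eta.2 zeta.1).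
by rewrite -[(a *: xi + eta).1]/(a *: xi.1 + eta.1) (cotangent_lin _ c3) //; ring.
Qed.

Lemma gpairD p xi eta zeta : gtangent p xi -> gtangent p eta ->
  gtangent p zeta -> gpair (xi + eta) zeta = gpair xi zeta + gpair eta zeta.
Proof.
by move=> t1 t2 t3; have := gpair_lin 1 t1 t2 t3; rewrite scale1r mul1r.
Qed.

End GeneralisedVectors.

(** * Lie derivatives of 1-forms *)

Section LieDerivative.
Context {R : realType} {n : nat} {M : manifold R n}.
Implicit Types (X Y Z : M -> tvec M) (th : M -> covec M) (f g : M -> R).

Lemma vfield_smooth X f : vfield X -> smooth_fun f -> smooth_fun (fun p => X p f).
Proof. by move=> [_]; exact. Qed.

Lemma vfieldD X Y : vfield X -> vfield Y -> vfield (fun p => X p + Y p).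
Proof.
move=> [tX sX] [tY sY]; split=> [p|f sf]; first exact: tangent_add.
exact: (smooth_funD (sX _ sf) (sY _ sf)).
Qed.

Lemma vfieldM f X : smooth_fun f -> vfield X -> vfield (fun p => f p *: X p).
Proof.
move=> sf [tX sX]; split=> [p|g sg]; first exact: tangent_scale.
exact: (smooth_funM sf (sX _ sg)).
Qed.

Lemma vfieldZ (a : R) X : vfield X -> vfield (fun p => a *: X p).
Proof. by apply: (@vfieldM (fun=> a)); exact: smooth_fun_cst. Qed.

Lemma vfield0 : vfield (fun _ : M => 0).
Proof. by split=> [p|f _]; [exact: tangent0|exact: smooth_fun_cst]. Qed.

Lemma vfield_sum I (r : seq I) (F : I -> M -> tvec M) :
  (forall i, vfield (F i)) -> vfield (fun p => \sum_(i <- r) F i p).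
Proof.
move=> vF; elim: r => [|i r IH].
  rewrite (_ : (fun p => _) = fun=> 0); first exact: vfield0.
  by apply/funext => p; rewrite big_nil.
rewrite (_ : (fun p => _) = fun p => F i p + \sum_(i <- r) F i p).
  exact: vfieldD.
by apply/funext => p; rewrite big_cons.
Qed.

Lemma vfield_lie X Y : vfield X -> vfield Y -> vfield (lie X Y).
Proof.
move=> vX vY; have [tX sX] := vX; have [tY sY] := vY.
split=> [p|f sf]; last exact: (smooth_funB (sX _ (sY _ sf)) (sY _ (sX _ sf))).
have lin U (a : R) f g : vfield U -> smooth_fun f -> smooth_fun g ->
    (fun x => U x (fun x => a * f x + g x)) = fun x => a * U x f + U x g.
  by move=> [tU _] sf sg; apply/funext => x; rewrite (tangent_lin _ (tU x)).
have prod U f g : vfield U -> smooth_fun f -> smooth_fun g ->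
    (fun x => U x (fun x => f x * g x)) = fun x => f x * U x g + g x * U x f.
  by move=> [tU _] sf sg; apply/funext => x; rewrite (tangent_prod (tU x)).
split=> [a f g sf sg|f g sf sg|f nf]; rewrite /lie.
- rewrite !lin //; rewrite (tangent_lin _ (tX p)) ?(tangent_lin _ (tY p));
    [ring|exact: sX|exact: sX|exact: sY|exact: sY].
- have sXf := sX _ sf; have sXg := sX _ sg; have sYf := sY _ sf; have sYg := sY _ sg.
  rewrite !prod // (tangentD (tX p)); [|exact: smooth_funM..].
  rewrite (tangentD (tY p)); [|exact: smooth_funM..].
  by rewrite !(tangent_prod (tX p)) // !(tangent_prod (tY p)) //; ring.
- have z U : vfield U -> (fun x => U x f) = fun=> 0.
    by move=> [tU _]; apply/funext => x; exact: (tangent_nonsmooth (tU x)).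
  by rewrite !z // (tangent_cst _ (tX p)) (tangent_cst _ (tY p)) subrr.
Qed.

Lemma lie_anti X Y p : lie X Y p = - lie Y X p.
Proof. by apply/funext => f; rewrite -[RHS]/(- (lie Y X p f)) /lie opprB. Qed.

Lemma lieMr X f Y p : vfield X -> smooth_fun f -> vfield Y ->
  lie X (fun q => f q *: Y q) p = f p *: lie X Y p + X p f *: Y p.
Proof.
move=> vX sf vY; have [tX sX] := vX; have [tY sY] := vY.
apply: (@tangent_ext _ _ _ p).
- by apply: (vfield_lie vX (vfieldM sf vY)).1.
- by apply: tangent_lincomb; [exact: (vfield_lie vX vY).1|exact: tangent_scale].
move=> g sg; rewrite -[RHS]/(f p * lie X Y p g + X p f * Y p g) /lie.
have -> : X p (fun x => (f x *: Y x) g) = X p (fun x => f x * Y x g) by [].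
rewrite (tangent_prod (tX p) sf (sY _ sg)).
by rewrite -[(f p *: Y p) _]/(f p * Y p _); ring.
Qed.

Lemma lieDr X Y Z p : vfield X -> vfield Y -> vfield Z ->
  lie X (fun q => Y q + Z q) p = lie X Y p + lie X Z p.
Proof.
move=> vX vY vZ; have [tX sX] := vX; have [tY sY] := vY; have [tZ sZ] := vZ.
apply: (@tangent_ext _ _ _ p).
- by apply: (vfield_lie vX (vfieldD vY vZ)).1.
- by apply: tangent_add; [exact: (vfield_lie vX vY).1|exact: (vfield_lie vX vZ).1].
move=> g sg; rewrite -[RHS]/(lie X Y p g + lie X Z p g) /lie.
have -> : X p (fun x => (Y x + Z x) g) = X p (fun x => Y x g + Z x g) by [].
rewrite (tangentD (tX p) (sY _ sg) (sZ _ sg)).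
by rewrite -[(Y p + Z p) _]/(Y p _ + Z p _); ring.
Qed.

Lemma lieDl X Y Z p : vfield X -> vfield Y -> vfield Z ->
  lie (fun q => X q + Y q) Z p = lie X Z p + lie Y Z p.
Proof.
move=> vX vY vZ; rewrite lie_anti lieDr // opprD -!lie_anti //.
Qed.

Lemma lieMl X f Y p : vfield X -> smooth_fun f -> vfield Y ->
  lie (fun q => f q *: X q) Y p = f p *: lie X Y p - Y p f *: X p.
Proof.
by move=> vX sf vY; rewrite lie_anti lieMr // opprD -scalerN -lie_anti.
Qed.

Lemma lie_near X Y Z p : vfield X -> vfield Y -> vfield Z ->
  (\forall q \near p, Y q = Z q) -> lie X Y p = lie X Z p.
Proof.
move=> vX vY vZ YZ; have [tX sX] := vX; have [tY sY] := vY; have [tZ sZ] := vZ.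
apply: (@tangent_ext _ _ _ p).
- exact: (vfield_lie vX vY).1.
- exact: (vfield_lie vX vZ).1.
move=> f sf; rewrite /lie (nbhs_singleton YZ); congr (_ - _).
apply: (tangent_germ (tX p) (sY _ sf) (sZ _ sf)).
by apply: filterS YZ => q ->.
Qed.

(** The Lie derivative as an operator on vector fields, before it is known to be tensorial in [Z];
    [lie_form] evaluates the same expression on a chosen extension of a tangent vector. *)
Definition lie_eval X th Z p : R :=
  X p (fun x => th x (Z x)) - th p (lie X Z p).

Lemma lie_evalM X th f Z p : vfield X -> form1 th -> smooth_fun f -> vfield Z ->
  lie_eval X th (fun q => f q *: Z q) p = f p * lie_eval X th Z p.
Proof.
move=> vX [cth sth] sf vZ; have [tX sX] := vX; have [tZ sZ] := vZ.
rewrite /lie_eval lieMr //.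
have -> : (fun x => th x (f x *: Z x)) = fun x => f x * th x (Z x).
  by apply/funext => x; rewrite (cotangentZ_at _ (cth x)).
rewrite (tangent_prod (tX p) sf (sth _ vZ)).
rewrite (cotangent_lin _ (cth p)); [|exact: (vfield_lie vX vZ).1|exact: tangent_scale].
by rewrite (cotangentZ_at _ (cth p)) //; ring.
Qed.

Lemma lie_evalD X th Y Z p : vfield X -> form1 th -> vfield Y -> vfield Z ->
  lie_eval X th (fun q => Y q + Z q) p = lie_eval X th Y p + lie_eval X th Z p.
Proof.
move=> vX [cth sth] vY vZ; have [tX sX] := vX; have [tZ sZ] := vZ; have [tY sY] := vY.
rewrite /lie_eval lieDr //.
have -> : (fun x => th x (Y x + Z x)) = fun x => th x (Y x) + th x (Z x).
  by apply/funext => x; rewrite (cotangentD_at (cth x)).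
rewrite (tangentD (tX p) (sth _ vY) (sth _ vZ)).
rewrite (cotangentD_at (cth p)); [ring|exact: (vfield_lie vX vY).1|exact: (vfield_lie vX vZ).1].
Qed.

Lemma lie_eval0 X th p : vfield X -> form1 th -> lie_eval X th (fun=> 0) p = 0.
Proof.
move=> vX fth; have := lie_evalM p vX fth (@smooth_fun_cst R n M 0) vfield0.
rewrite mul0r => <-; congr lie_eval; by apply/funext => q; rewrite scaler0.
Qed.

Lemma lie_eval_sum X th I (r : seq I) (F : I -> M -> tvec M) p : vfield X ->
  form1 th -> (forall i, vfield (F i)) ->
  lie_eval X th (fun q => \sum_(i <- r) F i q) p = \sum_(i <- r) lie_eval X th (F i) p.
Proof.
move=> vX fth vF; elim: r => [|i r IH].
  rewrite big_nil -[RHS](lie_eval0 p vX fth); congr lie_eval.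
  by apply/funext => q; rewrite big_nil.
rewrite big_cons -IH -lie_evalD //; last exact: vfield_sum.
by congr lie_eval; apply/funext => q; rewrite big_cons.
Qed.

(** Near [p], [Z] is a combination of frame fields whose coefficients vanish at [p], and the
    operator is local and linear over functions. *)
Lemma lie_eval_tensor0 X th Z p : vfield X -> form1 th -> vfield Z -> Z p = 0 ->
  lie_eval X th Z p = 0.
Proof.
move=> vX fth vZ Zp; have [h [F [sh vF H]]] := local_frame p.
have sZh a : smooth_fun (fun q => Z q (h a)) by exact: vfield_smooth.
have vZF a : vfield (fun q => Z q (h a) *: F a q) by exact: vfieldM.
have vZ' : vfield (fun q => \sum_a Z q (h a) *: F a q) by exact: vfield_sum.
have E : \forall q \near p, Z q = \sum_a Z q (h a) *: F a q.
  by apply: filterS H => q; apply; exact: vZ.1.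
have -> : lie_eval X th Z p = lie_eval X th (fun q => \sum_a Z q (h a) *: F a q) p.
  rewrite /lie_eval (lie_near vX vZ vZ' E); congr (_ - _).
  apply: (tangent_germ (vX.1 p) (fth.2 _ vZ) (fth.2 _ vZ')).
  by apply: filterS E => q <-.
rewrite lie_eval_sum // big1 // => a _.
by rewrite (@lie_evalM _ _ (fun q => Z q (h a))) // Zp mul0r.
Qed.

Lemma lie_eval_tensor X th Y Z p : vfield X -> form1 th -> vfield Y -> vfield Z ->
  Y p = Z p -> lie_eval X th Y p = lie_eval X th Z p.
Proof.
move=> vX fth vY vZ YZ; apply/eqP; rewrite -subr_eq0 -mulN1r; apply/eqP.
have sm1 := @smooth_fun_cst R n M (-1).
rewrite -(lie_evalM p vX fth sm1 vZ) -lie_evalD //; last exact: vfieldM.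
apply: lie_eval_tensor0 => //; first by apply: vfieldD => //; exact: vfieldM.
by rewrite YZ scaleN1r subrr.
Qed.

Lemma vfield_extend p v : tangent p v -> exists2 Z : M -> tvec M, vfield Z & Z p = v.
Proof.
move=> tv; have [h [F [sh vF H]]] := local_frame p.
exists (fun q => \sum_a v (h a) *: F a q); last first.
  by rewrite [RHS](nbhs_singleton H _ tv).
by apply: vfield_sum => a; exact: vfieldZ.
Qed.

(** Tensoriality makes the choice in [vfield_through] irrelevant. *)
Lemma lie_form_eval X th Z p : vfield X -> form1 th -> vfield Z ->
  lie_form X th p (Z p) = lie_eval X th Z p.
Proof.
move=> vX fth vZ; rewrite /lie_form /form_of; case: asboolP => [_|[]]; last exact: vZ.1.
have [] : [set Y : M -> (M -> R) -> R | vfield Y /\ Y p = Z p] (vfield_through p (Z p)).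
  by apply: (@xgetPex _ _ [set Y : M -> (M -> R) -> R | vfield Y /\ Y p = Z p]); exists Z.
by move=> vT Tp; exact: lie_eval_tensor.
Qed.

Lemma cotangent_lie_form X th p : vfield X -> form1 th -> cotangent p (lie_form X th p).
Proof.
move=> vX fth; split=> [a v w /vfield_extend[Y vY <-] /vfield_extend[Z vZ <-]|v nv].
  have vYZ := vfieldD (vfieldZ a vY) vZ.
  rewrite (lie_form_eval p vX fth vYZ) !lie_form_eval // lie_evalD //; last exact: vfieldZ.
  by rewrite (@lie_evalM _ _ (fun=> a)) //; exact: smooth_fun_cst.
by rewrite /lie_form /form_of; case: asboolP.
Qed.

Lemma form1_lie_form X th : vfield X -> form1 th -> form1 (lie_form X th).
Proof.
move=> vX fth; split=> [p|Z vZ]; first exact: cotangent_lie_form.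
rewrite (_ : (fun p => _) = fun p => lie_eval X th Z p).
  have vl := vfield_lie vX vZ.
  exact: (smooth_funB (vfield_smooth vX (fth.2 _ vZ)) (fth.2 _ vl)).
by apply/funext => p; rewrite lie_form_eval.
Qed.

Lemma form1D th th' : form1 th -> form1 th' -> form1 (fun p => th p + th' p).
Proof.
move=> [c s] [c' s']; split=> [p|X vX].
  by have := cotangent_lincomb 1 (c p) (c' p); rewrite scale1r.
exact: (smooth_funD (s _ vX) (s' _ vX)).
Qed.

Lemma form1M f th : smooth_fun f -> form1 th -> form1 (fun p => f p *: th p).
Proof.
move=> sf [c s]; split=> [p|X vX].
  by have := cotangent_lincomb (f p) (c p) (cotangent0 p); rewrite addr0.
exact: (smooth_funM sf (s _ vX)).
Qed.

Lemma form1Z (a : R) th : form1 th -> form1 (fun p => a *: th p).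
Proof. by apply: (@form1M (fun=> a)); exact: smooth_fun_cst. Qed.

Lemma dfunE f p v : tangent p v -> dfun f p v = v f.
Proof. by move=> tv; rewrite /dfun; case: asboolP. Qed.

Lemma cotangent_dfun f p : smooth_fun f -> cotangent p (dfun f p).
Proof.
move=> sf; split=> [a v w tv tw|v nv]; last by rewrite /dfun; case: asboolP.
by rewrite !dfunE //; exact: tangent_lincomb.
Qed.

Lemma form1_dfun f : smooth_fun f -> form1 (dfun f : M -> covec M).
Proof.
move=> sf; split=> [p|X vX]; first exact: cotangent_dfun.
rewrite (_ : (fun p => _) = fun p => X p f); first exact: vfield_smooth.
by apply/funext => p; rewrite dfunE //; exact: vX.1.
Qed.

Lemma form1_0 : form1 (fun _ : M => 0 : covec M).
Proof.
split=> [p|X vX]; first exact: cotangent0.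
exact: smooth_fun_cst.
Qed.

Lemma cotangentZ p (a : R) (th : covec M) : cotangent p th -> cotangent p (a *: th).
Proof. by move=> c; have := cotangent_lincomb a c (cotangent0 p); rewrite addr0. Qed.

Lemma lie_form_ext X th p (om : covec M) : vfield X -> form1 th -> cotangent p om ->
  (forall Z, vfield Z -> lie_eval X th Z p = om (Z p)) -> lie_form X th p = om.
Proof.
move=> vX fth com H; apply: (cotangent_ext (cotangent_lie_form p vX fth) com).
by move=> v /vfield_extend[Z vZ <-]; rewrite lie_form_eval // H.
Qed.

Lemma lie_form_lincombl (a : R) X Y th p : vfield X -> vfield Y -> form1 th ->
  lie_form (fun q => a *: X q + Y q) th p = a *: lie_form X th p + lie_form Y th p.
Proof.
move=> vX vY fth; have vXa := vfieldZ a vX; have vXY := vfieldD vXa vY.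
have [cth sth] := fth.
apply: lie_form_ext => //.
  by apply: cotangent_lincomb; exact: cotangent_lie_form.
move=> Z vZ; rewrite -[RHS]/(a * lie_form X th p (Z p) + lie_form Y th p (Z p)).
rewrite !lie_form_eval // /lie_eval lieDl //.
rewrite (@lieMl _ (fun=> a)) //; last exact: smooth_fun_cst.
rewrite (tangent_cst _ (vZ.1 p)) scale0r subr0.
rewrite (cotangent_lin _ (cth p)); [|exact: (vfield_lie vX vZ).1|exact: (vfield_lie vY vZ).1].
by rewrite -[(a *: X p + Y p) _]/(a * X p _ + Y p _); ring.
Qed.

Lemma lie_form_lincombr (a : R) X th om p : vfield X -> form1 th -> form1 om ->
  lie_form X (fun q => a *: th q + om q) p = a *: lie_form X th p + lie_form X om p.
Proof.
move=> vX fth fom; have ftha := form1Z a fth; have fto := form1D ftha fom.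
apply: lie_form_ext => //.
  by apply: cotangent_lincomb; exact: cotangent_lie_form.
move=> Z vZ; rewrite -[RHS]/(a * lie_form X th p (Z p) + lie_form X om p (Z p)).
rewrite !lie_form_eval // /lie_eval.
have -> : X p (fun x => (a *: th x + om x) (Z x)) =
  X p (fun x => a * th x (Z x) + om x (Z x)) by [].
rewrite (tangent_lin _ (vX.1 p) (fth.2 _ vZ) (fom.2 _ vZ)).
by rewrite -[(a *: th p + om p) _]/(a * th p _ + om p _); ring.
Qed.

Lemma lie_formMl f X th p : smooth_fun f -> vfield X -> form1 th ->
  lie_form (fun q => f q *: X q) th p = f p *: lie_form X th p + th p (X p) *: dfun f p.
Proof.
move=> sf vX fth; have vfX := vfieldM sf vX; have [cth sth] := fth.
apply: lie_form_ext => //.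
  apply: cotangent_lincomb; first exact: cotangent_lie_form.
  by apply: cotangentZ; exact: cotangent_dfun.
move=> Z vZ; rewrite -[RHS]/(f p * lie_form X th p (Z p) + th p (X p) * dfun f p (Z p)).
rewrite lie_form_eval // dfunE; last exact: vZ.1.
rewrite /lie_eval lieMl // -scaleNr.
rewrite (cotangent_lin _ (cth p)); [|exact: (vfield_lie vX vZ).1|
  by apply: tangent_scale; exact: vX.1].
rewrite (cotangentZ_at _ (cth p)); last exact: vX.1.
by rewrite -[(f p *: X p) _]/(f p * X p _); ring.
Qed.

Lemma lie_formMr f X th p : smooth_fun f -> vfield X -> form1 th ->
  lie_form X (fun q => f q *: th q) p = f p *: lie_form X th p + X p f *: th p.
Proof.
move=> sf vX fth; have ff := form1M sf fth; have [cth sth] := fth.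
apply: lie_form_ext => //.
  apply: cotangent_lincomb; first exact: cotangent_lie_form.
  exact: cotangentZ.
move=> Z vZ; rewrite -[RHS]/(f p * lie_form X th p (Z p) + X p f * th p (Z p)).
rewrite lie_form_eval // /lie_eval.
have -> : X p (fun x => (f x *: th x) (Z x)) = X p (fun x => f x * th x (Z x)) by [].
rewrite (tangent_prod (vX.1 p) sf (sth _ vZ)).
by rewrite -[(f p *: th p) _]/(f p * th p _); ring.
Qed.

Lemma lie_form_dfun f X p : smooth_fun f -> vfield X ->
  lie_form X (dfun f) p = dfun (fun x => X x f) p.
Proof.
move=> sf vX; have fd := form1_dfun sf.
apply: lie_form_ext => //; first by apply: cotangent_dfun; exact: vfield_smooth.
move=> Z vZ; rewrite dfunE; last exact: vZ.1.
rewrite /lie_eval dfunE; last exact: (vfield_lie vX vZ).1.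
have -> : (fun x => dfun f x (Z x)) = fun x => Z x f.
  by apply/funext => x; rewrite dfunE //; exact: vZ.1.
by rewrite /lie opprB addrC subrK.
Qed.

Lemma lie_form0 X p : vfield X -> lie_form X (fun=> 0) p = 0.
Proof.
move=> vX; have f0 := form1_0.
apply: lie_form_ext => //; first exact: cotangent0.
move=> Z vZ;  rewrite /lie_eval.
by rewrite -[LHS]/(X p (fun=> 0) - 0) (tangent_cst _ (vX.1 p)) subrr.
Qed.

End LieDerivative.

(** * Connections and Dorfman connections *)

Section Connector.
Context {R : realType} {n k : nat} {M : manifold R n} {E : vbundle M k}.
Unset Implicit Arguments.
Context {I : eqType} (l : I -> forall m, fibre E m -> R)
  (s : I -> forall m, fibre E m) (r : M -> seq I).
Set Implicit Arguments.

Context (fr : locally_finite_frame l s r).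

Let dl i : dual_section (l i). Proof. by case: fr. Qed.
Let es i : esection (s i). Proof. by case: fr. Qed.
Let frE m (x : fibre E m) : \sum_(i <- r m) l i m x *: s i m = x.
Proof. by case: fr. Qed.

Let far m0 i : i \notin r m0 ->
  \forall m \near m0, forall x : fibre E m, l i m x = 0.
Proof. by move=> ni; case: fr => _ _ _ H _; apply: filterS (H m0) => m; apply. Qed.

(** Both sums reduce to the indices common to [r m] and [r m']. The list [r m] jumps with [m]; this
    lemma compares it with the list at a nearby point. *)
Lemma sum_local (V : zmodType) m m' (F : I -> V) :
  (forall i, i \notin r m -> F i = 0) -> (forall i, i \notin r m' -> F i = 0) ->
  \sum_(i <- r m) F i = \sum_(i <- r m') F i.
Proof.
have [_ _ ur _ _] := fr.
have H m1 m2 : (forall i, i \notin r m2 -> F i = 0) ->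
    \sum_(i <- r m1) F i = \sum_(i <- [seq i <- r m1 | i \in r m2]) F i.
  move=> F0; rewrite big_filter [RHS]big_mkcond /=; apply: eq_bigr => i _.
  by case: ifPn => // /F0.
move=> F1 F2; rewrite (H m m' F2) (H m' m F1); apply: perm_big.
apply: uniq_perm; rewrite ?filter_uniq // => i.
by rewrite !mem_filter andbC.
Qed.

(** Around [p0] the index list is frozen at [r (q p0)]. The vanishing hypothesis asks for [l i] to
    be zero near [q p] and not just at it, because the summands may contain derivatives of [l i]. *)
Lemma smooth_fun_local_sum N (X : manifold R N) (q : X -> M) (F : I -> X -> R) :
  continuous q -> (forall i, smooth_fun (F i)) ->
  (forall i p, (\forall m \near q p, forall x : fibre E m, l i m x = 0) -> F i p = 0) ->
  smooth_fun (fun p => \sum_(i <- r (q p)) F i p).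
Proof.
move=> cq sF F0; apply/smooth_funP => p0.
have S : sfun_at (fun p => \sum_(i <- r (q p0)) F i p) p0.
  by apply: sfun_at_sum => i; move: p0; apply/smooth_funP.
apply: sfun_at_eq S.
have [_ _ _ H _] := fr.
have : \forall p \near p0, \forall m \near q p, forall i, i \notin r (q p0) ->
   forall x : fibre E m, l i m x = 0.
  exact: (cq p0 _ (near_join (H (q p0)))).
apply: filterS => p Hp; apply: sum_local => i ni; apply: F0; last exact: far.
by apply: filterS Hp => m; apply.
Qed.

(* The connector TE -> E of the linear connection [nabla] below; [hor] is its
   horizontal lift. *)
Definition conn m (v : tvec E) : fibre E m :=
  \sum_(i <- r m) v (ell (l i)) *: s i m.

Lemma conn_lincomb m (a : R) v w : conn m (a *: v + w) = a *: conn m v + conn m w.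
Proof.
rewrite /conn scaler_sumr -big_split; apply: eq_bigr => i _ /=.
by rewrite -[(a *: v + w) _]/(a * v _ + w _) scalerDl scalerA.
Qed.

Lemma conn0 m : conn m 0 = 0.
Proof. by rewrite /conn big1 // => i _; rewrite scale0r. Qed.

Lemma tangent_far (p : E) v i : tangent p v ->
  (\forall m \near qE p, forall x : fibre E m, l i m x = 0) -> v (ell (l i)) = 0.
Proof.
move=> tv H; rewrite -(tangent_cst 0 tv); apply: (tangent_germ tv).
- exact: ell_smooth.
- exact: smooth_fun_cst.
have : \forall p' \near p, forall x : fibre E (qE p'), l i (qE p') x = 0.
  exact: (msmap_continuous ((smooth_mapP _).1 qE_smooth p) H).
by apply: filterS => p' H'; rewrite -[p' in LHS]pt_tagged ell_pt.
Qed.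

(** [v] is applied to the expansion of [lam] as the sum of the [l i] times [lam (s i)]. By the
    Leibniz rule, differentiating [l i] gives the connector and differentiating the coefficients
    gives a term depending only on the base part of [v]. *)
Lemma tangent_ell m (x : fibre E m) v lam : tangent (pt x) v -> dual_section lam ->
  v (ell lam) = lam m (conn m v) +
    \sum_(i <- r m) l i m x * push (@qE _ _ _ M E) v (fun m => lam m (s i m)).
Proof.
move=> tv dlam; have [_ _ _ H _] := fr.
have sls i : smooth_fun (fun m => lam m (s i m)) by exact: dlam.2.
have slE i : smooth_fun (fun p : E => lam (qE p) (s i (qE p))).
  exact: (smooth_fun_map (f := fun m => lam m (s i m)) qE_smooth).
have e : \forall p \near pt x, ell lam p =
    \sum_(i <- r m) ell (l i) p * lam (qE p) (s i (qE p)).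
  have : \forall p \near pt x, forall i, i \notin r m ->
      forall y : fibre E (qE p), l i (qE p) y = 0.
    have Hm : \forall m' \near qE (pt x), forall i, i \notin r m ->
      forall y : fibre E m', l i m' y = 0 by rewrite qE_pt.
    exact: (msmap_continuous ((smooth_mapP _).1 qE_smooth (pt x)) Hm).
  apply: filterS; apply: pt_ind => m' y; rewrite !ell_pt qE_pt => Hy.
  under eq_bigr do rewrite ell_pt.
  rewrite -{1}(frE y) (dual_sum _ _ dlam).
  rewrite (sum_local (m' := m)).
  - by apply: eq_bigr => i _; rewrite (dualZ _ _ dlam).
  - move=> i ni; rewrite (dualZ _ _ dlam).
    by rewrite (nbhs_singleton (far ni)) mul0r.
  - by move=> i ni; rewrite (dualZ _ _ dlam) Hy // mul0r.
rewrite (tangent_germ tv (ell_smooth dlam) _ e); last first.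
  by apply: smooth_fun_sum => i; apply: smooth_funM => //; exact: ell_smooth.
rewrite (tangent_sum _ tv); last first.
  by move=> i; apply: smooth_funM => //; exact: ell_smooth.
rewrite /conn (dual_sum _ _ dlam) -big_split; apply: eq_bigr => i _ /=.
rewrite (tangent_prod tv) //; last exact: ell_smooth.
by rewrite ell_pt qE_pt (dualZ _ _ dlam) push_qE // addrC (mulrC (lam _ _)).
Qed.

(** By [tangent_ell] the values on fibrewise linear functions depend only on the base part and the
    connector. Equalities in [TE] are checked below through these two components. *)
Lemma tangent_conn_ext m (x : fibre E m) v w :
  tangent (pt x) v -> tangent (pt x) w ->
  push (@qE _ _ _ M E) v = push (@qE _ _ _ M E) w -> conn m v = conn m w -> v = w.
Proof.
move=> tv tw e1 e2; apply: (tangent_tot_ext tv tw) => [f sf|lam dlam].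
  by rewrite -!push_qE // e1.
by rewrite (tangent_ell tv) // (tangent_ell tw) // e1 e2.
Qed.

Lemma conn_vertical m (x y : fibre E m) : conn m (vertical x y) = y.
Proof.
by rewrite /conn -[RHS]frE; apply: eq_bigr => i _; rewrite vertical_ell.
Qed.

(** A velocity is not visibly linear in the direction of its curve; linearity is read off from the
    connector. *)
Lemma vertical_lincomb m (x : fibre E m) (a : R) y z :
  vertical x (a *: y + z) = a *: vertical x y + vertical x z.
Proof.
apply: (@tangent_conn_ext m x).
- exact: tangent_vertical.
- by apply: tangent_lincomb; exact: tangent_vertical.
- by rewrite push_lincomb !push_qE_vertical scaler0 addr0.
- by rewrite conn_lincomb !conn_vertical.
Qed.

Lemma vertical0 m (x : fibre E m) : vertical x 0 = 0.
Proof.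
by have := vertical_lincomb x (-1) 0 0; rewrite scaler0 addr0 scaleN1r addNr.
Qed.

(** An extension of [x] with constant coefficients in the spanning family. It is not parallel in
    general; [hor] subtracts its covariant derivative. *)
Definition flat_section m (x : fibre E m) m' : fibre E m' :=
  \sum_(i <- r m) l i m x *: s i m'.

Lemma flat_sectionE m (x : fibre E m) : flat_section x m = x.
Proof. exact: frE. Qed.

Lemma esection_flat m (x : fibre E m) : esection (flat_section x).
Proof.
apply: esection_sum => i; apply: (esectionM (f := fun=> l i m x)) => //.
exact: smooth_fun_cst.
Qed.

Definition hor m (x : fibre E m) (v : tvec M) : tvec E :=
  let u := push (fun m => pt (flat_section x m) : E) v in
  u - vertical x (conn m u).

Lemma tangent_hor m (x : fibre E m) v : tangent m v -> tangent (pt x) (hor x v).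
Proof.
move=> tv; apply: tangent_sub; last exact: tangent_vertical.
have := tangent_section (esection_flat x) tv.
by rewrite flat_sectionE.
Qed.

Lemma conn_sub m (v w : tvec E) : conn m (v - w) = conn m v - conn m w.
Proof. by have := conn_lincomb m (-1) w v; rewrite !scaleN1r addrC [in RHS]addrC. Qed.

Lemma connD m (v w : tvec E) : conn m (v + w) = conn m v + conn m w.
Proof. by have := conn_lincomb m 1 v w; rewrite !scale1r. Qed.

Lemma push_qE_hor m (x : fibre E m) v : tangent m v ->
  push (@qE _ _ _ M E) (hor x v) = v.
Proof.
move=> tv; rewrite push_sub push_qE_vertical subr0 (push_section_base (m := m)) //.
exact: esection_flat.
Qed.

Lemma conn_hor m (x : fibre E m) v : conn m (hor x v) = 0.
Proof. by rewrite conn_sub conn_vertical subrr. Qed.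

Lemma hor_lincomb m (x : fibre E m) (a : R) v w : tangent m v -> tangent m w ->
  hor x (a *: v + w) = a *: hor x v + hor x w.
Proof.
move=> tv tw; apply: (@tangent_conn_ext m x).
- by apply: tangent_hor; exact: tangent_lincomb.
- by apply: tangent_lincomb; exact: tangent_hor.
- by rewrite push_lincomb !push_qE_hor //; exact: tangent_lincomb.
- by rewrite conn_lincomb !conn_hor scaler0 addr0.
Qed.

Lemma tangent_decomp m (x : fibre E m) v : tangent (pt x) v ->
  v = hor x (push (@qE _ _ _ M E) v) + vertical x (conn m v).
Proof.
move=> tv; have tqv : tangent m (push (@qE _ _ _ M E) v).
  by apply: tangent_qE tv; rewrite qE_pt.
apply: (tangent_conn_ext tv).
- by apply: tangent_add; [exact: tangent_hor|exact: tangent_vertical].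
- have := push_lincomb (@qE _ _ _ M E) 1 (hor x (push (@qE _ _ _ M E) v)) (vertical x (conn m v)).
  by rewrite !scale1r => ->; rewrite push_qE_hor // push_qE_vertical addr0.
- by rewrite connD conn_hor conn_vertical add0r.
Qed.

(** The maps [l] embed [E] in a trivial bundle and the [s] project back to [E]; this is the trivial
    connection compressed by the two, and no independence of the [s i] is involved. *)
Definition nabla (v : tvec M) (e : forall m, fibre E m) m : fibre E m :=
  \sum_(i <- r m) v (fun m => l i m (e m)) *: s i m.

Lemma conn_section v e m :
  conn m (push (fun m => pt (e m) : E) v) = nabla v e m.
Proof. by apply: eq_bigr => i _; rewrite push_section_ell. Qed.

Lemma push_section_decomp v e m : esection e -> tangent m v ->
  push (fun m => pt (e m) : E) v = hor (e m) v + vertical (e m) (nabla v e m).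
Proof.
move=> se tv; rewrite [LHS](tangent_decomp (tangent_section se tv)).
by rewrite (push_section_base (m := m)) // conn_section.
Qed.

(* [codiff eps x v] is the value on [x] of the dual derivative of [eps] along [v]. *)
Definition codiff (eps : forall m, fibre E m -> R) m (x : fibre E m) (v : tvec M) : R :=
  \sum_(i <- r m) l i m x * v (fun m => eps m (s i m)).

Lemma tangent_ell_codiff m (x : fibre E m) v lam : tangent (pt x) v ->
  dual_section lam ->
  v (ell lam) = lam m (conn m v) + codiff lam x (push (@qE _ _ _ M E) v).
Proof. exact: tangent_ell. Qed.

Lemma nabla_dual v e lam m : tangent m v -> esection e -> dual_section lam ->
  v (fun m => lam m (e m)) = lam m (nabla v e m) + codiff lam (e m) v.
Proof.
move=> tv se dlam; rewrite -conn_section -push_section_ell //.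
rewrite (tangent_ell_codiff (tangent_section se tv) dlam).
by rewrite (push_section_base (m := m)).
Qed.

Lemma nablaD v e e' m : tangent m v -> esection e -> esection e' ->
  nabla v (fun m => e m + e' m) m = nabla v e m + nabla v e' m.
Proof.
move=> tv se se'; rewrite /nabla -big_split; apply: eq_bigr => i _ /=.
rewrite -scalerDl -(tangentD tv); [|exact: (dl i).2|exact: (dl i).2].
by congr (v _ *: _); apply/funext => q; rewrite (dualD _ _ (dl i)).
Qed.

Lemma nablaM v f e m : tangent m v -> smooth_fun f -> esection e ->
  nabla v (fun m => f m *: e m) m = f m *: nabla v e m + v f *: e m.
Proof.
move=> tv sf se; rewrite /nabla scaler_sumr -[in RHS](frE (e m)) scaler_sumr.
rewrite -big_split; apply: eq_bigr => i _ /=.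
rewrite !scalerA -scalerDl; congr (_ *: _).
rewrite (mulrC (v f)) -(tangent_prod tv sf); last exact: (dl i).2.
by congr v; apply/funext => q; rewrite (dualZ _ _ (dl i)).
Qed.

Lemma nabla_lincomb (a : R) v w e m :
  nabla (a *: v + w) e m = a *: nabla v e m + nabla w e m.
Proof.
rewrite /nabla scaler_sumr -big_split; apply: eq_bigr => i _ /=.
by rewrite -[(a *: v + w) _]/(a * v _ + w _) scalerDl scalerA.
Qed.

Lemma hor0 m (x : fibre E m) : hor x 0 = 0.
Proof. by rewrite /hor push0 conn0 vertical0 subrr. Qed.

(** The section must be parallel at [m] in direction [v]: the derivative [w] of the flat section is
    cancelled by adding [h] times an extension of [w], where [h m = 0] and [v h = -1]. For [v = 0]
    there is no such [h], hence the separate case. *)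
Lemma hor_section m (x : fibre E m) v : tangent m v ->
  exists e, [/\ esection e, e m = x & push (fun m => pt (e m) : E) v = hor x v].
Proof.
move=> tv; have [->|v0] := pselect (v = 0).
  exists (flat_section x); split; [exact: esection_flat|exact: flat_sectionE|].
  by rewrite hor0 push0.
have [g [sg vg]] : exists g, smooth_fun g /\ v g <> 0.
  apply: contrapT => H; apply: v0; apply: (tangent_ext tv (tangent0 m)) => g sg.
  by apply: contrapT => vg; apply: H; exists g.
pose h q := - (v g)^-1 * (g q - g m).
have sg' : smooth_fun (fun q => g q - g m).
  by apply: smooth_funB => //; exact: smooth_fun_cst.
have sh : smooth_fun h by exact: smooth_funZ.
have hm : h m = 0 by rewrite /h subrr mulr0.
have vh : v h = -1.
  rewrite (tangentZ _ tv) // (tangentB tv) //; last exact: smooth_fun_cst.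
  by rewrite (tangent_cst _ tv) subr0 mulNr mulVf //; exact/eqP.
pose w := nabla v (flat_section x) m.
have sx := esection_flat x; have sw := esection_flat w.
pose e m' := flat_section x m' + h m' *: flat_section w m'.
have se : esection e by apply: esectionD => //; exact: esectionM.
have em : e m = x by rewrite /e hm scale0r addr0 flat_sectionE.
exists e; split=> //.
rewrite (push_section_decomp se tv) em.
rewrite /e nablaD //; last exact: esectionM.
by rewrite nablaM // hm vh scale0r add0r flat_sectionE scaleN1r subrr vertical0 addr0.
Qed.

(** * The splitting into side and core elements *)

Definition dpair m (nu : sideT E m) (tau : coreT E m) : R :=
  nu.2 tau.1 + tau.2 nu.1.

Definition side_vec m (nu : sideT E m) : Prop :=
  tangent m nu.1 /\ forall (a : R) x y, nu.2 (a *: x + y) = a * nu.2 x + nu.2 y.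

Lemma side_vec0 m (nu : sideT E m) : side_vec nu -> nu.2 0 = 0.
Proof.
move=> [_ h]; have := h 1 0 0; rewrite scaler0 addr0 mul1r => H.
by apply: (addrI (nu.2 0)); rewrite addr0 -H.
Qed.

Lemma side_vecZ m (nu : sideT E m) (a : R) x : side_vec nu -> nu.2 (a *: x) = a * nu.2 x.
Proof. by move=> sn; have := sn.2 a x 0; rewrite (side_vec0 sn) !addr0. Qed.

Lemma side_vecD m (nu : sideT E m) x y : side_vec nu -> nu.2 (x + y) = nu.2 x + nu.2 y.
Proof. by move=> sn; have := sn.2 1 x y; rewrite scale1r mul1r. Qed.

Lemma side_vec_lincomb m (a : R) (nu nu' : sideT E m) :
  side_vec nu -> side_vec nu' -> side_vec (a *: nu + nu').
Proof.
move=> [t1 l1] [t2 l2]; split; first exact: tangent_lincomb.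
move=> b x y; have E' z : (a *: nu + nu').2 z = a * nu.2 z + nu'.2 z by [].
by rewrite !E' l1 l2; ring.
Qed.

(* The linear splitting of TE (+) T^*E induced by [nabla] and, in [core_part],
   the projection to the core along it. *)
Definition sigma m (x : fibre E m) (nu : sideT E m) : gvec E :=
  (hor x nu.1, fun v => if `[< tangent (pt x) v >] then nu.2 (conn m v) else 0).

Definition core_part m (x : fibre E m) (xi : gvec E) : coreT E m :=
  (conn m xi.1, fun v => if `[< tangent m v >] then xi.2 (hor x v) else 0).

Lemma sigma2E m (x : fibre E m) nu v : tangent (pt x) v ->
  (sigma x nu).2 v = nu.2 (conn m v).
Proof. by move=> tv; rewrite /sigma /=; case: asboolP. Qed.

Lemma core_part2E m (x : fibre E m) xi v : tangent m v ->
  (core_part x xi).2 v = xi.2 (hor x v).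
Proof. by move=> tv; rewrite /core_part /=; case: asboolP. Qed.

Lemma core_up2E m (x : fibre E m) tau v : tangent (pt x) v ->
  (core_up tau x).2 v = tau.2 (push (@qE _ _ _ M E) v).
Proof. by move=> tv; rewrite /core_up /=; case: asboolP. Qed.

Lemma tangent_qE_pt m (x : fibre E m) v : tangent (pt x) v ->
  tangent m (push (@qE _ _ _ M E) v).
Proof. by apply: tangent_qE; rewrite qE_pt. Qed.

Lemma gtangent_sigma m (x : fibre E m) nu : side_vec nu -> gtangent (pt x) (sigma x nu).
Proof.
move=> sn; split; first by apply: tangent_hor; exact: sn.1.
split=> [a v w tv tw|v nv]; last by rewrite /sigma /=; case: asboolP.
rewrite !sigma2E //; last exact: tangent_lincomb.
by rewrite conn_lincomb sn.2.
Qed.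

Lemma gtangent_core_up m (x : fibre E m) (tau : coreT E m) : cotangent m tau.2 ->
  gtangent (pt x) (core_up tau x).
Proof.
move=> ct; split; first exact: tangent_vertical.
split=> [a v w tv tw|v nv]; last by rewrite /core_up /=; case: asboolP.
rewrite !core_up2E //; last exact: tangent_lincomb.
by rewrite push_lincomb (cotangent_lin _ ct) //;
  [exact: (tangent_qE_pt tv)|exact: (tangent_qE_pt tw)].
Qed.

Lemma cotangent_core_part m (x : fibre E m) xi : gtangent (pt x) xi ->
  cotangent m (core_part x xi).2.
Proof.
move=> [_ cxi]; split=> [a v w tv tw|v nv]; last by rewrite /core_part /=; case: asboolP.
rewrite !core_part2E //; last exact: tangent_lincomb.
by rewrite hor_lincomb // (cotangent_lin _ cxi) //; exact: tangent_hor.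
Qed.

Lemma side_vec_proj m (x : fibre E m) xi : gtangent (pt x) xi ->
  side_vec (side_proj x xi).
Proof.
move=> [txi cxi]; split; first exact: (tangent_qE_pt txi).
move=> a y z; rewrite /side_proj /= vertical_lincomb (cotangent_lin _ cxi) //;
  exact: tangent_vertical.
Qed.

Lemma side_proj_sigma m (x : fibre E m) nu : side_vec nu ->
  side_proj x (sigma x nu) = nu.
Proof.
case: nu => v eps sn; rewrite /side_proj /=; congr pair.
  by rewrite push_qE_hor //; exact: sn.1.
apply/funext => y; case: asboolP => [_|[]]; last exact: tangent_vertical.
by rewrite conn_vertical.
Qed.

Lemma side_proj_lincomb m (x : fibre E m) (a : R) xi eta :
  side_proj x (a *: xi + eta) = a *: side_proj x xi + side_proj x eta.
Proof. by rewrite /side_proj; congr pair; exact: push_lincomb. Qed.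

Lemma core_part_core_up m (x : fibre E m) (tau : coreT E m) : cotangent m tau.2 ->
  core_part x (core_up tau x) = tau.
Proof.
case: tau => y th /= ct; rewrite /core_part /=; congr pair; first exact: conn_vertical.
apply/funext => v; case: asboolP => [tv|ntv]; last by rewrite ct.2.
by case: asboolP => [_|[]]; [rewrite push_qE_hor|exact: tangent_hor].
Qed.

Lemma gvec_decomp m (x : fibre E m) xi : gtangent (pt x) xi ->
  xi = sigma x (side_proj x xi) + core_up (core_part x xi) x.
Proof.
case: xi => v th [/= tv ct]; congr pair; first exact: tangent_decomp.
apply: (cotangent_ext ct).
  have sn : side_vec (side_proj x (v, th)) by exact: side_vec_proj.
  have cc : cotangent m (core_part x (v, th)).2 by exact: cotangent_core_part.
  have := cotangent_lincomb 1 (gtangent_sigma x sn).2 (gtangent_core_up x cc).2.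
  by rewrite scale1r.
move=> w tw; rewrite -[RHS]/((sigma x _).2 w + (core_up _ x).2 w).
rewrite sigma2E // core_up2E // core_part2E; last exact: (tangent_qE_pt tw).
rewrite /side_proj /= addrC -(cotangentD_at ct); last exact: tangent_vertical.
  by rewrite -tangent_decomp.
by apply: tangent_hor; exact: (tangent_qE_pt tw).
Qed.

Lemma sigma_lincomb m (x : fibre E m) (a : R) (nu nu' : sideT E m) :
  side_vec nu -> side_vec nu' ->
  sigma x (a *: nu + nu') = a *: sigma x nu + sigma x nu'.
Proof.
move=> sn sn'; congr pair; first by apply: hor_lincomb; [exact: sn.1|exact: sn'.1].
apply/funext => v; rewrite -[RHS]/(a * (sigma x nu).2 v + (sigma x nu').2 v).
by rewrite /sigma /=; case: asboolP => // _; rewrite mulr0 addr0.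
Qed.

Lemma core_up_lincomb m (x : fibre E m) (a : R) (tau tau' : coreT E m) :
  core_up (a *: tau + tau') x = a *: core_up tau x + core_up tau' x.
Proof.
congr pair; first exact: vertical_lincomb.
apply/funext => v; rewrite -[RHS]/(a * (core_up tau x).2 v + (core_up tau' x).2 v).
by rewrite /core_up /=; case: asboolP => // _; rewrite mulr0 addr0.
Qed.

(** The connector kills horizontal lifts. With [gpair_core], both summands of the splitting are
    isotropic, so the pairing is carried by the mixed terms, where it is the duality of side and
    core. *)
Lemma gpair_sigma m (x : fibre E m) (nu nu' : sideT E m) :
  side_vec nu -> side_vec nu' -> gpair (sigma x nu) (sigma x nu') = 0.
Proof.
move=> sn sn'; rewrite /gpair !sigma2E.
- by rewrite !conn_hor (side_vec0 sn) (side_vec0 sn') addr0.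
- by apply: tangent_hor; exact: sn.1.
- by apply: tangent_hor; exact: sn'.1.
Qed.

Lemma gpair_sigma_core m (x : fibre E m) (nu : sideT E m) (tau : coreT E m) :
  side_vec nu -> gpair (sigma x nu) (core_up tau x) = dpair nu tau.
Proof.
move=> sn; rewrite /gpair sigma2E; last exact: tangent_vertical.
rewrite core_up2E; last by apply: tangent_hor; exact: sn.1.
by rewrite conn_vertical push_qE_hor //; exact: sn.1.
Qed.

Lemma gpair_core m (x : fibre E m) (tau tau' : coreT E m) :
  cotangent m tau.2 -> cotangent m tau'.2 ->
  gpair (core_up tau x) (core_up tau' x) = 0.
Proof.
move=> ct ct'; rewrite /gpair !core_up2E; [|exact: tangent_vertical..].
by rewrite !push_qE_vertical (cotangent_at0 ct) (cotangent_at0 ct') addr0.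
Qed.

Lemma side_section_dual (nu : forall m, sideT E m) :
  side_section nu -> dual_section (fun m => (nu m).2).
Proof. by case. Qed.

Lemma side_section_vec (nu : forall m, sideT E m) m :
  side_section nu -> side_vec (nu m).
Proof. by case=> [[h _] h' _]; split. Qed.

(** * Smoothness of the splitting *)

Lemma qE_continuous : continuous (@qE _ _ _ M E).
Proof.
by move=> p; exact: (msmap_continuous ((smooth_mapP _).1 qE_smooth p)).
Qed.

Lemma smooth_fun_qE (f : M -> R) :
  smooth_fun f -> smooth_fun (fun p : E => f (qE p)).
Proof. exact: (smooth_fun_map qE_smooth). Qed.

Lemma vfield_hor X : vfield X ->
  vfield (fun p : E => hor (tagged (split_tot p)) (X (qE p))).
Proof.
move=> [tX sX]; have tH p : tangent p (hor (tagged (split_tot p)) (X (qE p))).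
  by rewrite -[X in tangent X _]pt_tagged; apply: tangent_hor; exact: tX.
apply: (vfield_tot tH) => [f sf|lam dlam].
  have := smooth_fun_qE (sX _ sf).
  rewrite (_ : (fun q => _) = fun q : E =>
      hor (tagged (split_tot q)) (X (qE q)) (fun p => f (qE p))) //.
  by apply/funext => q; rewrite -push_qE // push_qE_hor //; exact: tX.
have S : smooth_fun (fun p : E => \sum_(i <- r (qE p))
    ell (l i) p * X (qE p) (fun m => lam m (s i m))).
  apply: (smooth_fun_local_sum qE_continuous) => [i|i p H].
    apply: smooth_funM; first exact: ell_smooth.
    have sXi := sX _ (dlam.2 _ (es i)).
    exact: (smooth_fun_qE sXi).
  by rewrite -[p in ell _ p]pt_tagged ell_pt (nbhs_singleton H) mul0r.
rewrite (_ : (fun p => _) = fun p : E => \sum_(i <- r (qE p))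
    ell (l i) p * X (qE p) (fun m => lam m (s i m))) //.
apply/funext => p; have tp : tangent (pt (tagged (split_tot p)))
   (hor (tagged (split_tot p)) (X (qE p))) by apply: tangent_hor; exact: tX.
rewrite (tangent_ell tp dlam) conn_hor (dual0 _ dlam) add0r.
apply: eq_bigr => i _.
by rewrite push_qE_hor; [rewrite -[p in RHS]pt_tagged ell_pt qE_pt|exact: tX].
Qed.

Lemma vfield_vertical e : esection e ->
  vfield (fun p : E => vertical (tagged (split_tot p)) (e (qE p))).
Proof.
move=> se; have tV p : tangent p (vertical (tagged (split_tot p)) (e (qE p))).
  by rewrite -[X in tangent X _]pt_tagged; exact: tangent_vertical.
apply: (vfield_tot tV) => [f sf|lam dlam].
  rewrite (_ : (fun p => _) = fun=> 0); first exact: smooth_fun_cst.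
  by apply/funext => p; exact: vertical_base.
rewrite (_ : (fun p => _) = fun p : E => lam (qE p) (e (qE p))).
  exact: (smooth_fun_qE (dlam.2 _ se)).
by apply/funext => p; exact: vertical_ell.
Qed.

Lemma smooth_conn V eps : vfield V -> dual_section eps ->
  smooth_fun (fun p : E => eps (qE p) (conn (qE p) (V p))).
Proof.
move=> [tV sV] de.
have S : smooth_fun (fun p : E => \sum_(i <- r (qE p)) V p (ell (l i)) * eps (qE p) (s i (qE p))).
  apply: (smooth_fun_local_sum qE_continuous) => [i|i p H].
    apply: smooth_funM; first by apply: sV; exact: ell_smooth.
    exact: (smooth_fun_qE (de.2 _ (es i))).
  by rewrite (tangent_far (tV p) H) mul0r.
rewrite (_ : (fun p => _) = fun p : E =>
  \sum_(i <- r (qE p)) V p (ell (l i)) * eps (qE p) (s i (qE p))) //.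
apply/funext => p; rewrite /conn (dual_sum _ _ de).
by apply: eq_bigr => i _; rewrite (dualZ _ _ de).
Qed.

Lemma gsection_sigma nu : side_section nu ->
  gsection (fun p : E => sigma (tagged (split_tot p)) (nu (qE p))).
Proof.
move=> sn; have [vn _ _] := sn; split; first exact: (vfield_hor vn).
have gs p : gtangent p (sigma (tagged (split_tot p)) (nu (qE p))).
  by rewrite -[X in gtangent X _]pt_tagged; apply: gtangent_sigma; exact: side_section_vec.
split=> [p|V sV]; first exact: (gs p).2.
have := smooth_conn sV (side_section_dual sn).
rewrite (_ : (fun p => _) = fun p : E => (sigma (tagged (split_tot p)) (nu (qE p))).2 (V p)) //.
by apply/funext => p; rewrite sigma2E // pt_tagged; exact: sV.1.
Qed.

Lemma core_section_part e S : esection e -> gsection S ->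
  core_section (fun m => core_part (e m) (S (pt (e m)))).
Proof.
move=> se [sV [cT sT]]; split.
  apply/esectionP => lam dlam.
  have := smooth_fun_map se (smooth_conn sV dlam).
  rewrite (_ : (fun q => _) = fun m => lam m (conn m (S (pt (e m))).1)) //.
  by apply/funext => m; rewrite qE_pt.
split=> [m|X sX].
  apply: (@cotangent_core_part m (e m) (S (pt (e m)))).
  by split; [exact: sV.1|exact: cT].
have := smooth_fun_map se (sT _ (vfield_hor sX)).
rewrite (_ : (fun q => _) = fun m => (core_part (e m) (S (pt (e m)))).2 (X m)) //.
apply/funext => m; rewrite core_part2E; last exact: sX.1.
by rewrite /pt /qE incK.
Qed.

(** Evaluation along the zero section; this is how smoothness of [j] is obtained from that of
    [J]. *)
Lemma side_section_proj S : gsection S ->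
  side_section (fun m => side_proj (0 : fibre E m) (S (pt (0 : fibre E m)))).
Proof.
move=> [sV [cT sT]]; have gS m : gtangent (pt (0 : fibre E m)) (S (pt (0 : fibre E m))).
  by split; [exact: sV.1|exact: cT].
split.
- split=> [m|f sf]; first exact: (side_vec_proj (gS m)).1.
  have := smooth_fun_map (@esection0 _ _ _ M E) (sV.2 _ (smooth_fun_map qE_smooth sf)).
  rewrite (_ : (fun q => _) = fun m => (side_proj (0 : fibre E m) (S (pt (0 : fibre E m)))).1 f) //.
  by apply/funext => m; rewrite /side_proj /= push_qE.
- by move=> m; exact: (side_vec_proj (gS m)).2.
- move=> e se; have := smooth_fun_map (@esection0 _ _ _ M E) (sT _ (vfield_vertical se)).
  rewrite (_ : (fun q => _) = fun m =>
      (side_proj (0 : fibre E m) (S (pt (0 : fibre E m)))).2 (e m)) //.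
  by apply/funext => m; rewrite /side_proj /= /pt /qE incK.
Qed.

(** * Addition and scaling over TM and E^* *)

Lemma tsum_hor m (x y : fibre E m) v : tangent m v ->
  tsum x y (hor x v) (hor y v) (hor (x + y) v).
Proof.
move=> tv; have [c [sc c0 cv]] := curve_exists tv.
(* Two sections parallel at [m] along [v] have a sum that is parallel there as well. Composing them
   with one base curve of velocity [v] gives the curves that [tsum] asks for. *)
have [e [se ex hx]] := hor_section x tv.
have [e' [se' ey hy]] := hor_section y tv.
have push_hor : push (fun m => pt (e m + e' m) : E) v = hor (x + y) v.
  have H := push_section_decomp (esectionD se se') tv.
  rewrite H nablaD // ex ey.
  have zero z ez : esection ez -> ez m = z ->
     push (fun m => pt (ez m) : E) v = hor z v -> nabla v ez m = 0.
    move=> sez ezm H'; rewrite -conn_section H'; exact: conn_hor.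
  by rewrite (zero x e) // (zero y e') // addr0 vertical0 addr0.
exists c, (fun t => e (c t)), (fun t => e' (c t)).
have scv e0 (se0 : esection e0) := smooth_curve_map se0 sc.
split; [exact: scv|exact: scv| |].
  split; first by rewrite -ex -[in RHS]c0.
  by rewrite -ey -[in RHS]c0.
split.
- by rewrite -hx -cv push_velocity.
- by rewrite -hy -cv push_velocity.
- by rewrite -push_hor -cv push_velocity //; exact: esectionD.
Qed.

(** The curves in [tsum] start over [c 0], which is only propositionally equal to [m]; base points
    have to be identified before fibre elements can be compared. *)
Lemma Tagged_add m m' (x y : fibre E m) (x' y' : fibre E m') :
  pt x = pt x' -> pt y = pt y' -> pt (x + y) = pt (x' + y').
Proof.
move=> /(can_inj (@incK _ _ _ _ E)) e1 /(can_inj (@incK _ _ _ _ E)) e2.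
have mm : m = m' by have /(congr1 (@tag _ _)) := e1.
subst m'; have -> : x = x' := eq_from_Tagged e1.
by have -> : y = y' := eq_from_Tagged e2.
Qed.

(** The functions [ell (l i)] are additive along [a t + b t], so their derivatives, which make up
    the connector, add; the base curve is common to all three velocities. *)
Lemma tsum_spec m (x y : fibre E m) v w u : tsum x y v w u ->
  [/\ tangent (pt (x + y)) u, conn m u = conn m v + conn m w &
      push (@qE _ _ _ M E) u = push (@qE _ _ _ M E) v].
Proof.
move=> [c [a [b [sa sb [a0 b0] [-> -> ->]]]]].
have la lam (dlam : dual_section lam) t : smooth_at (fun t => lam (c t) (a t)) t.
  have := sfun_at_msmooth ((smooth_curveP _).1 sa t) ((smooth_funP _).1 (ell_smooth dlam) _).
  by apply: smooth_at_eq; near=> q; rewrite ell_pt.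
have lb lam (dlam : dual_section lam) t : smooth_at (fun t => lam (c t) (b t)) t.
  have := sfun_at_msmooth ((smooth_curveP _).1 sb t) ((smooth_funP _).1 (ell_smooth dlam) _).
  by apply: smooth_at_eq; near=> q; rewrite ell_pt.
have sab : smooth_curve (fun t => pt (a t + b t) : E).
  apply: smooth_curve_tot => [|lam dlam t].
    have := smooth_curve_map qE_smooth sa.
    rewrite (_ : (fun t => _) = c); last by apply/funext => t; rewrite qE_pt.
    by rewrite (_ : (fun t => _) = c) //; apply/funext => t; rewrite qE_pt.
  apply: smooth_at_eq (smooth_atD (la _ dlam t) (lb _ dlam t)).
  by near=> q; rewrite ell_pt (dualD _ _ dlam).
split.
- by apply: velocity_at => //; exact: Tagged_add.
- rewrite /conn -big_split; apply: eq_bigr => i _ /=.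
  rewrite -scalerDl; congr (_ *: _).
  rewrite !velocityE; [|exact: ell_smooth..].
  have e e0 : ell (l i) \o (fun t => pt (e0 t : fibre E (c t)) : E) = fun t => l i (c t) (e0 t).
    by apply/funext => t /=; rewrite ell_pt.
  rewrite (e a) (e b) (e (fun t => a t + b t)) !derive1E.
  rewrite -deriveD; [|exact: smooth_at_derivable (la _ (dl i) 0)|
    exact: smooth_at_derivable (lb _ (dl i) 0)].
  by congr derive; apply/funext => t; rewrite (dualD _ _ (dl i)).
- apply/funext => f; have [sf|nf] := pselect (smooth_fun f); last first.
    by rewrite /push; case: asboolP.
  rewrite !push_qE // !velocityE; [|exact: (smooth_fun_map qE_smooth sf)..].
  by congr derive1; apply/funext => t /=; rewrite !qE_pt.
Unshelve. all: by end_near. Qed.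

Definition fscale (a : R) (p : E) : E := pt (a *: tagged (split_tot p)).

Lemma fscale_pt a m (x : fibre E m) : fscale a (pt x) = pt (a *: x).
Proof. by rewrite /fscale /pt incK. Qed.

Lemma fscale_smooth a : smooth_map (fscale a).
Proof.
apply: smooth_map_tot => [|lam dlam].
  rewrite (_ : (fun t => _) = @qE _ _ _ M E); first exact: qE_smooth.
  by apply/funext; apply: pt_ind => m x; rewrite fscale_pt !qE_pt.
have := smooth_funZ a (ell_smooth dlam).
rewrite (_ : (fun q => _) = fun y => ell lam (fscale a y)) //.
by apply/funext; apply: pt_ind => m x; rewrite fscale_pt !ell_pt (dualZ _ _ dlam).
Qed.

Lemma tangent_tscale a m (x : fibre E m) v : tangent (pt x) v ->
  tangent (pt (a *: x)) (tscale a v).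
Proof. by move=> /(tangent_push (fscale_smooth a)); rewrite fscale_pt. Qed.

Lemma conn_tscale a m (x : fibre E m) v : tangent (pt x) v ->
  conn m (tscale a v) = a *: conn m v.
Proof.
move=> tv; rewrite /conn scaler_sumr; apply: eq_bigr => i _.
rewrite scalerA -(tangentZ a tv); last exact: ell_smooth.
rewrite /tscale pushE; last exact: ell_smooth.
congr (v _ *: _); apply/funext; apply: pt_ind => m' y.
by rewrite /= -/(fscale a (pt y)) fscale_pt !ell_pt (dualZ _ _ (dl i)).
Qed.

Lemma push_qE_tscale a (v : tvec E) :
  push (@qE _ _ _ M E) (tscale a v) = push (@qE _ _ _ M E) v.
Proof.
apply/funext => f; have [sf|nf] := pselect (smooth_fun f); last first.
  by rewrite /push; case: asboolP.
rewrite !push_qE // /tscale pushE; last exact: (smooth_fun_map qE_smooth sf).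
congr v; apply/funext; apply: pt_ind => m y.
by rewrite /= -/(fscale a (pt y)) fscale_pt !qE_pt.
Qed.

Lemma tscale_hor a m (x : fibre E m) v : tangent m v ->
  tscale a (hor x v) = hor (a *: x) v.
Proof.
move=> tv; apply: (@tangent_conn_ext m (a *: x)).
- by apply: tangent_tscale; exact: tangent_hor.
- exact: tangent_hor.
- by rewrite push_qE_tscale !push_qE_hor.
- by rewrite (conn_tscale _ (tangent_hor x tv)) !conn_hor scaler0.
Qed.

(** The lift is linear also for the structure over [TM] and [E^*]. Together with [gsum_core_part],
    this turns additivity of [J] over [j] into additivity of the defect in the point of [E]. *)
Lemma gsum_sigma m (x y : fibre E m) nu : side_vec nu ->
  gsum x y (sigma x nu) (sigma y nu) (sigma (x + y) nu).
Proof.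
move=> sn; split; first by rewrite !side_proj_sigma.
  by apply: tsum_hor; exact: sn.1.
move=> v w u tv tw /tsum_spec[tu cu _].
by rewrite !sigma2E // cu (side_vecD _ _ sn).
Qed.

Lemma gscale_sigma a m (x : fibre E m) nu : side_vec nu ->
  gscale x a (sigma x nu) (sigma (a *: x) nu).
Proof.
move=> sn; split; first by rewrite !side_proj_sigma.
  by rewrite /= tscale_hor //; exact: sn.1.
move=> v tv; rewrite !sigma2E //; last exact: tangent_tscale.
by rewrite (conn_tscale _ tv) (side_vecZ _ _ sn).
Qed.

(** The covector part is tested on horizontal vectors, which form a sum in [TE -> TM] by
    [tsum_hor]. *)
Lemma gsum_core_part m (x y : fibre E m) xi eta zeta : gsum x y xi eta zeta ->
  core_part (x + y) zeta = core_part x xi + core_part y eta.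
Proof.
move=> [_ /tsum_spec[_ cu _] H]; congr pair; first exact: cu.
apply/funext => v; rewrite -[RHS]/((core_part x xi).2 v + (core_part y eta).2 v).
rewrite /core_part /=; case: asboolP => [tv|_]; last by rewrite addr0.
by apply: H; [exact: tangent_hor|exact: tangent_hor|exact: tsum_hor].
Qed.

Lemma gscale_core_part a m (x : fibre E m) xi zeta : gtangent (pt x) xi ->
  gscale x a xi zeta -> core_part (a *: x) zeta = a *: core_part x xi.
Proof.
move=> [txi _] [_ e H]; congr pair; first by rewrite /= e (conn_tscale _ txi).
apply/funext => v; rewrite -[RHS]/(a * (core_part x xi).2 v).
rewrite /core_part /=; case: asboolP => [tv|_]; last by rewrite mulr0.
by rewrite -tscale_hor // H //; exact: tangent_hor.
Qed.

(** * The dual derivative and the Dorfman connection of the linear connection *)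

Lemma codiff_lincomb eps m (a : R) (x y : fibre E m) v :
  codiff eps (a *: x + y) v = a * codiff eps x v + codiff eps y v.
Proof.
rewrite /codiff mulr_sumr -big_split; apply: eq_bigr => i _ /=.
by rewrite (dl i).1 mulrDl mulrA.
Qed.

Lemma codiff0 eps m v : codiff eps (0 : fibre E m) v = 0.
Proof. by rewrite /codiff big1 // => i _; rewrite (dual0 _ (dl i)) mul0r. Qed.

Lemma codiffM f eps m (x : fibre E m) v : tangent m v -> smooth_fun f ->
  dual_section eps ->
  codiff (fun m x => f m * eps m x) x v = f m * codiff eps x v + eps m x * v f.
Proof.
move=> tv sf de; have -> : eps m x = \sum_(i <- r m) l i m x * eps m (s i m).
  by rewrite -{1}(frE x) (dual_sum _ _ de); apply: eq_bigr => i _; rewrite (dualZ _ _ de).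
rewrite /codiff mulr_sumr mulr_suml -big_split; apply: eq_bigr => i _ /=.
by rewrite (tangent_prod tv sf (de.2 _ (es i))); ring.
Qed.

Lemma codiffD eps eps' m (x : fibre E m) v : tangent m v ->
  dual_section eps -> dual_section eps' ->
  codiff (fun m x => eps m x + eps' m x) x v = codiff eps x v + codiff eps' x v.
Proof.
move=> tv de de'; rewrite /codiff -big_split; apply: eq_bigr => i _ /=.
by rewrite (tangentD tv (de.2 _ (es i)) (de'.2 _ (es i))) mulrDr.
Qed.

Lemma smooth_codiff eps e X : dual_section eps -> esection e -> vfield X ->
  smooth_fun (fun m => codiff eps (e m) (X m)).
Proof.
move=> de se [tX sX].
apply: (smooth_fun_local_sum (q := id)) => [m|i|i p H]; first exact: cvg_id.
  exact: (smooth_funM ((dl i).2 _ se) (sX _ (de.2 _ (es i)))).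
by rewrite (nbhs_singleton H) mul0r.
Qed.

Lemma esection_nabla X e : vfield X -> esection e ->
  esection (fun m => nabla (X m) e m).
Proof.
move=> vX se; apply/esectionP => lam dlam.
rewrite (_ : (fun m => _) = fun m => X m (fun q => lam q (e q)) - codiff lam (e m) (X m)).
  exact: (smooth_funB (vX.2 _ (dlam.2 _ se)) (smooth_codiff dlam se vX)).
by apply/funext => m; rewrite (nabla_dual (vX.1 m) se dlam) addrK.
Qed.

Lemma nabla0 v m : tangent m v -> nabla v (fun m => 0 : fibre E m) m = 0.
Proof.
move=> tv; rewrite /nabla big1 // => i _.
rewrite (_ : (fun m => _) = fun=> 0) ?(tangent_cst _ tv) ?scale0r //.
by apply/funext => q; rewrite (dual0 _ (dl i)).
Qed.

(** The dual derivative as a covector, set to zero off the tangent space as [cotangent] demands. *)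
Definition codform (eps : forall m, fibre E m -> R) m (x : fibre E m) : covec M :=
  fun v => if `[< tangent m v >] then codiff eps x v else 0.

Lemma codformE eps m (x : fibre E m) v : tangent m v -> codform eps x v = codiff eps x v.
Proof. by rewrite /codform; case: asboolP. Qed.

Lemma cotangent_codform eps m (x : fibre E m) : dual_section eps ->
  cotangent m (codform eps x).
Proof.
move=> de; split=> [a v w tv tw|v nv]; last by rewrite /codform; case: asboolP.
rewrite !codformE //; last exact: tangent_lincomb.
rewrite /codiff mulr_sumr -big_split; apply: eq_bigr => i _ /=.
by rewrite -[(a *: v + w) _]/(a * v _ + w _); ring.
Qed.

Lemma form1_codform eps e : dual_section eps -> esection e ->
  form1 (fun m => codform eps (e m)).
Proof.
move=> de se; split=> [m|X vX]; first exact: cotangent_codform.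
rewrite (_ : (fun m => _) = fun m => codiff eps (e m) (X m)); first exact: smooth_codiff.
by apply/funext => m; rewrite codformE //; exact: vX.1.
Qed.

Lemma codform_lincomb eps m (a : R) (x y : fibre E m) :
  codform eps (a *: x + y) = a *: codform eps x + codform eps y.
Proof.
apply/funext => v; rewrite -[RHS]/(a * codform eps x v + codform eps y v) /codform.
by case: asboolP => _; rewrite ?codiff_lincomb // mulr0 addr0.
Qed.

Lemma codform0 eps m : codform eps (0 : fibre E m) = 0.
Proof. by apply/funext => v; rewrite /codform codiff0; case: asboolP. Qed.

Lemma codformD eps eps' m (x : fibre E m) : dual_section eps -> dual_section eps' ->
  codform (fun m x => eps m x + eps' m x) x = codform eps x + codform eps' x.
Proof.
move=> de de'; apply/funext => v; rewrite -[RHS]/(codform eps x v + codform eps' x v).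
by rewrite /codform; case: asboolP => [tv|_]; rewrite ?codiffD // addr0.
Qed.

Lemma codformM f eps m (x : fibre E m) : smooth_fun f -> dual_section eps ->
  codform (fun m x => f m * eps m x) x = f m *: codform eps x + eps m x *: dfun f m.
Proof.
move=> sf de; apply/funext => v.
rewrite -[RHS]/(f m * codform eps x v + eps m x * dfun f m v) /codform /dfun.
by case: asboolP => [tv|_]; rewrite ?codiffM // !mulr0 addr0.
Qed.

(* The Dorfman connection whose horizontal lift is [sigma]. *)
Definition base_connection : connection_type E := fun nu tau m =>
  (nabla (nu m).1 (fun x => (tau x).1) m,
   lie_form (fun p => (nu p).1) (fun p => (tau p).2) m
   + codform (fun m => (nu m).2) (tau m).1).

Lemma core_sectionD tau tau' : core_section tau -> core_section tau' ->
  core_section (fun m => tau m + tau' m : coreT E m).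
Proof.
by move=> [s1 f1] [s2 f2]; split; [exact: (esectionD s1 s2)|exact: (form1D f1 f2)].
Qed.

Lemma core_section_base nu tau : side_section nu -> core_section tau ->
  core_section (base_connection nu tau).
Proof.
move=> sn [st ft]; have [vn _ _] := sn; split; first exact: (esection_nabla vn st).
exact: (form1D (form1_lie_form vn ft) (form1_codform (side_section_dual sn) st)).
Qed.

Lemma base_connectionM f nu tau m : smooth_fun f -> side_section nu ->
  core_section tau ->
  base_connection nu (fun m => f m *: tau m) m =
  f m *: base_connection nu tau m + (nu m).1 f *: tau m.
Proof.
move=> sf sn [st ft]; have [vn _ _] := sn; congr pair.
  exact: (nablaM (vn.1 m) sf st).
rewrite (lie_formMr _ sf vn ft) -[X in codform _ X]addr0 codform_lincomb codform0 addr0.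
by rewrite -[RHS]/(f m *: (_ + _) + _) scalerDr addrAC.
Qed.

Lemma base_connectionDr nu tau tau' m : side_section nu ->
  core_section tau -> core_section tau' ->
  base_connection nu (fun m => tau m + tau' m) m =
  base_connection nu tau m + base_connection nu tau' m.
Proof.
move=> sn [st ft] [st' ft']; have [vn _ _] := sn; congr pair.
  exact: (nablaD (vn.1 m) st st').
have := lie_form_lincombr 1 m vn ft ft'.
under [X in lie_form _ X]funext do rewrite scale1r.
rewrite scale1r => ->.
have := codform_lincomb (fun m => (nu m).2) 1 (tau m).1 (tau' m).1.
rewrite !scale1r => ->.
by rewrite addrACA.
Qed.

Lemma base_connectionMl f nu tau m : smooth_fun f -> side_section nu ->
  core_section tau ->
  base_connection (fun m => f m *: nu m) tau m =
  f m *: base_connection nu tau m + duality nu tau m *: core_d E f m.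
Proof.
move=> sf sn [st ft]; have [vn _ _] := sn; congr pair.
  rewrite -[RHS]/(f m *: nabla (nu m).1 _ m + duality nu tau m *: 0) scaler0.
  have -> : 0 = nabla 0 (fun m => (tau m).1) m :> fibre E m.
    by rewrite /nabla big1 // => i _; rewrite scale0r.
  by rewrite -nabla_lincomb addr0.
rewrite (lie_formMl _ sf vn ft).
rewrite -[X in _ + X = _]/(codform (fun m x => f m * (nu m).2 x) (tau m).1).
rewrite (codformM _ sf (side_section_dual sn)).
rewrite -[RHS]/(f m *: (_ + _) + duality nu tau m *: dfun f m) /duality.
by rewrite scalerDr scalerDl addrACA [X in _ + X]addrC.
Qed.

Lemma base_connectionDl nu nu' tau m : side_section nu -> side_section nu' ->
  core_section tau ->
  base_connection (fun m => nu m + nu' m) tau m =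
  base_connection nu tau m + base_connection nu' tau m.
Proof.
move=> sn sn' [st ft]; have [vn _ _] := sn; have [vn' _ _] := sn'; congr pair.
  have := nabla_lincomb 1 (nu m).1 (nu' m).1 (fun m => (tau m).1) m.
  by rewrite !scale1r.
have := lie_form_lincombl 1 m vn vn' ft.
under [X in lie_form X]funext do rewrite scale1r.
rewrite scale1r => ->.
rewrite -[X in _ + X = _]/(codform (fun m x => (nu m).2 x + (nu' m).2 x) (tau m).1).
by rewrite (codformD _ (side_section_dual sn) (side_section_dual sn')) addrACA.
Qed.

Lemma base_connection_d f nu m : smooth_fun f -> side_section nu ->
  base_connection nu (core_d E f) m = core_d E (fun x => (nu x).1 f) m.
Proof.
move=> sf sn; have [vn _ _] := sn; rewrite /base_connection /core_d /=.
by rewrite (nabla0 (vn.1 m)) (lie_form_dfun _ sf vn) codform0 addr0.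
Qed.

(* The last condition keeps the dual dull bracket skew-symmetric. *)
Definition core_tensor (psi : forall m, fibre E m -> sideT E m -> coreT E m) : Prop :=
  [/\ forall m (a : R) x y nu, side_vec nu ->
        psi m (a *: x + y) nu = a *: psi m x nu + psi m y nu,
      forall m x (a : R) nu nu', side_vec nu -> side_vec nu' ->
        psi m x (a *: nu + nu') = a *: psi m x nu + psi m x nu',
      forall e nu, esection e -> side_section nu ->
        core_section (fun m => psi m (e m) (nu m)) &
      forall m x nu nu', side_vec nu -> side_vec nu' ->
        dpair nu' (psi m x nu) = - dpair nu (psi m x nu')].

Definition corrected_connection (psi : forall m, fibre E m -> sideT E m -> coreT E m) :
    connection_type E := fun nu tau m =>
  base_connection nu tau m + psi m (tau m).1 (nu m).

(** The sign is opposite to that in [corrected_connection], because a horizontal lift subtracts the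
    core section of the connection. *)
Definition corrected_lift (psi : forall m, fibre E m -> sideT E m -> coreT E m)
    (nu : forall m, sideT E m) (p : E) : gvec E :=
  sigma (tagged (split_tot p)) (nu (qE p)) -
  core_up (psi _ (tagged (split_tot p)) (nu (qE p))) (tagged (split_tot p)).

Lemma smooth_duality (nu : forall m, sideT E m) (tau : forall m, coreT E m) :
  side_section nu -> core_section tau -> smooth_fun (duality nu tau).
Proof.
by move=> [vn _ sn] [st ft]; exact: (smooth_funD (sn _ st) (ft.2 _ vn)).
Qed.

(** * Dorfman connections corrected by a core tensor *)

Section CoreTensor.
Context (psi : forall m, fibre E m -> sideT E m -> coreT E m) (hpsi : core_tensor psi).

Lemma core_tensor0 m nu : side_vec nu -> psi (0 : fibre E m) nu = 0.
Proof.
move=> sn; have [h _ _ _] := hpsi.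
have := h m 1 0 0 nu sn; rewrite scaler0 addr0 scale1r => H.
by apply: (addrI (psi (0 : fibre E m) nu)); rewrite addr0 -H.
Qed.

Lemma side_vec_0 m : side_vec (0 : sideT E m).
Proof. by split=> [|a x y]; [exact: tangent0|rewrite -[LHS]/(0 : R) mulr0 add0r]. Qed.

Lemma core_tensor_side0 m (x : fibre E m) : psi x 0 = 0.
Proof.
have [_ h _ _] := hpsi; have s0 := side_vec_0 m.
have := h m x 1 0 0 s0 s0; rewrite scaler0 addr0 scale1r => H.
by apply: (addrI (psi x 0)); rewrite addr0 -H.
Qed.

Lemma core_tensorZ m (x : fibre E m) (a : R) nu : side_vec nu ->
  psi (a *: x) nu = a *: psi x nu.
Proof.
move=> sn; have [h _ _ _] := hpsi.
by have := h m a x 0 nu sn; rewrite core_tensor0 // !addr0.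
Qed.

Lemma core_tensorD m (x y : fibre E m) nu : side_vec nu ->
  psi (x + y) nu = psi x nu + psi y nu.
Proof.
by move=> sn; have [h _ _ _] := hpsi; have := h m 1 x y nu sn; rewrite !scale1r.
Qed.

Lemma core_tensor_sideZ m (x : fibre E m) (a : R) nu : side_vec nu ->
  psi x (a *: nu) = a *: psi x nu.
Proof.
move=> sn; have [_ h _ _] := hpsi.
by have := h m x a nu 0 sn (side_vec_0 m); rewrite core_tensor_side0 !addr0.
Qed.

Lemma core_tensor_sideD m (x : fibre E m) nu nu' : side_vec nu -> side_vec nu' ->
  psi x (nu + nu') = psi x nu + psi x nu'.
Proof.
move=> sn sn'; have [_ h _ _] := hpsi.
by have := h m x 1 nu nu' sn sn'; rewrite !scale1r.
Qed.

Lemma side_sectionZ (f : M -> R) nu : smooth_fun f -> side_section nu ->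
  side_section (fun m => f m *: nu m : sideT E m).
Proof.
move=> sf [vn ln sn]; split; first exact: (vfieldM sf vn).
- move=> m a x y; have E' z : (f m *: nu m).2 z = f m * (nu m).2 z by [].
  by rewrite !E' ln; ring.
- by move=> e se; exact: (smooth_funM sf (sn _ se)).
Qed.

Lemma core_sectionZ (f : M -> R) tau : smooth_fun f -> core_section tau ->
  core_section (fun m => f m *: tau m : coreT E m).
Proof.
by move=> sf [st ft]; split; [exact: (esectionM sf st)|exact: (form1M sf ft)].
Qed.

(** The tensor is linear over functions in both arguments and vanishes on [(0, df)], so it does not
    disturb the rules of the base connection. Homogeneity over the reals is the case of constant
    functions, whose derivatives vanish. *)
Lemma corrected_connection_dorfman : dorfman_connection (corrected_connection psi).
Proof.
have sc a : smooth_fun (fun _ : M => a) by exact: smooth_fun_cst.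
have cstE v m (a : R) : tangent m v -> v (fun _ : M => a) = 0 by exact: tangent_cst.
have Ml f nu tau m : smooth_fun f -> side_section nu -> core_section tau ->
    corrected_connection psi (fun m => f m *: nu m) tau m =
    f m *: corrected_connection psi nu tau m + duality nu tau m *: core_d E f m.
  move=> sf sn st; rewrite /corrected_connection base_connectionMl //.
  by rewrite core_tensor_sideZ; [rewrite scalerDr addrAC|exact: side_section_vec].
have Mr f nu tau m : smooth_fun f -> side_section nu -> core_section tau ->
    corrected_connection psi nu (fun m => f m *: tau m) m =
    f m *: corrected_connection psi nu tau m + (nu m).1 f *: tau m.
  move=> sf sn st; rewrite /corrected_connection base_connectionM //.
  rewrite -[(f m *: tau m).1]/(f m *: (tau m).1).
  by rewrite core_tensorZ; [rewrite scalerDr addrAC|exact: side_section_vec].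
split.
  move=> nu tau sn st; apply: core_sectionD; first exact: core_section_base.
  by have [_ _ h _] := hpsi; apply: h => //; case: st.
split=> //.
- move=> a nu nu' tau sn sn' st m.
  have := Ml (fun=> a) nu tau m (sc a) sn st.
  have -> : core_d E (fun=> a) m = 0.
    congr pair; apply/funext => v; rewrite /dfun; case: asboolP => // tv.
    by rewrite (cstE _ _ _ tv).
  rewrite scaler0 addr0 => <-; have sna := side_sectionZ (sc a) sn.
  rewrite /corrected_connection (base_connectionDl _ sna sn' st).
  rewrite core_tensor_sideD; first by rewrite addrACA.
  - exact: (side_section_vec m sna).
  - exact: (side_section_vec m sn').
- move=> a nu tau tau' sn st st' m.
  have := Mr (fun=> a) nu tau m (sc a) sn st.
  rewrite (cstE _ m); last by case: sn => -[].
  rewrite scale0r addr0 => <-; have sta := core_sectionZ (sc a) st.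
  rewrite /corrected_connection (base_connectionDr _ sn sta st').
  rewrite -[(a *: tau m + tau' m).1]/((a *: tau m).1 + (tau' m).1).
  by rewrite core_tensorD; [rewrite addrACA|exact: side_section_vec].
- by move=> f nu tau sf sn st m; exact: Mr.
- by move=> f nu tau sf sn st m; exact: Ml.
- move=> f nu sf sn m; rewrite /corrected_connection base_connection_d //.
  by rewrite core_tensor0 ?addr0 //; exact: side_section_vec.
Qed.

(** Found by solving the duality equation. The Lie bracket and the two dual derivatives come from
    the base connection and are visibly antisymmetric; skewness thus rests on the last term, that is
    on the skewness of [psi]. *)
Definition corrected_bracket (nu1 nu2 : forall m, sideT E m) (m : M) : sideT E m :=
  (lie (fun p => (nu1 p).1) (fun p => (nu2 p).1) m,
   fun x => codiff (fun m => (nu2 m).2) x (nu1 m).1 -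
            codiff (fun m => (nu1 m).2) x (nu2 m).1 -
            dpair (nu2 m) (psi x (nu1 m))).

Lemma corrected_bracketP :
  dual_dull_bracket (corrected_connection psi) corrected_bracket.
Proof.
move=> nu1 nu2 sn1 sn2; have [v1 l1 s1] := sn1; have [v2 l2 s2] := sn2.
have d1 := side_section_dual sn1; have d2 := side_section_dual sn2.
have [px _ sp _] := hpsi.
split.
  split; first exact: (vfield_lie v1 v2).
  - move=> m a x y; rewrite /corrected_bracket /= !codiff_lincomb.
    rewrite px /dpair; last exact: side_section_vec.
    have -> (t t' : coreT E m) : (a *: t + t').1 = a *: t.1 + t'.1 by [].
    have -> (t t' : coreT E m) v : (a *: t + t').2 v = a * t.2 v + t'.2 v by [].
    by rewrite l2; ring.
  - move=> e se; have c1 := smooth_codiff d2 se v1; have c2 := smooth_codiff d1 se v2.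
    exact: (smooth_funB (smooth_funB c1 c2) (smooth_duality sn2 (sp _ _ se sn1))).
move=> tau [st ft] m; have [cft sft] := ft.
have vm := v1.1 m.
rewrite /duality (tangentD vm (s2 _ st) (sft _ v2)).
rewrite (nabla_dual vm st d2).
rewrite /corrected_connection /corrected_bracket /=.
rewrite -[(_ + (psi _ _).2) _]/(lie_form (fun p => (nu1 p).1) (fun p => (tau p).2) m (nu2 m).1 +
  codform (fun m => (nu1 m).2) (tau m).1 (nu2 m).1 + (psi (tau m).1 (nu1 m)).2 (nu2 m).1).
rewrite (dualD _ _ d2) (lie_form_eval m v1 ft v2) codformE; last exact: v2.1.
by rewrite /lie_eval /dpair; ring.
Qed.

Lemma corrected_connection_skew : skew_symmetric (corrected_connection psi).
Proof.
exists corrected_bracket; first exact: corrected_bracketP.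
move=> nu1 nu2 sn1 sn2 m; have [_ _ _ sk] := hpsi.
rewrite /corrected_bracket; congr pair; first exact: lie_anti.
apply/funext => x; rewrite (sk m x (nu1 m) (nu2 m)); [|exact: side_section_vec..].
set B := fun _ : fibre E m => _; rewrite -[RHS]/(- B x) /B.
by ring.
Qed.

(** On [(e, 0)] the Lie derivative drops out. What remains is [nabla e], the vertical part of the
    tangent map of [e], and the dual derivative of the form, by which the differential of its linear
    function differs from the form composed with the connector. *)
Lemma corrected_liftP : horizontal_lift (corrected_connection psi) (corrected_lift psi).
Proof.
move=> nu e sn se m; have [vn _ _] := sn; have dn := side_section_dual sn.
rewrite /corrected_lift /qE /pt incK /= -/(pt (e m)).
set w := psi _ _.
have -> : corrected_connection psi nu (fun x => (e x, 0)) m =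
    (nabla (nu m).1 e m, codform (fun m => (nu m).2) (e m)) + w.
  by rewrite /corrected_connection /base_connection /= (lie_form0 _ vn) add0r.
set t := (nabla _ _ _, _).
have -> : core_up (t + w) (e m) = core_up t (e m) + core_up w (e m).
  by have := core_up_lincomb (e m) 1 t w; rewrite !scale1r.
rewrite opprD addrA; congr (_ - _); apply/esym/eqP; rewrite subr_eq; apply/eqP.
congr pair; first exact: (push_section_decomp se (vn.1 m)).
apply/funext => v.
rewrite -[RHS]/((sigma (e m) (nu m)).2 v + (core_up t (e m)).2 v) /dfun.
case: asboolP => [tv|nv]; last by rewrite /sigma /core_up /=; case: asboolP => //; rewrite addr0.
rewrite sigma2E // core_up2E // /t /= codformE; last exact: (tangent_qE_pt tv).
exact: (tangent_ell_codiff tv dn).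
Qed.

End CoreTensor.

(** * Linear generalised complex structures *)

Section GeneralisedComplex.
Context (J : E -> gvec E -> gvec E) (j : forall m, sideT E m -> sideT E m)
  (hJ : linear_gcs J j).

Let tJ m (x : fibre E m) xi : gtangent (pt x) xi -> gtangent (pt x) (J (pt x) xi).
Proof. by case: hJ => -[[h _ _] _ _ _] _; exact: h. Qed.

Let linJ m (x : fibre E m) a xi eta : gtangent (pt x) xi -> gtangent (pt x) eta ->
  J (pt x) (a *: xi + eta) = a *: J (pt x) xi + J (pt x) eta.
Proof. by case: hJ => -[[_ h _] _ _ _] _; exact: h. Qed.

Let JJ m (x : fibre E m) xi : gtangent (pt x) xi -> J (pt x) (J (pt x) xi) = - xi.
Proof. by case: hJ => -[_ h _ _] _; exact: h. Qed.

Let projJ m (x : fibre E m) xi : gtangent (pt x) xi ->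
  side_proj x (J (pt x) xi) = j (side_proj x xi).
Proof. by case: hJ => _ [h _ _]; exact: h. Qed.

(** For an orthogonal map with square -1 the adjoint is its inverse, which is its negative. *)
Lemma gcs_skew m (x : fibre E m) xi eta : gtangent (pt x) xi -> gtangent (pt x) eta ->
  gpair (J (pt x) xi) eta = - gpair xi (J (pt x) eta).
Proof.
move=> tx te; have [[_ _ orth _] _] := hJ.
rewrite -(orth _ _ _ (tJ tx) te) JJ // /gpair; have [_ cJ] := tJ te.
rewrite -[(- xi).2 _]/(- xi.2 _) -[(- xi).1]/(- xi.1) -(scaleN1r xi.1).
by rewrite (cotangentZ_at _ cJ) ?mulN1r ?opprD //; exact: tx.1.
Qed.

Let JD m (x : fibre E m) xi eta : gtangent (pt x) xi -> gtangent (pt x) eta ->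
  J (pt x) (xi + eta) = J (pt x) xi + J (pt x) eta.
Proof. by move=> t1 t2; have := linJ 1 t1 t2; rewrite !scale1r. Qed.

(** Properties of [j] are inherited from [J] by lifting to the fibre over the zero vector with
    [sigma] and projecting back. *)
Lemma side_vec_j m (nu : sideT E m) : side_vec nu -> side_vec (j nu).
Proof.
move=> sn; have tn := gtangent_sigma (0 : fibre E m) sn.
by rewrite -(side_proj_sigma 0 sn) -projJ //; apply: side_vec_proj; exact: tJ.
Qed.

Lemma j_lincomb m (a : R) (nu nu' : sideT E m) : side_vec nu -> side_vec nu' ->
  j (a *: nu + nu') = a *: j nu + j nu'.
Proof.
move=> sn sn'; have tn := gtangent_sigma (0 : fibre E m) sn.
have tn' := gtangent_sigma (0 : fibre E m) sn'; have sl := side_vec_lincomb a sn sn'.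
have tl := gtangent_sigma (0 : fibre E m) sl.
rewrite -{1}(side_proj_sigma 0 sl) -(projJ tl) sigma_lincomb // linJ //.
by rewrite side_proj_lincomb !projJ // !side_proj_sigma.
Qed.

Lemma jj m (nu : sideT E m) : side_vec nu -> j (j nu) = - nu.
Proof.
move=> sn; have tn := gtangent_sigma (0 : fibre E m) sn.
rewrite -{1}(side_proj_sigma 0 sn) -(projJ tn) -(projJ (tJ tn)) JJ //.
have := side_proj_lincomb (0 : fibre E m) (-1) (sigma 0 nu) 0.
rewrite !scaleN1r addr0 => ->; rewrite side_proj_sigma //.
suff -> : side_proj (0 : fibre E m) 0 = 0 by rewrite addr0.
by rewrite /side_proj push0.
Qed.

(** The [Phi] of the overview: it measures how far [sigma] is from intertwining [j] and [J]. *)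
Definition defect m (x : fibre E m) (nu : sideT E m) : coreT E m :=
  core_part x (J (pt x) (sigma x nu)).

Lemma cotangent_defect m (x : fibre E m) nu : side_vec nu ->
  cotangent m (defect x nu).2.
Proof. by move=> sn; apply: cotangent_core_part; apply: tJ; exact: gtangent_sigma. Qed.

Lemma gcs_sigma m (x : fibre E m) nu : side_vec nu ->
  J (pt x) (sigma x nu) = sigma x (j nu) + core_up (defect x nu) x.
Proof.
move=> sn; have tn := gtangent_sigma x sn.
by rewrite [LHS](gvec_decomp (tJ tn)) projJ // side_proj_sigma.
Qed.

Lemma core_up0 m (x : fibre E m) : core_up (0 : coreT E m) x = 0.
Proof.
have := core_up_lincomb x 1 (0 : coreT E m) 0; rewrite scaler0 addr0 scale1r => H.
by apply: (addrI (core_up (0 : coreT E m) x)); rewrite addr0 -H.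
Qed.

Lemma core_upN m (x : fibre E m) (tau : coreT E m) : core_up (- tau) x = - core_up tau x.
Proof.
by have := core_up_lincomb x (-1) tau 0; rewrite core_up0 !addr0 !scaleN1r.
Qed.

Lemma sigmaN m (x : fibre E m) nu : side_vec nu -> sigma x (- nu) = - sigma x nu.
Proof.
move=> sn; have := sigma_lincomb x (-1) sn (side_vec_0 m); rewrite addr0 !scaleN1r => ->.
suff -> : sigma x (0 : sideT E m) = 0 by rewrite addr0.
have s0 := side_vec_0 m; have := sigma_lincomb x 1 s0 s0.
rewrite scaler0 addr0 scale1r => H.
by apply: (addrI (sigma x (0 : sideT E m))); rewrite addr0 -H.
Qed.

(** Apply [J] once more to the decomposition of [J (sigma nu)]; the two side parts cancel by
    [j^2 = -1]. Core elements of this form are the only ones that occur in the corrected lift. *)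
Lemma gcs_core m (x : fibre E m) nu : side_vec nu ->
  J (pt x) (core_up (defect x nu) x) = - core_up (defect x (j nu)) x.
Proof.
move=> sn; have sj := side_vec_j sn; have tn := gtangent_sigma x sn.
have tc := gtangent_core_up x (cotangent_defect x sn).
have := JJ tn; rewrite (gcs_sigma x sn) JD //; last exact: gtangent_sigma.
rewrite (gcs_sigma x sj) jj // sigmaN // -addrA => H.
apply/eqP; rewrite -addr_eq0 addrC; apply/eqP.
by apply: (addrI (- sigma x nu)); rewrite H addr0.
Qed.

(** Skewness of [J] is applied to a lift and a core element. Both images are known, and isotropy of
    the core removes the remaining term. *)
Lemma dpair_defect_j m (x : fibre E m) nu nu' : side_vec nu -> side_vec nu' ->
  dpair nu' (defect x (j nu)) = dpair (j nu') (defect x nu).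
Proof.
move=> sn sn'; have sj := side_vec_j sn; have sj' := side_vec_j sn'.
have ts := gtangent_sigma x sn'; have tc := gtangent_core_up x (cotangent_defect x sn).
have tcj := gtangent_core_up x (cotangent_defect x sj).
have tsj := gtangent_sigma x sj'; have tc' := gtangent_core_up x (cotangent_defect x sn').
have := gcs_skew ts tc; rewrite (gcs_sigma x sn') gcs_core //.
rewrite (gpairD tsj tc' tc) gpair_sigma_core // gpair_core; [|exact: cotangent_defect..].
rewrite addr0 => ->; rewrite -core_upN gpair_sigma_core // /dpair.
have -> : (- defect x (j nu)).1 = (-1) *: (defect x (j nu)).1 by rewrite scaleN1r.
by rewrite (side_vecZ _ _ sn') -[(- defect _ _).2 _]/(- (defect x (j nu)).2 _); ring.
Qed.

(** Skewness of [J] on two lifts: since lifts are isotropic, only the core parts of their images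
    contribute. *)
Lemma dpair_defect_skew m (x : fibre E m) nu nu' : side_vec nu -> side_vec nu' ->
  dpair nu' (defect x nu) = - dpair nu (defect x nu').
Proof.
move=> sn sn'; have sj := side_vec_j sn; have sj' := side_vec_j sn'.
have [[_ _ orth _] _] := hJ.
have ts := gtangent_sigma x sn; have tc := gtangent_core_up x (cotangent_defect x sn).
have ts' := gtangent_sigma x sn'; have tc' := gtangent_core_up x (cotangent_defect x sn').
have tsj := gtangent_sigma x sj; have tsj' := gtangent_sigma x sj'.
have := gcs_skew ts ts'; rewrite !gcs_sigma // (gpairD tsj tc ts').
rewrite (gpairC (sigma x nu)) (gpairD tsj' tc' ts) !gpair_sigma // !add0r.
by rewrite !(gpairC (core_up _ _)) !gpair_sigma_core.
Qed.

Lemma defect_lincombr m (x : fibre E m) (a : R) nu nu' : side_vec nu -> side_vec nu' ->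
  defect x (a *: nu + nu') = a *: defect x nu + defect x nu'.
Proof.
move=> sn sn'; have sl := side_vec_lincomb a sn sn'.
have c1 := cotangent_defect x sn; have c2 := cotangent_defect x sn'.
have t1 := gtangent_core_up x c1; have t2 := gtangent_core_up x c2.
have sj := side_vec_j sn; have sj' := side_vec_j sn'.
(* It is enough to compare core elements, as [core_part] is a left inverse of [core_up] on cotangent
   values. *)
have H : core_up (defect x (a *: nu + nu')) x = core_up (a *: defect x nu + defect x nu') x.
  rewrite core_up_lincomb; apply: (addrI (sigma x (j (a *: nu + nu')))).
  rewrite -gcs_sigma // sigma_lincomb // linJ //; [|exact: gtangent_sigma..].
  rewrite !gcs_sigma // j_lincomb // sigma_lincomb //.
  by rewrite scalerDr addrACA.
have cl : cotangent m (a *: defect x nu + defect x nu').2.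
  exact: (cotangent_lincomb a c1 c2).
rewrite -(core_part_core_up x (cotangent_defect x sl)) H.
by rewrite core_part_core_up.
Qed.

Lemma defectD m (x y : fibre E m) nu : side_vec nu ->
  defect (x + y) nu = defect x nu + defect y nu.
Proof.
move=> sn; have [_ [_ h _]] := hJ.
have H := h m x y _ _ _ (gtangent_sigma x sn) (gtangent_sigma y sn)
  (gtangent_sigma (x + y) sn) (gsum_sigma x y sn).
exact: (gsum_core_part H).
Qed.

Lemma defectZ m (x : fibre E m) (a : R) nu : side_vec nu ->
  defect (a *: x) nu = a *: defect x nu.
Proof.
move=> sn; have [_ [_ _ h]] := hJ.
have H := h m x a _ _ (gtangent_sigma x sn) (gtangent_sigma (a *: x) sn)
  (gscale_sigma a x sn).
by apply: (gscale_core_part _ H); apply: tJ; exact: gtangent_sigma.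
Qed.

Lemma side_section_j nu : side_section nu -> side_section (fun m => j (nu m)).
Proof.
move=> sn; have [[[_ _ h] _ _ _] _] := hJ.
have := side_section_proj (h _ (gsection_sigma sn)).
rewrite (_ : (fun m => _) = fun m => j (nu m)) //.
apply: functional_extensionality_dep => m.
rewrite /pt /qE incK /= -/(pt (0 : fibre E m)).
have snm := side_section_vec m sn.
by rewrite projJ ?side_proj_sigma //; exact: gtangent_sigma.
Qed.

Lemma core_section_defect e nu : esection e -> side_section nu ->
  core_section (fun m => defect (e m) (nu m)).
Proof.
move=> se sn; have [[[_ _ h] _ _ _] _] := hJ.
have := core_section_part se (h _ (gsection_sigma sn)).
rewrite (_ : (fun m => _) = fun m => defect (e m) (nu m)) //.
apply: functional_extensionality_dep => m.
by rewrite /defect /pt /qE incK.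
Qed.

(* J maps sigma nu - a core (defect (j nu)) to sigma (j nu) + (1 - a) core (defect nu),
   which is to be sigma (j nu) + a core (defect nu): hence a = 1/2. *)
Definition half_defect m (x : fibre E m) (nu : sideT E m) : coreT E m :=
  2^-1 *: defect x (j nu).

Lemma half_defect_tensor : core_tensor half_defect.
Proof.
split.
- move=> m a x y nu sn; have sj := side_vec_j sn.
  by rewrite /half_defect defectD // defectZ // scalerDr !scalerA mulrC.
- move=> m x a nu nu' sn sn'; have sj := side_vec_j sn; have sj' := side_vec_j sn'.
  by rewrite /half_defect j_lincomb // defect_lincombr // scalerDr !scalerA mulrC.
- move=> e nu se sn; apply: (core_sectionZ (f := fun=> 2^-1)).
    exact: smooth_fun_cst.
  by apply: core_section_defect => //; exact: side_section_j.
- move=> m x nu nu' sn sn'; have sj := side_vec_j sn; have sj' := side_vec_j sn'.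
  have dZ (mu : sideT E m) tau : side_vec mu ->
      dpair mu (2^-1 *: tau) = 2^-1 * dpair mu tau.
    move=> smu; rewrite /dpair -[(2^-1 *: tau).1]/(2^-1 *: tau.1).
    by rewrite (side_vecZ _ _ smu) -[(2^-1 *: tau).2 _]/(2^-1 * tau.2 _); ring.
  rewrite /half_defect !dZ // dpair_defect_j // dpair_defect_skew //.
  (* Moving [j] across the pairing and then using skewness gives [<nu', Phi (j nu)> = <j nu', Phi
     nu> = - <nu, Phi (j nu')>]. *)
  by rewrite mulrN.
Qed.

Lemma gcs_corrected_lift nu p : side_section nu ->
  J p (corrected_lift half_defect nu p) = corrected_lift half_defect (fun m => j (nu m)) p.
Proof.
move=> sn; rewrite /corrected_lift.
(* Every [pt] except the argument of [J] is unfolded, so that [incK] reduces the base point and the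
   fibre element of [pt x]. *)
move: p; apply: pt_ind => m x; rewrite /qE {2 3 4 5 6 7 8}/pt incK /=.
have snm := side_section_vec m sn; have sj := side_vec_j snm.
move: (nu m) snm sj => mu smu sj.
have sjj := side_vec_j sj.
have tc := gtangent_core_up x (cotangent_defect x sj).
have ts := gtangent_sigma x smu.
have Z tau : core_up (2^-1 *: tau) x = 2^-1 *: core_up tau x.
  by have := core_up_lincomb x 2^-1 tau 0; rewrite core_up0 !addr0.
rewrite /half_defect !Z.
have -> : sigma x mu - 2^-1 *: core_up (defect x (j mu)) x =
   (- 2^-1) *: core_up (defect x (j mu)) x + sigma x mu by rewrite scaleNr addrC.
rewrite linJ // gcs_sigma // gcs_core // jj //.
have -> : defect x (- mu) = - defect x mu.
  have s0 := side_vec_0 m; have := defect_lincombr x (-1) smu s0.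
  rewrite !scaleN1r addr0 => ->.
  have := defect_lincombr x 1 s0 s0; rewrite scaler0 addr0 scale1r => H.
  suff -> : defect x 0 = 0 by rewrite addr0.
  by apply: (addrI (defect x 0)); rewrite addr0 -H.
rewrite !core_upN opprK scalerN opprK addrCA; congr (_ + _).
rewrite -[X in _ + X]scale1r -scalerDl; congr (_ *: _).
by lra.
Qed.

End GeneralisedComplex.

End Connector.

Theorem proposition4p7 (R : realType) (n k : nat) (M : manifold R n)
    (E : vbundle M k) (J : E -> gvec E -> gvec E)
    (j : forall m : M, sideT E m -> sideT E m) (hJ : linear_gcs J j) :
  exists2 D : connection_type E,
    dorfman_connection D /\ skew_symmetric D &
    exists2 sg, horizontal_lift D sg &
      forall nu : (forall m : M, sideT E m), side_section nu ->
        forall p : E, J p (sg nu p) = sg (fun m => j m (nu m)) p.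
Proof.
have [I [l [s [r fr]]]] := @global_frame _ _ _ _ E.
have hpsi := half_defect_tensor fr hJ.
exists (corrected_connection l s r (half_defect l s r J j)).
  split; first exact: corrected_connection_dorfman.
  exact: corrected_connection_skew.
exists (corrected_lift l s r (half_defect l s r J j)).
  exact: corrected_liftP.
by move=> nu sn p; exact: gcs_corrected_lift.
Qed.
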